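(* Let $m,n>1$, $1\le k\le\min\{m,n\}$ and $\Phi\in L^{\infty}(\mathbb{M}_{m,n})$. Then $\Phi$ has a $k$-extremal function if and only if the Hankel-type operator $H^{\{k\}}_{\Phi}: H^{2}(\mathbb{M}_{n,k})\rightarrow L^{2}(\boldsymbol{S}_{1}^{m,k})/H^{2}(\boldsymbol{S}_{1}^{m,k})$ has a maximizing vector.
   Context: $\mathbb{T}$ is the unit circle and $\boldsymbol{m}$ is normalized Lebesgue measure on $\mathbb{T}$. $\mathbb{M}_{m,n}$ is the space of complex $m\times n$ matrices with the operator norm. For $A\in\mathbb{M}_{m,n}$ and $j\ge0$, $s_j(A)=\inf\{\|A-B\|_{\mathbb{M}_{m,n}}:\operatorname{rank}B\le j\}$; $\boldsymbol{S}_{1}^{m,n}$ denotes $\mathbb{M}_{m,n}$ with the trace norm $\|A\|_{\boldsymbol{S}_1^{m,n}}=\sum_{j\ge0}s_j(A)$. For a normed function space $X$ on $\mathbb{T}$ ($L^p$, $H^p$, $H^p_0=\{f\in H^p: \hat f(0)=0\}$), $X(\mathbb{M}_{m,n})$ (resp. $X(\boldsymbol{S}_1^{m,n})$) is the space of $m\times n$ matrix functions with entries in $X$, normed by the $X$-norm of $\zeta\mapsto\|\Phi(\zeta)\|_{\mathbb{M}_{m,n}}$ (resp. $\|\Phi(\zeta)\|_{\boldsymbol{S}_1^{m,n}}$). Let \[\mathcal{A}_k^{n,m}=\{\Psi\in H^1_0(\mathbb{M}_{n,m}):\ \|\Psi\|_{L^1(\mathbb{M}_{n,m})}\le1,\ \operatorname{rank}\Psi(\zeta)\le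 k \text{ a.e.}\},\] $\sigma_k(\Phi)=\sup_{\Psi\in\mathcal{A}_k^{n,m}}\left|\int_{\mathbb{T}}\operatorname{trace}(\Phi\Psi)\,d\boldsymbol{m}\right|$. A $k$-extremal function for $\Phi$ is a $\Psi\in\mathcal{A}_k^{n,m}$ with $\int_{\mathbb{T}}\operatorname{trace}(\Phi(\zeta)\Psi(\zeta))\,d\boldsymbol{m}(\zeta)=\sigma_k(\Phi)$. The Hankel-type operator is $H_\Phi^{\{k\}}F=\rho(\Phi F)$ for $F\in H^2(\mathbb{M}_{n,k})$, where $\rho:L^2(\boldsymbol{S}_1^{m,k})\to L^2(\boldsymbol{S}_1^{m,k})/H^2(\boldsymbol{S}_1^{m,k})$ is the quotient map and the quotient carries the quotient norm. A maximizing vector of a bounded operator $T:X\to Y$ is a nonzero $x\in X$ with $\|Tx\|_Y=\|T\|\,\|x\|_X$. *)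

(* Defs.v *)
From HB Require Import structures.
From mathcomp Require Import all_boot all_order all_algebra.
From mathcomp Require Import all_classical all_reals all_analysis.
From mathcomp Require Import complex.
Set Implicit Arguments. Unset Strict Implicit. Unset Printing Implicit Defensive.
Import Order.TTheory GRing.Theory Num.Theory.
Import numFieldNormedType.Exports.
Local Open Scope classical_set_scope.
Local Open Scope ring_scope.

(* The unit circle T is parametrized by t in [0,1] via zeta = exp(2 pi i t);
   normalized Lebesgue measure m on T corresponds to Lebesgue measure on [0,1]. *)
Section Defs.
Variable R : realType.
Local Notation C := (R[i]).
Local Notation mu := (@lebesgue_measure R).

Definition Tdom : set R := `[0%R, 1%R].

Definition cabs2 (z : C) : R := complex.Re z ^+ 2 + complex.Im z ^+ 2.
Definition cabs (z : C) : R := Num.sqrt (cabs2 z).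

Definition vnorm (p : nat) (v : 'cV[C]_p) : R := Num.sqrt (\sum_i cabs2 (v i 0)).

Definition opnorm (m n : nat) (A : 'M[C]_(m, n)) : R :=
  sup [set vnorm (A *m v) | v in [set v : 'cV[C]_n | vnorm v <= 1]].

Definition sing_val (m n : nat) (A : 'M[C]_(m, n)) (j : nat) : R :=
  inf [set opnorm (A - B) | B in [set B : 'M[C]_(m, n) | (\rank B <= j)%N]].

(* trace norm: sum_{j >= 0} s_j(A); s_j(A) = 0 for j >= min(m,n) >= rank A *)
Definition trnorm (m n : nat) (A : 'M[C]_(m, n)) : R :=
  \sum_(j < minn m n) sing_val A j.

Definition cint (f : R -> C) : C :=
  Complex (\int[mu]_(t in Tdom) complex.Re (f t)) (\int[mu]_(t in Tdom) complex.Im (f t)).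

Definition expi (x : R) : C := Complex (cos x) (sin x).

Definition fourier (f : R -> C) (j : int) : C :=
  cint (fun t => f t * expi (- (2 * pi * j%:~R * t))).

Definition cmeas (f : R -> C) : Prop :=
  measurable_fun Tdom (fun t => complex.Re (f t)) /\ measurable_fun Tdom (fun t => complex.Im (f t)).

Definition Lp (p : nat) (f : R -> C) : Prop :=
  cmeas f /\ (\int[mu]_(t in Tdom) ((cabs (f t)) ^+ p)%:E < +oo)%E.
Definition Linf (f : R -> C) : Prop :=
  cmeas f /\ exists M : R, {ae mu, forall t, Tdom t -> cabs (f t) <= M}.
Definition Hp (p : nat) (f : R -> C) : Prop :=
  Lp p f /\ forall j : int, j < 0 -> fourier f j = 0.
Definition Hp0 (p : nat) (f : R -> C) : Prop := Hp p f /\ fourier f 0 = 0.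

Definition entrywise (m n : nat) (X : (R -> C) -> Prop) (F : R -> 'M[C]_(m, n)) : Prop :=
  forall i j, X (fun t => F t i j).

Definition L1nrm (g : R -> R) : \bar R := (\int[mu]_(t in Tdom) (`|g t|)%:E)%E.
Definition L2nrm (g : R -> R) : \bar R :=
  match (\int[mu]_(t in Tdom) ((g t) ^+ 2)%:E)%E with
  | r%:E => (Num.sqrt r)%:E
  | _ => +oo%E
  end.

Definition L1M (m n : nat) (F : R -> 'M[C]_(m, n)) : \bar R := L1nrm (fun t => opnorm (F t)).
Definition L2M (m n : nat) (F : R -> 'M[C]_(m, n)) : \bar R := L2nrm (fun t => opnorm (F t)).
Definition L2S1 (m n : nat) (F : R -> 'M[C]_(m, n)) : \bar R := L2nrm (fun t => trnorm (F t)).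

Definition Acal (k n m : nat) (Psi : R -> 'M[C]_(n, m)) : Prop :=
  entrywise (Hp0 1) Psi /\ (L1M Psi <= 1%:E)%E /\
  {ae mu, forall t, Tdom t -> (\rank (Psi t) <= k)%N}.

Definition pairing (m n : nat) (Phi : R -> 'M[C]_(m, n)) (Psi : R -> 'M[C]_(n, m)) : C :=
  cint (fun t => \tr (Phi t *m Psi t)).

Definition sigma_k (k m n : nat) (Phi : R -> 'M[C]_(m, n)) : \bar R :=
  ereal_sup [set (cabs (pairing Phi Psi))%:E | Psi in [set Psi | @Acal k n m Psi]].

Definition k_extremal (k m n : nat) (Phi : R -> 'M[C]_(m, n)) (Psi : R -> 'M[C]_(n, m)) : Prop :=
  @Acal k n m Psi /\
  (complex.Re (pairing Phi Psi))%:E = sigma_k k Phi /\ complex.Im (pairing Phi Psi) = 0.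

Definition qnorm (m k : nat) (G : R -> 'M[C]_(m, k)) : \bar R :=
  ereal_inf [set L2S1 (fun t => G t - F t) | F in [set F | entrywise (Hp 2) F]].

(* H_Phi^{k} F = rho(Phi F) *)
Definition hankelk (k m n : nat) (Phi : R -> 'M[C]_(m, n)) (F : R -> 'M[C]_(n, k)) :
  R -> 'M[C]_(m, k) := fun t => Phi t *m F t.

Definition hankel_norm (k m n : nat) (Phi : R -> 'M[C]_(m, n)) : \bar R :=
  ereal_sup [set qnorm (@hankelk k m n Phi F) |
             F in [set F | entrywise (Hp 2) F /\ (L2M F <= 1%:E)%E]].

Definition maximizing_vector (k m n : nat) (Phi : R -> 'M[C]_(m, n)) (F : R -> 'M[C]_(n, k)) : Prop :=
  entrywise (Hp 2) F /\ L2M F <> 0%E /\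
  qnorm (@hankelk k m n Phi F) = (hankel_norm k Phi * L2M F)%E.

End Defs.

(* Main.v *)
(* The norm of the Hankel-type operator equals [sigma_k Phi], by two facts.
   Factorization: every [Psi] in H^1_0 of rank at most [k] is [F G] with [F] an n x k function in
   H^2, [G] a k x m function in H^2_0, and |F|^2, |G|^2 <= |Psi| pointwise. Indeed, put
   W = |Psi|^(-1/2) Psi and let [M_l] be the closed span of the [z^i W_j], [i >= l], in L^2. Elements
   of [M_(-1)] orthogonal to [M_0] have constant pointwise inner products; a maximal
   pointwise-orthonormal family T of them has at most [k] members and satisfies T T^* W = W, so
   F = |Psi|^(1/2) T and G = T^* W work.
   Duality: by Hahn-Banach and the Riesz theorem, the distance of [X] to H^2 in L^2(S_1) is the
   maximum of Re \int tr(X G) over [G] in H^2_0 with |G|_{L^2} <= 1.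
   If [Psi] is extremal, its factor [F] is therefore maximizing; conversely, if [F] is maximizing of
   norm [c] and [G] is dual to [Phi F], then c^(-1) F G is extremal. *)
Require Import Defs.
From HB Require Import structures.
From mathcomp Require Import all_boot all_order all_algebra.
From mathcomp Require Import all_classical all_reals all_analysis.
From mathcomp Require Import measurable_realfun perm complex ring lra zify.
Import Order.TTheory GRing.Theory Num.Theory.
Import numFieldNormedType.Exports.
Set Implicit Arguments. Unset Strict Implicit. Unset Printing Implicit Defensive.
Local Open Scope classical_set_scope.
Local Open Scope ring_scope.

(** * Complex matrices and the operator norm *)

(** The factorization is a Wold decomposition of multiplication by z on M_(-1). Purity of this shift
    is where H^1_0 enters: multiplication by |Psi|^(1/2) turns W back into Psi, so an element of
    every M_l becomes an integrable function all of whose Fourier coefficients vanish. Hence the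
    need for uniqueness of Fourier coefficients in L^1, not only in L^2. The two indices -1 and 0
    place the constant term: T lies in M_(-1), which lets |Psi|^(1/2) T have a mean, and T is
    orthogonal to M_0, which gives the adjoint of T times W mean zero. In the duality, L^2(S_1) is
    not a Hilbert space, but its norm is dominated by the Hilbert-Schmidt one, so the Hahn-Banach
    functional has a Riesz representative G. The sharp bound on the operator norm of G must then be
    recovered by testing on functions that nearly attain this norm pointwise; they are chosen
    measurably by a greedy search through a countable set of matrices. If sigma_k = 0, the factor F
    of an extremal function may vanish, while a maximizing vector must not; a constant function
    replaces it. *)

Section ComplexNumbers.
Variable R : realType.
Local Notation C := (R[i]).
Implicit Types (x y z : C).

Lemma ReM x y : complex.Re (x * y) =
  complex.Re x * complex.Re y - complex.Im x * complex.Im y.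
Proof. by case: x y => a b [c d]. Qed.

Lemma ImM x y : complex.Im (x * y) =
  complex.Re x * complex.Im y + complex.Im x * complex.Re y.
Proof. by case: x y => a b [c d]. Qed.

Lemma ReZ (a : R) x : complex.Re (a%:C%C * x) = a * complex.Re x.
Proof. by rewrite ReM /= mul0r subr0. Qed.

Lemma ReD x y : complex.Re (x + y) = complex.Re x + complex.Re y.
Proof. by case: x y => a b [c d]. Qed.

Lemma ImD x y : complex.Im (x + y) = complex.Im x + complex.Im y.
Proof. by case: x y => a b [c d]. Qed.

Lemma ReN x : complex.Re (- x) = - complex.Re x.
Proof. by case: x. Qed.

Lemma ImN x : complex.Im (- x) = - complex.Im x.
Proof. by case: x. Qed.

Lemma ReJ x : complex.Re (conjc x) = complex.Re x.
Proof. by case: x. Qed.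

Lemma ImJ x : complex.Im (conjc x) = - complex.Im x.
Proof. by case: x. Qed.

Lemma eqC x y : complex.Re x = complex.Re y -> complex.Im x = complex.Im y -> x = y.
Proof. by case: x y => a b [c d] /= -> ->. Qed.

Lemma cabs2_ge0 x : 0 <= cabs2 x.
Proof. by rewrite addr_ge0 ?sqr_ge0. Qed.

Lemma cabs2_eq0 x : (cabs2 x == 0) = (x == 0).
Proof.
by case: x => a b; rewrite /cabs2 /= paddr_eq0 ?sqr_ge0 // !sqrf_eq0 eq_complex.
Qed.

Lemma cabs2E x : (cabs2 x)%:C%C = x * conjc x.
Proof. by case: x => a b; apply: eqC => /=; rewrite /cabs2 /=; ring. Qed.

Lemma cabs2M x y : cabs2 (x * y) = cabs2 x * cabs2 y.
Proof. by case: x y => a b [c d]; rewrite /cabs2 /=; ring. Qed.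

Lemma cabs2J x : cabs2 (conjc x) = cabs2 x.
Proof. by case: x => a b; rewrite /cabs2 /= sqrrN. Qed.

Lemma cabs2r (a : R) : cabs2 (a%:C%C) = a ^+ 2.
Proof. by rewrite /cabs2 /= expr0n addr0. Qed.

Lemma cabs_norm x : (cabs x)%:C%C = `|x|.
Proof. by rewrite normc_def. Qed.

Lemma cabs_ge0 x : 0 <= cabs x.
Proof. exact: sqrtr_ge0. Qed.

Lemma sqr_cabs x : cabs x ^+ 2 = cabs2 x.
Proof. by rewrite sqr_sqrtr // cabs2_ge0. Qed.

Lemma cabs0 : cabs (0 : C) = 0.
Proof. by rewrite /cabs /cabs2 /= expr0n /= addr0 sqrtr0. Qed.

Lemma cabsM x y : cabs (x * y) = cabs x * cabs y.
Proof. by rewrite /cabs cabs2M sqrtrM // cabs2_ge0. Qed.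

Lemma cabsJ x : cabs (conjc x) = cabs x.
Proof. by rewrite /cabs cabs2J. Qed.

Lemma cabsr (a : R) : cabs (a%:C%C) = `|a|.
Proof. by rewrite /cabs cabs2r sqrtr_sqr. Qed.

Lemma cabs_eq0 x : (cabs x == 0) = (x == 0).
Proof. by rewrite -cabs2_eq0 -sqr_cabs sqrf_eq0. Qed.

Lemma cabsD x y : cabs (x + y) <= cabs x + cabs y.
Proof. by rewrite -lecR rmorphD /= !cabs_norm ler_normD. Qed.

Lemma cabs_sum (I : Type) (r : seq I) (P : pred I) (F : I -> C) :
  cabs (\sum_(i <- r | P i) F i) <= \sum_(i <- r | P i) cabs (F i).
Proof.
elim/big_rec2: _ => [|i a b _ H]; first by rewrite cabs0.
exact: le_trans (cabsD _ _) (lerD _ _).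
Qed.

Lemma le_Re_cabs x : `|complex.Re x| <= cabs x.
Proof.
by rewrite -sqrtr_sqr ler_sqrt ?cabs2_ge0 // lerDl sqr_ge0.
Qed.

Lemma le_Im_cabs x : `|complex.Im x| <= cabs x.
Proof.
by rewrite -sqrtr_sqr ler_sqrt ?cabs2_ge0 // lerDr sqr_ge0.
Qed.

Lemma cabs_le_ReIm x : cabs x <= `|complex.Re x| + `|complex.Im x|.
Proof.
rewrite -[leRHS]ger0_norm ?addr_ge0 // -sqrtr_sqr ler_sqrt ?sqr_ge0 //.
rewrite sqrrD !real_normK ?num_real // /cabs2 -subr_ge0.
by rewrite [X in 0 <= X](_ : _ = (`|complex.Re x| * `|complex.Im x|) *+ 2); [rewrite mulrn_wge0 ?mulr_ge0 | ring].
Qed.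

End ComplexNumbers.

(** A quadratic polynomial without negative values has nonpositive discriminant. This is the common
    core of the Cauchy-Schwarz inequalities for matrices, for integrals and for abstract semi-inner
    products. *)
Lemma semi_CS (R : realType) (a b c : R) :
  0 <= a -> 0 <= c -> (forall t, 0 <= a - 2 * t * b + t ^+ 2 * c) -> b ^+ 2 <= a * c.
Proof.
move=> a0 c0 H; have [c1|] := ltP 0 c.
  have := H (b / c); rewrite [X in 0 <= X](_ : _ = (a * c - b ^+ 2) / c); last first.
    by field; rewrite gt_eqF.
  by rewrite pmulr_lge0 ?invr_gt0 // subr_ge0.
move=> c1; have {c1 c0} c0 : c = 0 by apply/eqP; rewrite eq_le c0 c1.
subst c; rewrite mulr0; have [->|b0] := eqVneq b 0; first by rewrite expr0n.
(* For [c = 0] the polynomial is affine in [t]; at this point it takes the value -1. *)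
have := H ((a + 1) / (2 * b)).
by rewrite [X in 0 <= X](_ : _ = -1) ?oppr_ge0 ?ler10 //; field; rewrite b0.
Qed.

Section Matrices.
Variable R : realType.
Local Notation C := (R[i]).

Definition star m n (A : 'M[C]_(m, n)) : 'M[C]_(n, m) := map_mx (@conjc R) A^T.

Lemma starE m n (A : 'M[C]_(m, n)) i j : star A i j = conjc (A j i).
Proof. by rewrite !mxE. Qed.

Lemma starK m n (A : 'M[C]_(m, n)) : star (star A) = A.
Proof. by apply/matrixP => i j; rewrite !starE conjcK. Qed.

Lemma starM m n p (A : 'M[C]_(m, n)) (B : 'M[C]_(n, p)) :
  star (A *m B) = star B *m star A.
Proof. by rewrite /star trmx_mul map_mxM. Qed.

Lemma starD m n (A B : 'M[C]_(m, n)) : star (A + B) = star A + star B.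
Proof. by rewrite /star linearD /= map_mxD. Qed.

Lemma starZ m n (c : C) (A : 'M[C]_(m, n)) : star (c *: A) = conjc c *: star A.
Proof. by rewrite /star linearZ /= map_mxZ. Qed.

Lemma star0 m n : star (0 : 'M[C]_(m, n)) = 0.
Proof. by rewrite /star trmx0 map_mx0. Qed.

Lemma tr_star n (A : 'M[C]_n) : \tr (star A) = conjc (\tr A).
Proof. by rewrite /mxtrace rmorph_sum; apply: eq_bigr => i _; rewrite starE. Qed.

Definition nrm2 m n (A : 'M[C]_(m, n)) : R := \sum_i \sum_j cabs2 (A i j).

Definition dotr m n (A B : 'M[C]_(m, n)) : R := complex.Re (\tr (A *m star B)).

Lemma nrm2_ge0 m n (A : 'M[C]_(m, n)) : 0 <= nrm2 A.
Proof. by apply: sumr_ge0 => i _; apply: sumr_ge0 => j _; exact: cabs2_ge0. Qed.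

Lemma nrm2E m n (A : 'M[C]_(m, n)) : (nrm2 A)%:C%C = \tr (A *m star A).
Proof.
rewrite rmorph_sum /=; apply: eq_bigr => i _; rewrite mxE rmorph_sum.
by apply: eq_bigr => j _; rewrite starE -cabs2E.
Qed.

Lemma nrm2_dotr m n (A : 'M[C]_(m, n)) : nrm2 A = dotr A A.
Proof. by rewrite /dotr -nrm2E. Qed.

Lemma nrm2_star m n (A : 'M[C]_(m, n)) : nrm2 (star A) = nrm2 A.
Proof.
by apply: (@complexI R); rewrite nrm2E starK mxtrace_mulC -nrm2E.
Qed.

Lemma dotrC m n (A B : 'M[C]_(m, n)) : dotr A B = dotr B A.
Proof. by rewrite /dotr -ReJ -tr_star starM starK. Qed.

Lemma dotrDl m n (A B D : 'M[C]_(m, n)) : dotr (A + B) D = dotr A D + dotr B D.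
Proof. by rewrite /dotr mulmxDl linearD ReD. Qed.

Lemma dotrZl m n (a : R) (A D : 'M[C]_(m, n)) : dotr (a%:C%C *: A) D = a * dotr A D.
Proof. by rewrite /dotr -scalemxAl linearZ /= ReM /= mul0r subr0. Qed.

Lemma nrm2Z m n (c : C) (A : 'M[C]_(m, n)) : nrm2 (c *: A) = cabs2 c * nrm2 A.
Proof.
rewrite /nrm2 mulr_sumr; apply: eq_bigr => i _; rewrite mulr_sumr.
by apply: eq_bigr => j _; rewrite mxE cabs2M.
Qed.

Lemma dotr_quad m n (A B : 'M[C]_(m, n)) t :
  nrm2 (A - t%:C%C *: B) = nrm2 A - 2 * t * dotr A B + t ^+ 2 * nrm2 B.
Proof.
rewrite -scaleNr -rmorphN /= !nrm2_dotr dotrDl dotrZl dotrC dotrDl dotrZl.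
by rewrite [dotr B (_ + _)]dotrC dotrDl dotrZl [dotr B A]dotrC; ring.
Qed.

Lemma dotr_CS m n (A B : 'M[C]_(m, n)) : dotr A B ^+ 2 <= nrm2 A * nrm2 B.
Proof.
apply: semi_CS; rewrite ?nrm2_ge0 // => t.
by rewrite -dotr_quad nrm2_ge0.
Qed.

(** Once [c] is absorbed into a linear argument, a bound on a real part becomes a bound on a
    modulus. *)
Lemma phase (z : C) : exists2 c : C, cabs c = 1 & complex.Re (c * z) = cabs z.
Proof.
have [->|z0] := eqVneq z 0.
  by exists 1; rewrite ?mulr0 ?cabs0 // (cabsr 1) normr1.
have z1 : cabs z != 0 by rewrite cabs_eq0.
exists ((cabs z)^-1%:C%C * conjc z).
  by rewrite cabsM cabsJ cabsr ger0_norm ?invr_ge0 ?cabs_ge0 // mulVf.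
rewrite -mulrA [conjc z * z]mulrC -cabs2E -rmorphM /= -sqr_cabs.
by rewrite expr2 mulrA mulVf // mul1r.
Qed.

Lemma tr_CS m n (A B : 'M[C]_(m, n)) : cabs (\tr (A *m star B)) <= Num.sqrt (nrm2 A) * Num.sqrt (nrm2 B).
Proof.
have [c c1 <-] := phase (\tr (A *m star B)).
rewrite -linearZ /= scalemxAl -/(dotr _ _).
have := dotr_CS (c *: A) B; rewrite nrm2Z -sqr_cabs c1 expr1n mul1r => H.
apply: le_trans (ler_norm _) _.
by rewrite -sqrtr_sqr -sqrtrM ?nrm2_ge0 // ler_sqrt // mulr_ge0 ?nrm2_ge0.
Qed.

Lemma vnormE p (v : 'cV[C]_p) : vnorm v = Num.sqrt (nrm2 v).
Proof. by congr Num.sqrt; apply: eq_bigr => i _; rewrite big_ord1. Qed.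

Lemma vnorm_ge0 p (v : 'cV[C]_p) : 0 <= vnorm v.
Proof. exact: sqrtr_ge0. Qed.

Lemma sqr_vnorm p (v : 'cV[C]_p) : vnorm v ^+ 2 = nrm2 v.
Proof. by rewrite vnormE sqr_sqrtr // nrm2_ge0. Qed.

Lemma nrm2_eq0 m n (A : 'M[C]_(m, n)) : (nrm2 A == 0) = (A == 0).
Proof.
apply/eqP/eqP => [H|->]; last first.
  rewrite /nrm2 big1 // => i _; rewrite big1 // => j _.
  by apply/eqP; rewrite mxE cabs2_eq0.
apply/matrixP => i j; apply/eqP; rewrite mxE -cabs2_eq0; apply/eqP.
have H2 : \sum_j cabs2 (A i j) = 0.
  apply: (psumr_eq0P _ H) => // k _; apply: sumr_ge0 => l _; exact: cabs2_ge0.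
by apply: (psumr_eq0P _ H2) => // k _; exact: cabs2_ge0.
Qed.

Lemma vnorm_eq0 p (v : 'cV[C]_p) : (vnorm v == 0) = (v == 0).
Proof. by rewrite -nrm2_eq0 -sqr_vnorm sqrf_eq0. Qed.

Lemma vnorm0 p : vnorm (0 : 'cV[C]_p) = 0.
Proof. by apply/eqP; rewrite vnorm_eq0. Qed.

Lemma vnormZ p (c : C) (v : 'cV[C]_p) : vnorm (c *: v) = cabs c * vnorm v.
Proof. by rewrite !vnormE nrm2Z sqrtrM ?cabs2_ge0. Qed.

Lemma tr_scal (A : 'M[C]_1) : \tr A = A 0 0.
Proof. by rewrite /mxtrace big_ord1. Qed.

Lemma sqrtnrm2D m n (A B : 'M[C]_(m, n)) :
  Num.sqrt (nrm2 (A + B)) <= Num.sqrt (nrm2 A) + Num.sqrt (nrm2 B).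
Proof.
rewrite -[leRHS]ger0_norm ?addr_ge0 ?sqrtr_ge0 // -sqrtr_sqr ler_sqrt ?sqr_ge0 //.
have -> : A + B = A - (-1)%:C%C *: B by rewrite rmorphN scaleN1r opprK.
rewrite dotr_quad sqrrD !sqr_sqrtr ?nrm2_ge0 //.
have : dotr A B <= Num.sqrt (nrm2 A) * Num.sqrt (nrm2 B).
  by apply: le_trans (tr_CS _ _); apply: le_trans (ler_norm _) (le_Re_cabs _).
by rewrite sqrrN expr1n mul1r mulr2n; lra.
Qed.

Lemma vnormD p (u v : 'cV[C]_p) : vnorm (u + v) <= vnorm u + vnorm v.
Proof. by rewrite !vnormE sqrtnrm2D. Qed.

Lemma nrm2_rows m n (A : 'M[C]_(m, n)) : nrm2 A = \sum_i nrm2 (row i A).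
Proof.
apply: eq_bigr => i _; rewrite /nrm2 big_ord1; apply: eq_bigr => j _.
by rewrite mxE.
Qed.

Lemma nrm2_cols m n (A : 'M[C]_(m, n)) : nrm2 A = \sum_j nrm2 (col j A).
Proof.
rewrite /nrm2 exchange_big; apply: eq_bigr => j _; apply: eq_bigr => i _.
by rewrite big_ord1 mxE.
Qed.

Lemma nrm2M m n p (A : 'M[C]_(m, n)) (B : 'M[C]_(n, p)) :
  nrm2 (A *m B) <= nrm2 A * nrm2 B.
Proof.
rewrite [nrm2 A]nrm2_rows mulr_suml; apply: ler_sum => i _.
rewrite [nrm2 B]nrm2_cols mulr_sumr; apply: ler_sum => j _.
have := tr_CS (row i A) (star (col j B)); rewrite starK tr_scal.
have -> : (row i A *m col j B) 0 0 = (A *m B) i j.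
  by rewrite !mxE; apply: eq_bigr => k _; rewrite !mxE.
rewrite nrm2_star -sqrtrM ?nrm2_ge0 // /cabs ler_sqrt //.
by rewrite mulr_ge0 ?nrm2_ge0.
Qed.

Lemma vnormM_hs m n (A : 'M[C]_(m, n)) (v : 'cV[C]_n) :
  vnorm (A *m v) <= Num.sqrt (nrm2 A) * vnorm v.
Proof.
rewrite !vnormE -sqrtrM ?nrm2_ge0 // ler_sqrt ?nrm2M //.
by rewrite mulr_ge0 ?nrm2_ge0.
Qed.

(** A real [sup] has a meaning only for nonempty bounded sets; the Hilbert-Schmidt norm provides the
    bound. *)
Lemma opnorm_has_sup m n (A : 'M[C]_(m, n)) :
  has_sup [set vnorm (A *m v) | v in [set v : 'cV[C]_n | vnorm v <= 1]].
Proof.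
split; first by exists (vnorm (A *m 0)); exists 0 => //=; rewrite vnorm0.
exists (Num.sqrt (nrm2 A)) => _ [v /= v1 <-].
by apply: le_trans (vnormM_hs _ _) _; rewrite ler_piMr ?sqrtr_ge0.
Qed.

Lemma opnorm_ge0 m n (A : 'M[C]_(m, n)) : 0 <= opnorm A.
Proof.
rewrite -(vnorm0 m) -(mulmx0 1 A); apply: sup_upper_bound (opnorm_has_sup A) _ _.
by exists 0 => //=; rewrite vnorm0.
Qed.

Lemma vnormM m n (A : 'M[C]_(m, n)) (v : 'cV[C]_n) :
  vnorm (A *m v) <= opnorm A * vnorm v.
Proof.
have [->|v0] := eqVneq v 0; first by rewrite mulmx0 !vnorm0 mulr0.
have nv : vnorm v != 0 by rewrite vnorm_eq0.
have pv : 0 < vnorm v by rewrite lt_neqAle eq_sym nv vnorm_ge0.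
rewrite -ler_pdivrMr // mulrC.
have := sup_upper_bound (opnorm_has_sup A).
move=> /(_ (vnorm (A *m ((vnorm v)^-1%:C%C *: v)))).
rewrite -scalemxAr vnormZ cabsr ger0_norm ?invr_ge0 ?vnorm_ge0 //; apply.
exists ((vnorm v)^-1%:C%C *: v); rewrite ?scalemxAr //=.
  by rewrite vnormZ cabsr ger0_norm ?invr_ge0 ?vnorm_ge0 // mulVf.
by rewrite -scalemxAr vnormZ cabsr ger0_norm ?invr_ge0 ?vnorm_ge0.
Qed.

Lemma opnorm_le m n (A : 'M[C]_(m, n)) c : 0 <= c ->
  (forall v, vnorm (A *m v) <= c * vnorm v) -> opnorm A <= c.
Proof.
move=> c0 H; apply: ge_sup; first by have [] := opnorm_has_sup A.
by move=> _ [v /= v1 <-]; apply: le_trans (H v) _; rewrite ler_piMr.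
Qed.

Lemma opnorm_le_hs m n (A : 'M[C]_(m, n)) : opnorm A <= Num.sqrt (nrm2 A).
Proof. by apply: opnorm_le => [|v]; [exact: sqrtr_ge0|exact: vnormM_hs]. Qed.

Lemma opnormM m n p (A : 'M[C]_(m, n)) (B : 'M[C]_(n, p)) :
  opnorm (A *m B) <= opnorm A * opnorm B.
Proof.
apply: opnorm_le => [|v]; first by rewrite mulr_ge0 ?opnorm_ge0.
rewrite -mulmxA; apply: le_trans (vnormM _ _) _.
by rewrite -mulrA ler_wpM2l ?opnorm_ge0 ?vnormM.
Qed.

Lemma opnormD m n (A B : 'M[C]_(m, n)) : opnorm (A + B) <= opnorm A + opnorm B.
Proof.
apply: opnorm_le => [|v]; first by rewrite addr_ge0 ?opnorm_ge0.
rewrite mulmxDl mulrDl; apply: le_trans (vnormD _ _) _.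
by rewrite lerD ?vnormM.
Qed.

Lemma opnorm_eq0 m n (A : 'M[C]_(m, n)) : (opnorm A == 0) = (A == 0).
Proof.
apply/eqP/eqP => [H|->]; last first.
  apply/eqP; rewrite eq_le opnorm_ge0 andbT opnorm_le // => v.
  by rewrite mul0mx vnorm0 mul0r.
apply/matrixP => i j; have := vnormM A (delta_mx j 0); rewrite H mul0r => H1.
have /eqP : vnorm (A *m delta_mx j 0) == 0 by rewrite eq_le H1 vnorm_ge0.
move/eqP; rewrite vnorm_eq0 -colE => /eqP/matrixP/(_ i 0).
by rewrite !mxE.
Qed.

Lemma opnorm_leZ m n (c : C) (A : 'M[C]_(m, n)) : opnorm (c *: A) <= cabs c * opnorm A.
Proof.
apply: opnorm_le => [|v]; first by rewrite mulr_ge0 ?cabs_ge0 ?opnorm_ge0.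
by rewrite -scalemxAl vnormZ -mulrA ler_wpM2l ?cabs_ge0 ?vnormM.
Qed.

Lemma opnormZ m n (c : C) (A : 'M[C]_(m, n)) : opnorm (c *: A) = cabs c * opnorm A.
Proof.
apply/eqP; rewrite eq_le opnorm_leZ /=.
have [->|c0] := eqVneq c 0; first by rewrite cabs0 mul0r opnorm_ge0.
have := opnorm_leZ c^-1 (c *: A); rewrite scalerA mulVf // scale1r => H.
apply: le_trans (ler_wpM2l (cabs_ge0 c) H) _.
by rewrite mulrA -cabsM divff // (cabsr 1) normr1 mul1r.
Qed.

Lemma vnorm_delta (n : nat) (j : 'I_n) : vnorm (delta_mx j 0 : 'cV[C]_n) = 1.
Proof.
rewrite vnormE; suff -> : nrm2 (delta_mx j 0 : 'cV[C]_n) = 1 by rewrite sqrtr1.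
rewrite /nrm2 (bigD1 j) //= big_ord1 mxE !eqxx /= big1 ?addr0.
  by rewrite (cabs2r 1) expr1n.
move=> i ij; rewrite big_ord1 mxE (negPf ij) /=.
by apply/eqP; rewrite cabs2_eq0.
Qed.

Lemma nrm2_le_opnorm m n (A : 'M[C]_(m, n)) : nrm2 A <= n%:R * opnorm A ^+ 2.
Proof.
rewrite nrm2_cols; apply: le_trans (_ : \sum_(j < n) opnorm A ^+ 2 <= _); last first.
  by rewrite sumr_const card_ord mulr_natl.
apply: ler_sum => j _; rewrite -sqr_vnorm ler_sqr ?nnegrE ?vnorm_ge0 ?opnorm_ge0 //.
rewrite colE; apply: le_trans (vnormM _ _) _.
by rewrite vnorm_delta mulr1.
Qed.

Lemma cabs2_le_nrm2 m n (A : 'M[C]_(m, n)) i j : cabs2 (A i j) <= nrm2 A.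
Proof.
rewrite /nrm2 (bigD1 i) //= (bigD1 j) //= -addrA lerDl addr_ge0 //.
  by apply: sumr_ge0 => k _; exact: cabs2_ge0.
by apply: sumr_ge0 => k _; apply: sumr_ge0 => l _; exact: cabs2_ge0.
Qed.

(** With [u = star B *m x], the square of [vnorm u] is the inner product of [x] with [B *m u], hence
    at most [vnorm x * (c * vnorm u)]; divide by [vnorm u]. *)
Lemma opnorm_bound_star m n (B : 'M[C]_(m, n)) c : 0 <= c ->
  (forall y, vnorm (B *m y) <= c * vnorm y) ->
  forall x, vnorm (star B *m x) <= c * vnorm x.
Proof.
move=> c0 H x; set u := star B *m x.
have [u0|u0] := eqVneq (vnorm u) 0; first by rewrite u0 mulr_ge0 ?vnorm_ge0.
have pu : 0 < vnorm u by rewrite lt_neqAle eq_sym u0 vnorm_ge0.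
rewrite -(ler_pM2r pu) -expr2 sqr_vnorm.
have -> : nrm2 u = complex.Re (\tr (x *m star (B *m u))).
  by rewrite -/(dotr _ _) dotrC /dotr -mulmxA mxtrace_mulC -mulmxA nrm2_dotr /dotr /u
     starM starK mxtrace_mulC -mulmxA.
apply: le_trans (le_trans (ler_norm _) (le_Re_cabs _)) _.
apply: le_trans (tr_CS _ _) _; rewrite -!vnormE [leRHS]mulrAC mulrC.
by rewrite ler_wpM2r ?vnorm_ge0.
Qed.

Lemma opnorm_star m n (B : 'M[C]_(m, n)) : opnorm (star B) <= opnorm B.
Proof.
apply: opnorm_le => [|x]; first exact: opnorm_ge0.
by apply: opnorm_bound_star => [|y]; [exact: opnorm_ge0|exact: vnormM].
Qed.

Lemma vnorm_isom n r (T : 'M[C]_(n, r)) v : star T *m T = 1%:M -> vnorm (T *m v) = vnorm v.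
Proof.
move=> H; rewrite !vnormE; congr Num.sqrt; apply: (@complexI R).
by rewrite -nrm2_star nrm2E starK -[in RHS]nrm2_star nrm2E starK starM -mulmxA
  (mulmxA _ T) H mul1mx.
Qed.

Lemma opnorm_isom n r (T : 'M[C]_(n, r)) : star T *m T = 1%:M -> opnorm T <= 1.
Proof. by move=> H; apply: opnorm_le => // v; rewrite vnorm_isom // mul1r. Qed.

Lemma opnorm_rank1 m n (u : 'cV[C]_m) (v : 'cV[C]_n) :
  opnorm (u *m star v) <= vnorm u * vnorm v.
Proof.
apply: le_trans (opnorm_le_hs _) _.
by rewrite !vnormE -sqrtrM ?nrm2_ge0 // ler_sqrt ?mulr_ge0 ?nrm2_ge0 // -[nrm2 v]nrm2_star nrm2M.
Qed.

End Matrices.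

(** * Singular values and the trace norm *)

Section SVD.
Variable R : realType.
Local Notation C := (R[i]).
Variables m n : nat.
Implicit Type A : 'M[C]_(m, n).

(** The spectral theorem diagonalizes [star A *m A]. The singular values are taken as the norms of
    the columns of [A *m V], which makes them nonnegative at once; there are [n] of them whatever
    [m] is. Only the right singular vectors are needed below. *)
Lemma svd A : exists (V : 'M[C]_n) (s : 'I_n -> R),
  [/\ star V *m V = 1%:M, forall i, 0 <= s i,
      forall i j : 'I_n, (i <= j)%N -> s j <= s i &
      star (A *m V) *m (A *m V) = diag_mx (\row_i (s i ^+ 2)%:C%C)].
Proof.
pose H := star A *m A.
have Hh : H \is spectral.normalmx.
  apply: spectral.hermitian_normalmx; apply/is_hermitianmxP.
  rewrite expr0 scale1r -[RHS]/(star H) /H starM starK //.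
pose P := spectral.spectralmx H; pose sp := spectral.spectral_diag H.
have PP : P *m star P = 1%:M by exact/spectral.unitarymxP/spectral.spectral_unitarymx.
have HE : H = star P *m diag_mx sp *m P.
  have /spectral.orthomx_spectralP := Hh.
  by rewrite spectral.invmx_unitary ?spectral.spectral_unitarymx.
have dE : star (A *m star P) *m (A *m star P) = diag_mx sp.
  rewrite starM starK -!mulmxA (mulmxA (star A)) -/H HE -!mulmxA PP mulmx1.
  by rewrite mulmxA PP mul1mx.
pose t i := vnorm (col i (A *m star P)).
have tE i : (t i ^+ 2)%:C%C = sp 0 i.
  rewrite sqr_vnorm -nrm2_star nrm2E starK tr_scal.
  have /matrixP/(_ i i) := dE; rewrite [RHS]mxE eqxx mulr1n => <-.
  by rewrite !mxE; apply: eq_bigr => k _; rewrite !mxE.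
(* The permutation that sorts the column norms also reorders the eigenvectors. *)
pose tt := [tuple t i | i < n].
have sz : size (sort >=%R tt) == n by rewrite size_sort size_tuple.
have /tuple_permP[p pE] : perm_eq (Tuple sz) tt by rewrite perm_sort.
pose s j := tnth tt (p j).
have sE j : s j = t (p j) by rewrite /s tnth_mktuple.
exists (col_perm p (star P)), s; split => [|i|i j ij|].
- apply/matrixP => i j.
  have -> : (1%:M : 'M[C]_n) i j = (1%:M : 'M[C]_n) (p i) (p j).
    by rewrite !mxE (inj_eq perm_inj).
  rewrite -PP.
  by rewrite !mxE; apply: eq_bigr => k _; rewrite !mxE conjcK.
- by rewrite sE vnorm_ge0.
- have H1 : sorted >=%R (sort >=%R tt) by apply: sort_sorted => x y; exact: ge_total.
  have := sorted_leq_nth ge_trans ge_refl 0 H1.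
  move=> /(_ i j); rewrite !inE size_sort size_tuple !ltn_ord => /(_ isT isT ij).
  have E k : nth 0 (sort >=%R tt) (nat_of_ord k) = s k.
    have -> : sort >=%R tt = [tuple tnth tt (p i0) | i0 < n] :> seq R by rewrite -pE.
    by rewrite (nth_map k) ?size_enum_ord // nth_ord_enum.
  by rewrite !E.
- apply/matrixP => i j; set d := \row__ _.
  have -> : diag_mx d i j = diag_mx sp (p i) (p j).
    by rewrite !mxE (inj_eq perm_inj) sE tE.
  rewrite -dE !mxE; apply: eq_bigr => k _; rewrite !mxE; congr (conjc _ * _).
    by apply: eq_bigr => l _; rewrite !mxE.
  by apply: eq_bigr => l _; rewrite !mxE.
Qed.

Lemma sing_val_ge0 A j : 0 <= sing_val A j.
Proof.
apply: lb_le_inf; first by exists (opnorm (A - 0)); exists 0 => //=; rewrite mxrank0.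
by move=> _ [B _ <-]; exact: opnorm_ge0.
Qed.

Lemma sing_val_le A B j : (\rank B <= j)%N -> sing_val A j <= opnorm (A - B).
Proof.
move=> rB; apply: ge_inf; last by exists B.
by exists 0 => _ [D _ <-]; exact: opnorm_ge0.
Qed.

Lemma sing_val_eq0 A j : (\rank A <= j)%N -> sing_val A j = 0.
Proof.
move=> rA; apply/eqP; rewrite eq_le sing_val_ge0 andbT.
apply: le_trans (sing_val_le _ rA) _; rewrite subrr.
by have /eqP -> : opnorm (0 : 'M[C]_(m, n)) == 0 by rewrite opnorm_eq0.
Qed.

(** * Best approximation and trace duality in a basis of right singular vectors *)

Section WithSVD.
Variables (A : 'M[C]_(m, n)) (V : 'M[C]_n) (s : 'I_n -> R).
Hypothesis VV : star V *m V = 1%:M.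
Hypothesis s_ge0 : forall i, 0 <= s i.
Hypothesis s_dec : forall i j : 'I_n, (i <= j)%N -> s j <= s i.
Hypothesis AV : star (A *m V) *m (A *m V) = diag_mx (\row_i (s i ^+ 2)%:C%C).

Let VV' : V *m star V = 1%:M.
Proof. exact: mulmx1C. Qed.

Let nrm2V (c : 'cV[C]_n) : nrm2 (V *m c) = nrm2 c.
Proof. by rewrite -!sqr_vnorm vnorm_isom. Qed.

Let nrm2sV (c : 'cV[C]_n) : nrm2 (star V *m c) = nrm2 c.
Proof. by rewrite -nrm2V mulmxA VV' mul1mx. Qed.

Let nrm2AV (c : 'cV[C]_n) : nrm2 (A *m V *m c) = \sum_i s i ^+ 2 * cabs2 (c i 0).
Proof.
apply: (@complexI R); rewrite -nrm2_star nrm2E starK starM -mulmxA (mulmxA (star (A *m V))) AV.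
rewrite tr_scal mxE rmorph_sum; apply: eq_bigr => i _.
by rewrite mul_diag_mx !mxE [in RHS]rmorphM /= cabs2E; ring.
Qed.

Let nrm2_cV (c : 'cV[C]_n) : nrm2 c = \sum_i cabs2 (c i 0).
Proof. by apply: eq_bigr => i _; rewrite big_ord1. Qed.

Let pid_subE (j : nat) (c : 'cV[C]_n) i :
  (c - (pid_mx j : 'M[C]_n) *m c) i 0 = (if (i < j)%N then 0 else c i 0).
Proof.
rewrite !mxE (bigD1 i) //= big1 ?addr0 => [|k ki].
  by rewrite !mxE eqxx /=; case: ifP => _; rewrite (mul1r, mul0r) (subrr, subr0).
by rewrite !mxE eq_sym (negPf (_ : k != i :> nat)) // mul0r.
Qed.

(** The theorem of Eckart, Young and Mirsky: truncation of [A] gives one inequality; for the other,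
    the kernel of a matrix of rank at most [j] meets the span of the first [j.+1] singular vectors,
    on which [A] expands by at least [s j]. *)
Lemma sing_val_svd (j : 'I_n) : sing_val A j = s j.
Proof.
apply/eqP; rewrite eq_le; apply/andP; split.
  (* [B] agrees with [A] on the first [j] singular vectors and vanishes on the others. *)
  pose B := A *m V *m pid_mx j *m star V.
  have rB : (\rank B <= j)%N.
    apply: leq_trans (mxrankM_maxl _ _) _; apply: leq_trans (mxrankM_maxr _ _) _.
    by rewrite rank_pid_mx // ltnW.
  apply: le_trans (sing_val_le _ rB) _; apply: opnorm_le => // v.
  pose c := star V *m v.
  have -> : (A - B) *m v = A *m V *m (c - pid_mx j *m c).
    by rewrite mulmxBr mulmxBl /B /c !mulmxA -(mulmxA A V (star V)) VV' mulmx1.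
  rewrite -ler_sqr ?nnegrE ?mulr_ge0 ?vnorm_ge0 // exprMn !sqr_vnorm -[nrm2 v]nrm2sV -/c.
  rewrite nrm2AV nrm2_cV mulr_sumr; apply: ler_sum => i _.
  rewrite pid_subE.
  case: ltnP => ij; first by rewrite (_ : cabs2 0 = 0) ?mulr0 ?mulr_ge0 ?sqr_ge0 ?cabs2_ge0 //;
    apply/eqP; rewrite cabs2_eq0.
  by rewrite ler_wpM2r ?cabs2_ge0 // ler_sqr ?nnegrE ?s_dec.
apply: lb_le_inf; first by exists (opnorm (A - 0)); exists 0 => //=; rewrite mxrank0.
move=> _ [B /= rB <-].
(* [E] embeds the first [j.+1] coordinates. The transpose is there because [kermx] is a left kernel:
   [N] has [j.+1] rows and rank at most [j]. *)
pose E : 'M[C]_(n, j.+1) := \matrix_(i, l) (i == l :> nat)%:R.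
pose N := (B *m V *m E)^T.
have kN : kermx N != 0.
  rewrite -mxrank_eq0 mxrank_ker -lt0n subn_gt0 ltnS mxrank_tr.
  apply: leq_trans (mxrankM_maxl _ _) _; apply: leq_trans (mxrankM_maxl _ _) rB.
have /rowV0Pn[x xk x0] := kN.
have BVE : B *m V *m E *m x^T = 0.
  apply: trmx_inj; rewrite trmx_mul trmxK trmx0; exact/sub_kermxP.
pose c := E *m x^T.
have cE i : c i 0 = if insub (i : nat) is Some l then x 0 (l : 'I_j.+1) else 0.
  rewrite !mxE; case: insubP => [l _ li|ij].
    rewrite (bigD1 l) //= big1 ?addr0 => [|k kl]; first by rewrite !mxE -li eqxx mul1r.
    by rewrite !mxE -li eq_sym (negPf (_ : k != l :> nat)) // mul0r.
  rewrite big1 // => k _; rewrite !mxE (_ : (i == k :> nat) = false) ?mul0r //.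
  by apply: contraNF ij => /eqP ->.
have c0 : c != 0.
  apply: contra x0 => /eqP c0; apply/eqP/rowP => l; rewrite mxE.
  have ln : (l < n)%N by apply: leq_trans (ltn_ord l) _.
  have := cE (Ordinal ln); rewrite c0 mxE /=.
  case: insubP => [l' _ ll'|]; last by rewrite /= ltn_ord.
  by move=> ->; congr (x 0 _); apply: val_inj.
have pc : 0 < vnorm c by rewrite lt_neqAle eq_sym vnorm_eq0 c0 vnorm_ge0.
rewrite -(ler_pM2r pc) -[vnorm c](vnorm_isom _ VV).
apply: le_trans (vnormM _ _).
have -> : (A - B) *m (V *m c) = A *m V *m c.
  by rewrite mulmxBl !mulmxA BVE subr0.
rewrite vnorm_isom // -ler_sqr ?nnegrE ?mulr_ge0 ?vnorm_ge0 // exprMn !sqr_vnorm nrm2AV.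
rewrite nrm2_cV mulr_sumr; apply: ler_sum => i _; rewrite cE.
case: insubP => [l lj li|_]; last by rewrite (_ : cabs2 0 = 0) ?mulr0 //; apply/eqP; rewrite cabs2_eq0.
by rewrite ler_wpM2r ?cabs2_ge0 // ler_sqr ?nnegrE // s_dec // -ltnS.
Qed.

(** The sum in [trnorm] stops at [minn m n], whereas [s] has [n] values; the remaining ones vanish
    because the rank is at most [m]. *)
Lemma trnorm_svd : trnorm A = \sum_i s i.
Proof.
rewrite -[RHS](eq_bigr _ (fun j _ => sing_val_svd j)) /trnorm.
rewrite -(big_mkord xpredT (sing_val A)) -(big_mkord xpredT (sing_val A)).
rewrite [RHS](big_cat_nat _ (n := minn m n)) ?geq_minr //=.
rewrite [X in _ = _ + X](_ : _ = 0) ?addr0 //.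
rewrite big_nat_cond; apply: big1 => j /andP[/andP[mj jn] _].
apply: sing_val_eq0; apply: leq_trans (rank_leq_row _) _.
by move: mj; rewrite geq_min (leqNgt n) jn orbF.
Qed.

(** In the basis [V] the i-th diagonal entry of the product is at most [opnorm B] times the norm of
    the i-th column of [A *m V], which is [s i]. *)
Lemma tr_le_svd (B : 'M[C]_(n, m)) : cabs (\tr (A *m B)) <= (\sum_i s i) * opnorm B.
Proof.
rewrite -[A]mulmx1 -VV' mulmxA -[X in \tr X]mulmxA mxtrace_mulC.
apply: le_trans (cabs_sum _ _ _) _; rewrite mulr_suml; apply: ler_sum => i _.
have -> : (star V *m B *m (A *m V)) i i = (star V *m (B *m col i (A *m V))) i 0.
  by rewrite colE !mulmxA -colE [RHS]mxE.
have -> : s i = vnorm (col i (A *m V)).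
  apply/eqP; rewrite -(eqrXn2 (n:=2)) ?vnorm_ge0 // sqr_vnorm; apply/eqP.
  apply: (@complexI R); rewrite -nrm2_star nrm2E starK tr_scal.
  have -> : (s i ^+ 2)%:C%C = diag_mx (\row_i (s i ^+ 2)%:C%C) i i.
    by rewrite !mxE eqxx mulr1n.
  rewrite -AV.
  by rewrite !mxE; apply: eq_bigr => k _; rewrite !mxE.
rewrite mulrC; apply: le_trans (vnormM _ _).
set u := B *m _.
have -> : vnorm u = vnorm (star V *m u) by rewrite !vnormE nrm2sV.
rewrite [leRHS]vnormE ler_sqrt ?nrm2_ge0 //; exact: cabs2_le_nrm2.
Qed.

(** [B] is the adjoint of the partial isometry in the polar decomposition of [A]. The convention
    [0^-1 = 0] makes the inverse diagonal [D] vanish on the kernel. *)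
Lemma tr_attain_svd : exists2 B : 'M[C]_(n, m), opnorm B <= 1 & \tr (A *m B) = (\sum_i s i)%:C%C.
Proof.
pose D := diag_mx (\row_i ((s i)^-1)%:C%C) : 'M[C]_n.
have sD : star D = D.
  apply/matrixP => i j; rewrite starE !mxE eq_sym; case: eqVneq => [->|_].
    by rewrite !mulr1n; apply: eqC => //=; rewrite oppr0.
  by rewrite !mulr0n conjc0.
exists (V *m D *m star (A *m V)).
  apply: opnorm_le => // v; rewrite -[V *m D *m _]starK.
  apply: opnorm_bound_star => // x.
  rewrite starM starK starM sD mul1r.
  rewrite -ler_sqr ?nnegrE ?vnorm_ge0 // !sqr_vnorm !mulmxA.
  rewrite -[A *m V *m D *m star V *m x]mulmxA -(mulmxA _ D) nrm2AV -[nrm2 x]nrm2sV nrm2_cV.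
  apply: ler_sum => i _; rewrite mul_diag_mx !mxE cabs2M cabs2r mulrA -exprMn.
  have [->|si] := eqVneq (s i) 0; first by rewrite mul0r expr0n mul0r cabs2_ge0.
  by rewrite divff // expr1n mul1r.
rewrite !mulmxA mxtrace_mulC mulmxA AV.
rewrite rmorph_sum /mxtrace; apply: eq_bigr => i _.
rewrite mul_diag_mx !mxE eqxx mulr1n -rmorphM /=; congr _%:C%C.
have [->|si] := eqVneq (s i) 0; first by rewrite expr0n mul0r.
by rewrite expr2 mulfK.
Qed.

End WithSVD.

Lemma tr_le_trnorm A (B : 'M[C]_(n, m)) : cabs (\tr (A *m B)) <= trnorm A * opnorm B.
Proof.
have [V [s [VV s0 sd AV]]] := svd A.
by rewrite (trnorm_svd VV s0 sd AV); apply: (tr_le_svd VV s0 AV).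
Qed.

Lemma trnorm_attain A :
  exists2 B : 'M[C]_(n, m), opnorm B <= 1 & \tr (A *m B) = (trnorm A)%:C%C.
Proof.
have [V [s [VV s0 sd AV]]] := svd A.
by rewrite (trnorm_svd VV s0 sd AV); apply: (tr_attain_svd VV AV).
Qed.

Lemma trnorm_ge0 A : 0 <= trnorm A.
Proof. by apply: sumr_ge0 => j _; exact: sing_val_ge0. Qed.

(** By duality: the trace norm is a maximum of real parts of linear functionals, and the one
    attaining it at the sum bounds both terms. *)
Lemma trnormD A B : trnorm (A + B) <= trnorm A + trnorm B.
Proof.
have [D D1 DE] := trnorm_attain (A + B).
have -> : trnorm (A + B) = cabs (\tr ((A + B) *m D)).
  by rewrite DE cabsr ger0_norm ?trnorm_ge0.
rewrite mulmxDl linearD; apply: le_trans (cabsD _ _) (lerD _ _);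
  by apply: le_trans (tr_le_trnorm _ _) _; rewrite ler_piMr ?trnorm_ge0.
Qed.

Lemma trnorm_leZ (c : C) A : trnorm (c *: A) <= cabs c * trnorm A.
Proof.
have [D D1 DE] := trnorm_attain (c *: A).
have -> : trnorm (c *: A) = cabs (\tr ((c *: A) *m D)).
  by rewrite DE cabsr ger0_norm ?trnorm_ge0.
rewrite -scalemxAl linearZ cabsM ler_wpM2l ?cabs_ge0 //.
by apply: le_trans (tr_le_trnorm _ _) _; rewrite ler_piMr ?trnorm_ge0.
Qed.

Lemma trnorm_le_opnorm A : trnorm A <= m%:R * opnorm A.
Proof.
apply: le_trans (_ : \sum_(j < minn m n) opnorm A <= _).
  apply: ler_sum => j _; rewrite -[A in leRHS]subr0; apply: sing_val_le.
  by rewrite mxrank0.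
by rewrite sumr_const card_ord -[_ *+ minn m n]mulr_natl ler_wpM2r ?opnorm_ge0 // ler_nat geq_minl.
Qed.

Lemma trnorm_le_hs A : trnorm A <= m%:R * Num.sqrt (nrm2 A).
Proof.
by apply: le_trans (trnorm_le_opnorm A) _; rewrite ler_wpM2l ?opnorm_le_hs.
Qed.

Lemma trnorm_rank1 (u : 'cV[C]_m) (v : 'cV[C]_n) :
  trnorm (u *m star v) <= vnorm u * vnorm v.
Proof.
have r1 : (\rank (u *m star v) <= 1)%N.
  by apply: leq_trans (mxrankM_maxl _ _) (rank_leq_col _).
rewrite /trnorm; case: (minn m n) => [|p]; first by rewrite big_ord0 mulr_ge0 ?vnorm_ge0.
rewrite big_ord_recl big1 ?addr0 => [|i _]; last first.
  by apply: sing_val_eq0; apply: leq_trans r1 _.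
apply: le_trans (opnorm_rank1 u v); rewrite -[X in opnorm X]subr0.
by apply: sing_val_le; rewrite mxrank0.
Qed.

End SVD.

(** * Riesz representation and Hahn-Banach *)

Section RieszHahnBanach.
Variable R : realType.
Variable V : lmodType R[i].

(** * Riesz representation for a complete semi-inner product *)

Section Riesz.
(** Functions equal almost everywhere are not identified, so [ip] is only semidefinite. All laws are
    restricted to a predicate [M], since integrals of arbitrary functions obey none of them. Scalars
    are real because the functionals represented are real-valued. *)
Variables (M : V -> Prop) (ip : V -> V -> R).
Hypothesis MD : forall x y, M x -> M y -> M (x + y).
Hypothesis MZ : forall (a : R) x, M x -> M (a%:C%C *: x).
Hypothesis ipC : forall x y, M x -> M y -> ip x y = ip y x.
Hypothesis ipDl : forall x y z, M x -> M y -> M z -> ip (x + y) z = ip x z + ip y z.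
Hypothesis ipZl : forall (a : R) x z, M x -> M z -> ip (a%:C%C *: x) z = a * ip x z.
Hypothesis ip_ge0 : forall x, M x -> 0 <= ip x x.
Hypothesis complete : forall u : nat -> V, (forall n, M (u n)) ->
  (forall e, 0 < e -> exists N, forall p q, (N <= p)%N -> (N <= q)%N ->
     ip (u p - u q) (u p - u q) <= e) ->
  exists l, M l /\ (forall e, 0 < e -> exists N, forall p, (N <= p)%N ->
     ip (u p - l) (u p - l) <= e).

Let MB x y : M x -> M y -> M (x - y).
Proof.
move=> Mx My; have -> : x - y = x + (-1)%:C%C *: y by rewrite rmorphN scaleN1r.
by apply: MD => //; exact: MZ.
Qed.

Let ip_quad x y (t : R) : M x -> M y ->
  ip (x - t%:C%C *: y) (x - t%:C%C *: y) = ip x x - 2 * t * ip x y + t ^+ 2 * ip y y.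
Proof.
move=> Mx My; rewrite -scaleNr -rmorphN /=.
have Mty : M ((- t)%:C%C *: y) by exact: MZ.
have Ms : M (x + (- t)%:C%C *: y) by exact: MD.
rewrite ipDl // ipZl // [ip x (_ + _)]ipC // [ip y (_ + _)]ipC // !ipDl // !ipZl //.
by rewrite [ip y x]ipC //; ring.
Qed.

Lemma ip_CS x y : M x -> M y -> ip x y ^+ 2 <= ip x x * ip y y.
Proof.
move=> Mx My; apply: semi_CS; rewrite ?ip_ge0 // => t.
by rewrite -ip_quad // ip_ge0 //; apply: MB => //; exact: MZ.
Qed.

Variables (l : V -> R) (c : R).
Hypothesis lD : forall x y, M x -> M y -> l (x + y) = l x + l y.
Hypothesis lZ : forall (a : R) x, M x -> l (a%:C%C *: x) = a * l x.
Hypothesis c0 : 0 <= c.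
Hypothesis lc : forall x, M x -> l x ^+ 2 <= c * ip x x.
Hypothesis M0 : M 0.

(** The representative minimizes [J x = ip x x - 2 * l x]. Minimizing sequences are Cauchy by the
    parallelogram law, and the first variation of [J] at the limit is the claimed identity. *)
Lemma riesz : exists2 g, M g & forall x, M x -> l x = ip g x.
Proof.
pose J x := ip x x - 2 * l x.
have J_ge x : M x -> - c <= J x.
  move=> Mx; have := lc Mx; have := ip_ge0 Mx; rewrite /J.
  move: (ip x x) (l x) => q a q0 H.
  rewrite lerBrDr -subr_ge0.
  (* From [a^2 <= c * q] and the inequality between arithmetic and geometric means; this makes [- c]
     a lower bound of [J]. *)
  have H2 : (2 * a) ^+ 2 <= (q + c) ^+ 2.
    rewrite exprMn; have : 0 <= (q - c) ^+ 2 by exact: sqr_ge0.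
    rewrite !expr2 in H *; nra.
  have qc : 0 <= q + c by rewrite addr_ge0.
  suff : 2 * a <= q + c by lra.
  by rewrite leNgt; apply/negP => H3; rewrite !expr2 in H2; nra.
have hI : has_inf [set J x | x in M].
  split; first by exists (J 0); exists 0.
  by exists (- c) => _ [x Mx <-]; exact: J_ge.
set I := inf [set J x | x in M].
have I_le x : M x -> I <= J x by move=> Mx; apply: ge_inf; [case: hI|exists x].
have ex n : exists x, M x /\ J x <= I + n.+1%:R^-1.
  have [|_ [x Mx <-] H] := @inf_adherent _ [set J x | x in M] (n.+1%:R^-1) _ hI.
    by rewrite invr_gt0.
  by exists x; split => //; exact: ltW.
have [u uP] := choice ex.
have uM n : M (u n) by have [] := uP n.
have uJ n : J (u n) <= I + n.+1%:R^-1 by have [] := uP n.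
have small e : 0 < e -> exists N, forall p, (N <= p)%N -> p.+1%:R^-1 <= e :> R.
  move=> e0; exists (Num.truncn e^-1) => p Np.
  have := truncnS_gt (e^-1); rewrite -[e in _ <= e]invrK => H.
  rewrite lef_pV2 ?posrE ?invr_gt0 //.
  by apply: le_trans (ltW H) _; rewrite ler_nat ltnS.
have cauchy e : 0 < e -> exists N, forall p q, (N <= p)%N -> (N <= q)%N ->
     ip (u p - u q) (u p - u q) <= e.
  move=> e0; have [|N NP] := small (e / 4); first by rewrite divr_gt0.
  exists N => p q Np Nq.
  have Ms : M (u p - (-1)%:C%C *: u q) by apply: MB => //; exact: MZ.
  (* The parallelogram law bounds the squared distance of [u p] and [u q] by
     [2 * J (u p) + 2 * J (u q) - 4 * J] at the midpoint. With both values within [e / 4] of the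
     infimum, this is at most [e]. *)
  have := I_le _ (MZ 2^-1 Ms).
  have -> : J (2^-1%:C%C *: (u p - (-1)%:C%C *: u q)) =
      4^-1 * (ip (u p) (u p) + 2 * ip (u p) (u q) + ip (u q) (u q)) -
      (l (u p) + l (u q)).
    rewrite /J lZ // ipZl //; last exact: MZ.
    rewrite ipC //; last exact: MZ.
    by rewrite ipZl // ip_quad // rmorphN scaleN1r opprK lD //; field.
  have := uJ p; have := uJ q; have := NP _ Np; have := NP _ Nq; rewrite /J.
  have -> : u p - u q = u p - 1%:C%C *: u q by rewrite scale1r.
  rewrite ip_quad // expr1n mulr1 mul1r.
  move: (ip (u p) (u p)) (ip (u p) (u q)) (ip (u q) (u q)) (l (u p)) (l (u q)).
  by move: (p.+1%:R^-1) (q.+1%:R^-1) => ? ? ? ? ? ? ?; lra.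
have [g [Mg gP]] := complete uM cauchy.
exists g => // x Mx; apply/eqP; rewrite -subr_eq0 -sqrf_eq0 eq_le sqr_ge0 andbT.
(* [J] at [u n + t *: x] is at least [I], and [J (u n)] exceeds [I] by at most [n.+1%:R^-1]: a
   nonnegative quadratic in [t], whose discriminant is estimated. *)
have key n : (l x - ip (u n) x) ^+ 2 <= n.+1%:R^-1 * ip x x.
  apply: semi_CS; rewrite ?invr_ge0 ?ip_ge0 // => t.
  have Mt : M (u n - (- t)%:C%C *: x) by apply: MB => //; exact: MZ.
  have := I_le _ Mt; rewrite /J ip_quad //.
  have -> : l (u n - (- t)%:C%C *: x) = l (u n) + t * l x.
    by rewrite rmorphN scaleNr opprK lD ?lZ //; exact: MZ.
  have := uJ n; rewrite /J sqrrN.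
  move: (n.+1%:R^-1) (ip (u n) (u n)) (ip (u n) x) (ip x x) (l (u n)) (l x) => i a b d e f.
  by rewrite !expr2; nra.
apply/ler_addgt0Pl => e e0; rewrite addr0.
have q0 := ip_ge0 Mx.
(* Two errors with squares at most [d * ip x x] add up to one with square at most [4 * d * ip x x];
   the added 1 avoids division by zero. *)
pose d := e / (4 * (ip x x + 1)).
have d0 : 0 < d by rewrite divr_gt0 // mulr_gt0 // ltr_wpDl.
have [N1 H1] := small _ d0; have [N2 H2] := gP _ d0.
pose n := maxn N1 N2.
have k1 := key n; have k2 := H1 n (leq_maxl _ _); have k3 := H2 n (leq_maxr _ _).
have k4 := ip_CS (MB (uM n) Mg) Mx.
have E : ip (u n - g) x = ip (u n) x - ip g x.
  have -> : u n - g = u n + (-1)%:C%C *: g by rewrite rmorphN scaleN1r.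
  by rewrite ipDl ?ipZl ?mulN1r //; exact: MZ.
rewrite E in k4.
have k1' : (l x - ip (u n) x) ^+ 2 <= d * ip x x.
  by apply: le_trans k1 _; rewrite ler_wpM2r.
have k4' : (ip (u n) x - ip g x) ^+ 2 <= d * ip x x.
  by apply: le_trans k4 _; rewrite ler_wpM2r.
have k5 : 4 * (d * ip x x) <= e.
  have -> : e = 4 * (d * (ip x x + 1)).
    by rewrite /d; field; rewrite lt0r_neq0 // ltr_wpDl.
  by rewrite !ler_pM2l // lerDl.
have : 0 <= ((l x - ip (u n) x) - (ip (u n) x - ip g x)) ^+ 2 by exact: sqr_ge0.
move: k1' k4' k5; rewrite !expr2; nra.
Qed.

End Riesz.

(** * Hahn-Banach theorem through minimal sublinear functionals *)

Section HahnBanach.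
Variable S : V -> Prop.
Hypothesis SD : forall x y, S x -> S y -> S (x + y).
Hypothesis SZ : forall (a : R) x, S x -> S (a%:C%C *: x).

Definition sublinear (p : V -> R) :=
  (forall x y, S x -> S y -> p (x + y) <= p x + p y) /\
  (forall (a : R) x, 0 <= a -> S x -> p (a%:C%C *: x) <= a * p x).

Let SN x : S x -> S (- x).
Proof.
by move=> Sx; have -> : - x = (-1)%:C%C *: x; [rewrite rmorphN scaleN1r|exact: SZ].
Qed.

Let S0 x : S x -> S 0.
Proof. by move=> /(SZ 0); rewrite scale0r. Qed.

Lemma sublinearZ p a x : sublinear p -> S x -> 0 <= a -> p (a%:C%C *: x) = a * p x.
Proof.
move=> [pD pZ] Sx a0; apply/eqP; rewrite eq_le pZ //=.
have [->|an0] := eqVneq a 0.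
  rewrite mul0r scale0r; have Z : S 0 := S0 Sx.
  by have := pD 0 0 Z Z; rewrite addr0 lerDl.
have ap : 0 < a by rewrite lt_neqAle eq_sym an0.
rewrite -[x in leLHS]scale1r -(rmorph1 (real_complex R)) -(mulVf an0) rmorphM -scalerA /=.
have iv : 0 <= a^-1 by rewrite invr_ge0.
have := pZ a^-1 (a%:C%C *: x) iv (SZ _ Sx).
by rewrite -(ler_pM2l ap) mulrA divff // mul1r.
Qed.

Lemma sublinear0 p x : sublinear p -> S x -> p 0 = 0.
Proof. by move=> sp Sx; have := sublinearZ sp Sx (lexx 0); rewrite scale0r mul0r. Qed.

Lemma sublinear_geN p x : sublinear p -> S x -> - p (- x) <= p x.
Proof.
move=> sp Sx; have [pD _] := sp; have := pD _ _ Sx (SN Sx).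
by rewrite subrr (sublinear0 sp Sx) -lerBlDr sub0r.
Qed.

(** For sublinear [p] this is the largest sublinear functional below [p] whose value at [- a] is at
    most [- p a]. It serves twice: to show that minimal functionals are additive, and to prescribe
    the value at a given vector. *)
Definition shift_inf (p : V -> R) (a x : V) : R :=
  inf [set p (x + t%:C%C *: a) - t * p a | t in [set t : R | 0 <= t]].

Section Shift.
Variables (p : V -> R) (a : V).
Hypotheses (sp : sublinear p) (Sa : S a).

Let lb x : S x -> lbound [set p (x + t%:C%C *: a) - t * p a | t in [set t : R | 0 <= t]] (- p (- x)).
Proof.
move=> Sx _ [t /= t0 <-]; rewrite lerBrDr -(sublinearZ sp Sa t0) addrC lerBlDr.
have [pD _] := sp.
have E : t%:C%C *: a = (x + t%:C%C *: a) + (- x) by rewrite addrC addKr.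
by rewrite {1}E; apply: pD; [apply: SD => //; exact: SZ|exact: SN].
Qed.

Lemma shift_inf_le x t : S x -> 0 <= t -> shift_inf p a x <= p (x + t%:C%C *: a) - t * p a.
Proof. by move=> Sx t0; apply: ge_inf; [exists (- p (- x)); exact: lb|exists t]. Qed.

Lemma le_shift_inf x c : S x ->
  (forall t, 0 <= t -> c <= p (x + t%:C%C *: a) - t * p a) -> c <= shift_inf p a x.
Proof.
move=> Sx H; apply: lb_le_inf; first by exists (p (x + 0%:C%C *: a) - 0 * p a); exists 0 => /=.
by move=> _ [t /= t0 <-]; exact: H.
Qed.

Lemma sublinear_shift : sublinear (shift_inf p a).
Proof.
have [pD pZ] := sp; split => [x y Sx Sy|b x b0 Sx].
  rewrite -lerBlDr; apply: le_shift_inf => // t t0.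
  rewrite lerBlDr -lerBlDl; apply: le_shift_inf => // s s0.
  rewrite lerBlDl.
  apply: le_trans (shift_inf_le (SD Sx Sy) (addr_ge0 t0 s0)) _.
  have : p (x + y + (t + s)%:C%C *: a) <= p (x + t%:C%C *: a) + p (y + s%:C%C *: a).
    have -> : x + y + (t + s)%:C%C *: a = (x + t%:C%C *: a) + (y + s%:C%C *: a).
      by rewrite rmorphD scalerDl addrACA.
    by apply: pD; apply: SD => //; exact: SZ.
  by lra.
have H t : 0 <= t -> shift_inf p a (b%:C%C *: x) <= b * (p (x + t%:C%C *: a) - t * p a).
  move=> t0; apply: le_trans (shift_inf_le (SZ b Sx) (mulr_ge0 b0 t0)) _.
  rewrite mulrBr mulrA lerB //.
  rewrite rmorphM -scalerA -scalerDr; apply: pZ => //; apply: SD => //; exact: SZ.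
have [b00|bn0] := eqVneq b 0.
  by have := H 0 (lexx 0); rewrite b00 !mul0r.
have bp : 0 < b by rewrite lt_neqAle eq_sym bn0.
rewrite -ler_pdivrMl //; apply: le_shift_inf => // t t0.
by rewrite ler_pdivrMl // H.
Qed.

Lemma shift_inf_self x : S x -> shift_inf p a x <= p x.
Proof. by move=> Sx; have := shift_inf_le Sx (lexx 0); rewrite scale0r mul0r addr0 subr0. Qed.

Lemma shift_inf1 x : S x -> shift_inf p a x <= p (x + a) - p a.
Proof. by move=> Sx; have := shift_inf_le Sx ler01; rewrite scale1r mul1r. Qed.

End Shift.

(* A sublinear functional that is minimal below p is additive, because it
   cannot decrease under the shift construction. *)
Lemma minimal_sublinear p : sublinear p -> exists q : V -> R,
  [/\ sublinear q, forall x, S x -> q x <= p x &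
     forall x y, S x -> S y -> q (x + y) = q x + q y].
Proof.
move=> sp.
pose T := {q : V -> R | sublinear q /\ forall x, S x -> q x <= p x}.
(* The order is reversed, so that Zorn's lemma produces a minimal functional. It is only a preorder,
   as values outside [S] are arbitrary. *)
pose r (s t : T) : bool := `[< forall x, S x -> sval t x <= sval s x >].
have t0 : T by exists p; split.
have chain (A : set T) : total_on A r -> exists t, forall s, A s -> r s t.
  move=> tot; have [[s0 As0]|A0] := pselect (exists s, A s); last first.
    by exists t0 => s As; exfalso; apply: A0; exists s.
  pose q x := inf [set sval s x | s in A].
  have lbq x : S x -> lbound [set sval s x | s in A] (- p (- x)).
    move=> Sx _ [s As <-]; case: (svalP s) => ss sle.
    by apply: le_trans (sublinear_geN ss Sx); rewrite lerN2; apply: sle; exact: SN.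
  have q_le x s : S x -> A s -> q x <= sval s x.
    by move=> Sx As; apply: ge_inf; [exists (- p (- x)); exact: lbq|exists s].
  have le_q x c : (forall s, A s -> c <= sval s x) -> c <= q x.
    move=> H; apply: lb_le_inf; first by exists (sval s0 x); exists s0.
    by move=> _ [s As <-]; exact: H.
  have qs : sublinear q /\ forall x, S x -> q x <= p x.
    split; last first.
      by move=> x Sx; apply: le_trans (q_le x _ Sx As0) _; case: (s0) => s [? /=]; exact.
    split => [x y Sx Sy|b x b0 Sx].
            rewrite -lerBlDr; apply: (le_q) => s As; rewrite lerBlDr -lerBlDl.
      apply: (le_q) => s' As'; rewrite lerBlDl.
      (* Subadditivity of the infimum over a chain: of the two members involved, the smaller one is
         used for both arguments. *)
      have [/asboolP H|/asboolP H] := tot _ _ As As'.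
        apply: le_trans (q_le _ _ (SD Sx Sy) As') _.
        case: (svalP s') => -[pD _] _; apply: le_trans (pD _ _ Sx Sy) _.
        by rewrite lerD2r H.
      apply: le_trans (q_le _ _ (SD Sx Sy) As) _.
      case: (svalP s) => -[pD _] _; apply: le_trans (pD _ _ Sx Sy) _.
      by rewrite lerD2l H.
    have H s : A s -> q (b%:C%C *: x) <= b * sval s x.
      move=> As; apply: le_trans (q_le _ _ (SZ b Sx) As) _.
      by case: (svalP s) => -[_ pZ] _; exact: pZ.
    have [b00|bn0] := eqVneq b 0.
      by have := H _ As0; rewrite b00 !mul0r.
    have bp : 0 < b by rewrite lt_neqAle eq_sym bn0.
    by rewrite -ler_pdivrMl //; apply: (le_q) => t At; rewrite ler_pdivrMl // H.
  exists (exist _ q qs) => s As; apply/asboolP => x Sx /=; exact: q_le.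
have rxx t : r t t by apply/asboolP.
have rtr s t u : r s t -> r t u -> r s u.
  by move=> /asboolP H1 /asboolP H2; apply/asboolP => x Sx; exact: le_trans (H2 _ Sx) (H1 _ Sx).
have [[q [sq qp]] qmax] := ZL_preorder t0 rxx rtr chain.
exists q; split => // x y Sx Sy; apply/eqP; rewrite eq_le (proj1 sq) //=.
have sh : sublinear (shift_inf q y) /\ forall x, S x -> shift_inf q y x <= p x.
  split; first exact: sublinear_shift.
  by move=> z Sz; apply: le_trans (shift_inf_self sq Sy Sz) (qp _ Sz).
have := qmax (exist _ _ sh); have rq : r (exist _ q (conj sq qp)) (exist _ _ sh).
  by apply/asboolP => z Sz /=; exact: shift_inf_self.
move=> /(_ rq)/asboolP/(_ x Sx) /= H.
by have := le_trans H (shift_inf1 sq Sy Sx); rewrite lerBrDr.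
Qed.

(** Minimizing below the shift of [p] at [x0], rather than below [p], forces [l (- x0) <= - p x0];
    linearity turns this into equality at [x0]. *)
Lemma hahn_banach p x0 : sublinear p -> S x0 -> exists l : V -> R,
  [/\ forall x y, S x -> S y -> l (x + y) = l x + l y,
      forall (a : R) x, S x -> l (a%:C%C *: x) = a * l x,
      forall x, S x -> l x <= p x & l x0 = p x0].
Proof.
move=> sp Sx0.
have [l [sl lp lD]] := minimal_sublinear (sublinear_shift sp Sx0).
have lN x : S x -> l (- x) = - l x.
  move=> Sx; apply/eqP; rewrite -addr_eq0 -lD ?(SN Sx) //; last exact: SN.
  by rewrite addNr (sublinear0 sl Sx).
exists l; split => // [a x Sx|x Sx|].
- have [a0|a0] := leP 0 a; first exact: sublinearZ.
  rewrite -[a]opprK rmorphN scaleNr lN; last exact: SZ.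
  by rewrite (sublinearZ sl) ?oppr_ge0 ?mulNr // ltW.
- by apply: le_trans (lp _ Sx) _; exact: shift_inf_self.
- apply/eqP; rewrite eq_le; apply/andP; split.
    by apply: le_trans (lp _ Sx0) _; exact: shift_inf_self.
  rewrite -lerN2 -lN //; apply: le_trans (lp _ (SN Sx0)) _.
  apply: le_trans (shift_inf1 sp Sx0 (SN Sx0)) _.
  by rewrite addNr (sublinear0 sp Sx0) sub0r.
Qed.

End HahnBanach.
End RieszHahnBanach.

(** * Integration on the circle *)

Section CircleIntegrals.
Variable R : realType.
Local Notation C := (R[i]).
Local Notation mu := (@lebesgue_measure R).
Local Notation D := (@Tdom R : set (measurableTypeR R)).
Implicit Types (f g : R -> C) (h : R -> R).

Lemma measurable_Tdom : measurable D.
Proof. exact: measurable_itv. Qed.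
Local Hint Resolve measurable_Tdom : core.

Lemma mu_Tdom : mu D = 1%E.
Proof. by rewrite /Tdom lebesgue_measure_itv /= lte_fin ltr01 oppr0 adde0. Qed.

Lemma aeS (P Q : R -> Prop) : (forall t, P t -> Q t) ->
  {ae mu, forall t, P t} -> {ae mu, forall t, Q t}.
Proof. by move=> PQ; apply: (@filterS _ _ (ae_filter_ringOfSetsType mu)). Qed.

Lemma aeI (P Q : R -> Prop) : {ae mu, forall t, P t} -> {ae mu, forall t, Q t} ->
  {ae mu, forall t, P t /\ Q t}.
Proof. by apply: (@filterI _ _ (ae_filter_ringOfSetsType mu)). Qed.

Lemma aeT (P : R -> Prop) : (forall t, P t) -> {ae mu, forall t, P t}.
Proof. by move=> H; exact: aeW. Qed.

Definition rint h := mu.-integrable D (EFin \o h).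

Lemma rint_meas h : rint h -> measurable_fun D h.
Proof. by move=> /measurable_int /measurable_EFinP. Qed.

Lemma rint_le_ae h h' : measurable_fun D h -> rint h' ->
  {ae mu, forall t, D t -> `|h t| <= h' t} -> rint h.
Proof.
move=> mh ih' H; apply/integrableP; split; first exact/measurable_EFinP.
have mh' := rint_meas ih'.
apply: (@le_lt_trans _ _ (\int[mu]_(t in D) `|(EFin \o h') t|)%E).
  apply: ae_ge0_le_integral => //.
  - by apply/measurable_EFinP; exact: measurableT_comp.
  - by apply/measurable_EFinP; exact: measurableT_comp.
  - apply: (aeS _ H) => t {}H Dt /=; rewrite lee_fin.
    by apply: le_trans (H Dt) _; exact: ler_norm.
by have /integrableP[] := ih'.
Qed.

Lemma rint_le h h' : measurable_fun D h -> rint h' ->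
  (forall t, D t -> `|h t| <= h' t) -> rint h.
Proof. by move=> mh ih' H; apply: rint_le_ae mh ih' _; exact: aeT. Qed.

Lemma rintD h h' : rint h -> rint h' -> rint (fun t => h t + h' t).
Proof. by move=> i1 i2; have := integrableD measurable_Tdom i1 i2. Qed.

Lemma rintZ (a : R) h : rint h -> rint (fun t => a * h t).
Proof. by move=> i1; have := integrableZl measurable_Tdom a i1. Qed.

Lemma rintN h : rint h -> rint (fun t => - h t).
Proof. by move=> /(rintZ (-1)); apply: eq_integrable => // t _ /=; rewrite mulN1r. Qed.

Lemma rintB h h' : rint h -> rint h' -> rint (fun t => h t - h' t).
Proof. by move=> i1 i2; apply: rintD => //; exact: rintN. Qed.

Lemma rint_cst (a : R) : rint (cst a).
Proof.
apply/integrableP; split; first by apply/measurable_EFinP; exact: measurable_cst.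
under eq_integral do rewrite /=.
by rewrite integral_cst //= mu_Tdom mule1 ltry.
Qed.

Lemma rint_sum (I : Type) (r : seq I) (F : I -> R -> R) :
  (forall i, rint (F i)) -> rint (fun t => \sum_(i <- r) F i t).
Proof.
move=> H; elim: r => [|i r IH].
  by under [fun t => _]funext => t do rewrite big_nil; exact: rint_cst.
by under [fun t => _]funext => t do rewrite big_cons; exact: rintD.
Qed.

Lemma rintE h : rint h -> (\int[mu]_(t in D) (h t)%:E)%E = (\int[mu]_(t in D) h t)%:E.
Proof. by move=> ih; rewrite /Rintegral fineK // integrable_fin_num. Qed.

Lemma rint_norm h : rint h -> rint (fun t => `|h t|).
Proof. by move=> ih; exact: integrable_norm ih. Qed.

Lemma le_rint h h' : rint h -> rint h' -> (forall t, D t -> h t <= h' t) ->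
  \int[mu]_(t in D) h t <= \int[mu]_(t in D) h' t.
Proof. by move=> ih ih' H; exact: le_Rintegral. Qed.

Lemma ae_eq_rint h h' : measurable_fun D h -> measurable_fun D h' ->
  {ae mu, forall t, D t -> h t = h' t} ->
  \int[mu]_(t in D) h t = \int[mu]_(t in D) h' t.
Proof.
move=> mh mh' H; congr fine; apply: ae_eq_integral => //.
- exact/measurable_EFinP.
- exact/measurable_EFinP.
- by apply: (aeS _ H) => t {}H Dt /=; rewrite H.
Qed.

Lemma le_rint_ae h h' : rint h -> rint h' -> {ae mu, forall t, D t -> h t <= h' t} ->
  \int[mu]_(t in D) h t <= \int[mu]_(t in D) h' t.
Proof.
move=> ih ih' H.
(* The maximum dominates [h] everywhere and equals [h'] almost everywhere, which reduces the claim
   to an everywhere inequality. *)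
have mm : measurable_fun D (fun t => Num.max (h t) (h' t)).
  by apply: measurable_maxr; exact: rint_meas.
have im : rint (fun t => Num.max (h t) (h' t)).
  apply: (@rint_le _ (fun t => `|h t| + `|h' t|)) => //.
    by apply: rintD; exact: rint_norm.
  move=> t _; rewrite /Num.max; case: ifP => _; first by rewrite lerDr.
  by rewrite lerDl.
rewrite -(@ae_eq_rint (fun t => Num.max (h t) (h' t)) h') //.
- by apply: le_rint => // t _; rewrite le_max lexx.
- exact: rint_meas.
- by apply: (aeS _ H) => t {}H Dt; apply/max_idPr; exact: H.
Qed.

Lemma rint_eq0_ae h : rint h -> (forall t, D t -> 0 <= h t) ->
  \int[mu]_(t in D) h t = 0 -> {ae mu, forall t, D t -> h t = 0}.
Proof.
move=> ih h0 H.
have E : (\int[mu]_(t in D) `|(h t)%:E|)%E = 0%E.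
  rewrite -[RHS](_ : (\int[mu]_(t in D) h t)%:E = 0%E); last by rewrite H.
  rewrite -rintE //; apply: eq_integral => t; rewrite inE => Dt /=.
  by rewrite ger0_norm // h0.
have := (ae_eq_integral_abs mu measurable_Tdom (measurable_int mu ih)).1 E.
by apply: aeS => t H2 Dt; have := H2 Dt; move=> [].
Qed.

Lemma rint_ge0 h : (forall t, D t -> 0 <= h t) -> 0 <= \int[mu]_(t in D) h t.
Proof. exact: Rintegral_ge0. Qed.

Lemma rintegralD h h' : rint h -> rint h' ->
  \int[mu]_(t in D) (h t + h' t) = \int[mu]_(t in D) h t + \int[mu]_(t in D) h' t.
Proof. by move=> i1 i2; exact: RintegralD. Qed.

Lemma rintegralZ (a : R) h : rint h ->
  \int[mu]_(t in D) (a * h t) = a * \int[mu]_(t in D) h t.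
Proof. by move=> i1; exact: RintegralZl. Qed.

Lemma rintegralB h h' : rint h -> rint h' ->
  \int[mu]_(t in D) (h t - h' t) = \int[mu]_(t in D) h t - \int[mu]_(t in D) h' t.
Proof. by move=> i1 i2; exact: RintegralB. Qed.

Lemma rintegral_cst (a : R) : \int[mu]_(t in D) a = a.
Proof.
transitivity (a * fine (mu D)); last by rewrite mu_Tdom mulr1.
exact: (Rintegral_cst mu measurable_Tdom).
Qed.

Lemma rintegral_sum (I : Type) (r : seq I) (F : I -> R -> R) :
  (forall i, rint (F i)) ->
  \int[mu]_(t in D) (\sum_(i <- r) F i t) = \sum_(i <- r) \int[mu]_(t in D) F i t.
Proof.
move=> H; elim: r => [|i r IH].
  under eq_Rintegral do rewrite big_nil.
  by rewrite big_nil Rintegral_cst // mul0r.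
under eq_Rintegral do rewrite big_cons.
by rewrite big_cons rintegralD ?IH //; exact: rint_sum.
Qed.

Lemma cmeasD f g : cmeas f -> cmeas g -> cmeas (fun t => f t + g t).
Proof.
move=> [a b] [c d]; split.
  by under [fun t => _]funext => t do rewrite ReD; exact: measurable_funD.
by under [fun t => _]funext => t do rewrite ImD; exact: measurable_funD.
Qed.

Lemma cmeasM f g : cmeas f -> cmeas g -> cmeas (fun t => f t * g t).
Proof.
move=> [a b] [c d]; split.
  under [fun t => _]funext => t do rewrite ReM.
  by apply: measurable_funB; exact: measurable_funM.
under [fun t => _]funext => t do rewrite ImM.
by apply: measurable_funD; exact: measurable_funM.
Qed.

Lemma cmeas_cst (z : C) : cmeas (cst z).
Proof. by split; exact: measurable_cst. Qed.

Lemma cmeas_real h : measurable_fun D h -> cmeas (fun t => (h t)%:C%C).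
Proof. by move=> mh; split => //=; exact: measurable_cst. Qed.

Lemma cmeasJ f : cmeas f -> cmeas (fun t => conjc (f t)).
Proof.
move=> [a b]; split.
  by under [fun t => _]funext => t do rewrite ReJ.
under [fun t => _]funext => t do rewrite ImJ.
exact: measurableT_comp.
Qed.

Lemma cmeasN f : cmeas f -> cmeas (fun t => - f t).
Proof.
move=> mf; under [fun t => _]funext => t do rewrite -mulN1r.
by apply: cmeasM => //; exact: cmeas_cst.
Qed.

Lemma cmeas_sum (I : Type) (r : seq I) (F : I -> R -> C) :
  (forall i, cmeas (F i)) -> cmeas (fun t => \sum_(i <- r) F i t).
Proof.
move=> H; elim: r => [|i r IH].
  by under [fun t => _]funext => t do rewrite big_nil; exact: cmeas_cst.
by under [fun t => _]funext => t do rewrite big_cons; exact: cmeasD.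
Qed.

Lemma meas_cabs2 f : cmeas f -> measurable_fun D (fun t => cabs2 (f t)).
Proof. by move=> [a b]; apply: measurable_funD; exact: measurable_funX. Qed.

Lemma meas_sqrt h : measurable_fun D h -> measurable_fun D (fun t => Num.sqrt (h t)).
Proof.
move=> mh; apply: (measurableT_comp (f:=@Num.sqrt R)) => //.
exact: continuous_measurable_fun (@sqrt_continuous R).
Qed.

Lemma meas_cabs f : cmeas f -> measurable_fun D (fun t => cabs (f t)).
Proof. by move=> /meas_cabs2/meas_sqrt. Qed.

Lemma L1P f : Lp 1 f <-> rint (fun t => complex.Re (f t)) /\ rint (fun t => complex.Im (f t)).
Proof.
split.
  move=> [mf Hf]; have ic : rint (fun t => cabs (f t)).
    apply/integrableP; split; first by apply/measurable_EFinP; exact: meas_cabs.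
    move: Hf; apply: le_lt_trans.
    rewrite le_eqVlt; apply/orP; left; apply/eqP; apply: eq_integral => t _ /=.
    by rewrite ger0_norm ?cabs_ge0 // expr1.
  have [a b] := mf.
  by split; apply: (rint_le _ ic) => // t _; [exact: le_Re_cabs|exact: le_Im_cabs].
move=> [iR iI]; have mf : cmeas f by split; exact: rint_meas.
split => //.
have ic : rint (fun t => cabs (f t)).
  apply: (@rint_le _ (fun t => `|complex.Re (f t)| + `|complex.Im (f t)|)).
  - exact: meas_cabs.
  - by apply: rintD; exact: rint_norm.
  - by move=> t _; rewrite ger0_norm ?cabs_ge0 //; exact: cabs_le_ReIm.
have /integrableP[_] := ic; apply: le_lt_trans.
rewrite le_eqVlt; apply/orP; left; apply/eqP; apply: eq_integral => t _ /=.
by rewrite ger0_norm ?cabs_ge0 // expr1.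
Qed.

Lemma L1_cabs f : Lp 1 f -> rint (fun t => cabs (f t)).
Proof.
move=> /[dup] [[mf _]] /L1P[iR iI].
apply: (@rint_le _ (fun t => `|complex.Re (f t)| + `|complex.Im (f t)|)).
- exact: meas_cabs.
- by apply: rintD; exact: rint_norm.
- by move=> t _; rewrite ger0_norm ?cabs_ge0 //; exact: cabs_le_ReIm.
Qed.

Lemma L1_le_ae f h : cmeas f -> rint h ->
  {ae mu, forall t, D t -> cabs (f t) <= h t} -> Lp 1 f.
Proof.
move=> [a b] ih H; apply/L1P; split; apply: (rint_le_ae _ ih) => //;
  apply: (aeS _ H) => t {}H Dt; apply: le_trans (H Dt).
- exact: le_Re_cabs.
- exact: le_Im_cabs.
Qed.

Lemma L1_le f h : cmeas f -> rint h ->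
  (forall t, D t -> cabs (f t) <= h t) -> Lp 1 f.
Proof. by move=> mf ih H; apply: L1_le_ae mf ih _; exact: aeT. Qed.

Lemma L1D f g : Lp 1 f -> Lp 1 g -> Lp 1 (fun t => f t + g t).
Proof.
move=> Lf Lg; apply: (@L1_le _ (fun t => cabs (f t) + cabs (g t))).
- by apply: cmeasD; [case: Lf|case: Lg].
- by apply: rintD; exact: L1_cabs.
- by move=> t _; exact: cabsD.
Qed.

Lemma L1_bmul f g (M : R) : cmeas g -> Lp 1 f ->
  {ae mu, forall t, D t -> cabs (g t) <= M} -> Lp 1 (fun t => g t * f t).
Proof.
move=> mg Lf H; apply: (@L1_le_ae _ (fun t => M * cabs (f t))).
- by apply: cmeasM => //; case: Lf.
- by apply: rintZ; exact: L1_cabs.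
- by apply: (aeS _ H) => t {}H Dt; rewrite cabsM ler_wpM2r ?cabs_ge0 // H.
Qed.

Lemma L1Z (z : C) f : Lp 1 f -> Lp 1 (fun t => z * f t).
Proof.
move=> Lf; apply: (@L1_bmul f (cst z) (cabs z) (cmeas_cst z) Lf); exact: aeT.
Qed.

Lemma L1N f : Lp 1 f -> Lp 1 (fun t => - f t).
Proof. by move=> /(L1Z (-1)); under [fun t => _]funext => t do rewrite mulN1r. Qed.

Lemma L1B f g : Lp 1 f -> Lp 1 g -> Lp 1 (fun t => f t - g t).
Proof. by move=> Lf Lg; apply: L1D => //; exact: L1N. Qed.

Lemma L1_cst (z : C) : Lp 1 (cst z).
Proof.
apply: (@L1_le _ (cst (cabs z)) (cmeas_cst z) (rint_cst _)). by move=> t _ /=.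
Qed.

Lemma L1_sum (I : Type) (r : seq I) (F : I -> R -> C) :
  (forall i, Lp 1 (F i)) -> Lp 1 (fun t => \sum_(i <- r) F i t).
Proof.
move=> H; elim: r => [|i r IH].
  by under [fun t => _]funext => t do rewrite big_nil; exact: L1_cst.
by under [fun t => _]funext => t do rewrite big_cons; exact: L1D.
Qed.

Lemma L2P f : Lp 2 f <-> cmeas f /\ rint (fun t => cabs2 (f t)).
Proof.
have E : (\int[mu]_(t in D) (cabs (f t) ^+ 2)%:E = \int[mu]_(t in D) `|(cabs2 (f t))%:E|)%E.
  by apply: eq_integral => t _ /=; rewrite sqr_cabs ger0_norm // cabs2_ge0.
split=> [[mf Hf]|[mf /integrableP[_ Hf]]]; split => //.
  by apply/integrableP; split; [apply/measurable_EFinP; exact: meas_cabs2|rewrite -E].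
by rewrite E.
Qed.

Lemma L2_le_ae f h : cmeas f -> rint h ->
  {ae mu, forall t, D t -> cabs2 (f t) <= h t} -> Lp 2 f.
Proof.
move=> mf ih H; apply/L2P; split => //; apply: (rint_le_ae _ ih).
  exact: meas_cabs2.
by apply: (aeS _ H) => t {}H Dt; rewrite ger0_norm ?cabs2_ge0 // H.
Qed.

Lemma L2_cabs2 f : Lp 2 f -> rint (fun t => cabs2 (f t)).
Proof. by move=> /L2P[]. Qed.

Lemma cabs2D_le (x y : C) : cabs2 (x + y) <= 2 * cabs2 x + 2 * cabs2 y.
Proof.
case: x y => a b [c d]; rewrite /cabs2 /=.
have := sqr_ge0 (a - c); have := sqr_ge0 (b - d); rewrite !expr2; nra.
Qed.

Lemma L2D f g : Lp 2 f -> Lp 2 g -> Lp 2 (fun t => f t + g t).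
Proof.
move=> Lf Lg; apply: (@L2_le_ae _ (fun t => 2 * cabs2 (f t) + 2 * cabs2 (g t))).
- by apply: cmeasD; [case: Lf|case: Lg].
- by apply: rintD; apply: rintZ; exact: L2_cabs2.
- by apply: aeT => t _; exact: cabs2D_le.
Qed.

Lemma L2_bmul f g (M : R) : cmeas g -> Lp 2 f ->
  {ae mu, forall t, D t -> cabs (g t) <= M} -> Lp 2 (fun t => g t * f t).
Proof.
move=> mg Lf H; apply: (@L2_le_ae _ (fun t => M ^+ 2 * cabs2 (f t))).
- by apply: cmeasM => //; case: Lf.
- by apply: rintZ; exact: L2_cabs2.
- apply: (aeS _ H) => t {}H Dt; rewrite cabs2M ler_wpM2r ?cabs2_ge0 // -sqr_cabs.
  by rewrite ler_sqr ?nnegrE ?cabs_ge0 ?H // (le_trans _ (H Dt)) ?cabs_ge0.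
Qed.

Lemma L2Z (z : C) f : Lp 2 f -> Lp 2 (fun t => z * f t).
Proof.
move=> Lf; apply: (@L2_bmul f (cst z) (cabs z) (cmeas_cst z) Lf); exact: aeT.
Qed.

Lemma L2J f : Lp 2 f -> Lp 2 (fun t => conjc (f t)).
Proof.
move=> Lf; apply: (@L2_le_ae _ (fun t => cabs2 (f t))).
- by apply: cmeasJ; case: Lf.
- exact: L2_cabs2.
- by apply: aeT => t _; rewrite cabs2J.
Qed.

Lemma L2_cst (z : C) : Lp 2 (cst z).
Proof. by apply/L2P; split; [exact: cmeas_cst|exact: (rint_cst (cabs2 z))]. Qed.

Lemma L2_sum (I : Type) (r : seq I) (F : I -> R -> C) :
  (forall i, Lp 2 (F i)) -> Lp 2 (fun t => \sum_(i <- r) F i t).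
Proof.
move=> H; elim: r => [|i r IH].
  by under [fun t => _]funext => t do rewrite big_nil; exact: L2_cst.
by under [fun t => _]funext => t do rewrite big_cons; exact: L2D.
Qed.

Lemma L2_mul f g : Lp 2 f -> Lp 2 g -> Lp 1 (fun t => f t * g t).
Proof.
move=> Lf Lg; apply: (@L1_le _ (fun t => cabs2 (f t) + cabs2 (g t))).
- by apply: cmeasM; [case: Lf|case: Lg].
- by apply: rintD; exact: L2_cabs2.
- move=> t _; rewrite cabsM -!sqr_cabs.
  have := sqr_ge0 (cabs (f t) - cabs (g t)); have := cabs_ge0 (f t); have := cabs_ge0 (g t).
  rewrite !expr2; nra.
Qed.

Lemma L2_L1 f : Lp 2 f -> Lp 1 f.
Proof.
move=> Lf; have := L2_mul Lf (L2_cst 1).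
by under [fun t => _]funext => t do rewrite mulr1.
Qed.

Lemma cint_ae f g : cmeas f -> cmeas g -> {ae mu, forall t, D t -> f t = g t} ->
  cint f = cint g.
Proof.
move=> [a b] [c d] H; congr Complex; apply: ae_eq_rint => //;
  by apply: (aeS _ H) => t {}H Dt; rewrite H.
Qed.

Lemma cintD f g : Lp 1 f -> Lp 1 g -> cint (fun t => f t + g t) = cint f + cint g.
Proof.
move=> /L1P[a b] /L1P[c d]; apply: eqC; rewrite (ReD, ImD) /= -rintegralD //;
  by apply: eq_Rintegral => t _; rewrite (ReD, ImD).
Qed.

Lemma cintZ (z : C) f : Lp 1 f -> cint (fun t => z * f t) = z * cint f.
Proof.
move=> /L1P[a b]; case: z => x y; apply: eqC; rewrite (ReM, ImM) /=.
  rewrite -!rintegralZ // -rintegralB; [|exact: rintZ..].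
  by apply: eq_Rintegral => t _; rewrite ReM.
rewrite -!rintegralZ // -rintegralD; [|exact: rintZ..].
by apply: eq_Rintegral => t _; rewrite ImM.
Qed.

Lemma cintN f : Lp 1 f -> cint (fun t => - f t) = - cint f.
Proof.
by move=> Lf; under [fun t => _]funext => t do rewrite -mulN1r; rewrite cintZ // mulN1r.
Qed.

Lemma cintB f g : Lp 1 f -> Lp 1 g -> cint (fun t => f t - g t) = cint f - cint g.
Proof. by move=> Lf Lg; rewrite cintD ?cintN //; exact: L1N. Qed.

Lemma cint_sum (I : Type) (r : seq I) (F : I -> R -> C) :
  (forall i, Lp 1 (F i)) ->
  cint (fun t => \sum_(i <- r) F i t) = \sum_(i <- r) cint (F i).
Proof.
move=> H; elim: r => [|i r IH].
  rewrite big_nil; under [fun t => _]funext => t do rewrite big_nil.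
  by apply: eqC; rewrite /= Rintegral_cst // mul0r.
under [fun t => _]funext => t do rewrite big_cons.
by rewrite big_cons cintD ?IH //; exact: L1_sum.
Qed.

Lemma cintJ f : Lp 1 f -> cint (fun t => conjc (f t)) = conjc (cint f).
Proof.
move=> /L1P[a b]; apply: eqC; rewrite (ReJ, ImJ) /=.
  by apply: eq_Rintegral => t _; rewrite ReJ.
rewrite -mulN1r -rintegralZ //.
by apply: eq_Rintegral => t _; rewrite ImJ mulN1r.
Qed.

Lemma cint_cst (z : C) : cint (cst z) = z.
Proof.
by apply: eqC; exact: rintegral_cst.
Qed.

Lemma Re_cint f : complex.Re (cint f) = \int[mu]_(t in D) complex.Re (f t).
Proof. by []. Qed.

Lemma cabs_cint_le f h : Lp 1 f -> rint h ->
  {ae mu, forall t, D t -> cabs (f t) <= h t} ->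
  cabs (cint f) <= \int[mu]_(t in D) h t.
Proof.
move=> Lf ih H; have [c c1 <-] := phase (cint f).
rewrite -cintZ // Re_cint; apply: le_rint_ae => //.
  by have /L1P[] := L1Z c Lf.
apply: (aeS _ H) => t {}H Dt; apply: le_trans (ler_norm _) _.
by apply: le_trans (le_Re_cabs _) _; rewrite cabsM c1 mul1r H.
Qed.

Definition ek (j : int) (t : R) : C := expi (2 * pi * j%:~R * t).

Lemma expiD (x y : R) : expi (x + y) = expi x * expi y.
Proof. by rewrite /expi cosD sinD; apply: eqC => /=; ring. Qed.

Lemma ekD j l t : ek (j + l) t = ek j t * ek l t.
Proof. by rewrite /ek -expiD intrD; congr expi; ring. Qed.

Lemma ek0 t : ek 0 t = 1.
Proof. by rewrite /ek mulr0 mul0r /expi cos0 sin0. Qed.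

Lemma ekJ j t : conjc (ek j t) = ek (- j) t.
Proof. by rewrite /ek intrN mulrN mulNr /expi cosN sinN. Qed.

Lemma ekK j t : ek j t * ek (- j) t = 1.
Proof. by rewrite -ekD subrr ek0. Qed.

Lemma cabs2_ek j t : cabs2 (ek j t) = 1.
Proof. exact: cos2Dsin2. Qed.

Lemma cabs_ek j t : cabs (ek j t) = 1.
Proof. by rewrite /cabs cabs2_ek sqrtr1. Qed.

Lemma cmeas_ek j : cmeas (ek j).
Proof.
have ml : measurable_fun D (fun t : R => 2 * pi * j%:~R * t).
  by apply: measurable_funM => //; exact: measurable_cst.
split.
  apply: (measurableT_comp (f := @cos R)) => //.
  exact: continuous_measurable_fun (@continuous_cos R).
apply: (measurableT_comp (f := @sin R)) => //.
exact: continuous_measurable_fun (@continuous_sin R).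
Qed.

Lemma L1_ek j f : Lp 1 f -> Lp 1 (fun t => f t * ek j t).
Proof.
move=> Lf; under [fun t => _]funext => t do rewrite mulrC.
apply: (@L1_bmul f (ek j) 1 (cmeas_ek j) Lf); apply: aeT => t _; by rewrite cabs_ek.
Qed.

Lemma L2_ek j f : Lp 2 f -> Lp 2 (fun t => f t * ek j t).
Proof.
move=> Lf; under [fun t => _]funext => t do rewrite mulrC.
apply: (@L2_bmul f (ek j) 1 (cmeas_ek j) Lf); apply: aeT => t _; by rewrite cabs_ek.
Qed.

Lemma L2_ek1 j : Lp 2 (ek j).
Proof.
have := L2_ek j (L2_cst 1); by under [fun t => _]funext => t do rewrite mul1r.
Qed.

Lemma fourierE f j : fourier f j = cint (fun t => f t * ek (- j) t).
Proof.
rewrite /fourier; congr cint; apply/funext => t.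
by rewrite /ek intrN mulrN mulNr.
Qed.

End CircleIntegrals.

(** * Completeness of the space of square-integrable functions *)

Section RieszFischer.
Variable R : realType.
Local Notation C := (R[i]).
Local Notation mu := (@lebesgue_measure R).
Local Notation D := (@Tdom R : set (measurableTypeR R)).
Local Hint Resolve measurable_Tdom : core.

Let expVn (k : nat) : R := 2^-1 ^+ k.

Let expVn_gt0 k : 0 < expVn k.
Proof. by rewrite exprn_gt0. Qed.

Let sum_expVn n : \sum_(k < n) expVn k <= 2.
Proof.
suff -> : \sum_(k < n) expVn k = 2 - 2 * expVn n by rewrite gerBl mulr_ge0 // ltW.
elim: n => [|n IH]; first by rewrite big_ord0 /expVn expr0 mulr1 subrr.
by rewrite big_ord_recr /= IH /expVn exprS; field.
Qed.

Lemma meas_EFin (h : R -> R) : measurable_fun D h -> measurable_fun D (fun t => (h t)%:E).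
Proof. by move=> mh; apply/measurable_EFinP. Qed.

Lemma cvg_rEFin (v : nat -> R) (l : R) : v n @[n --> \oo] --> l ->
  (v n)%:E @[n --> \oo] --> l%:E.
Proof. by move=> vl; apply: cvg_EFin => //; exact: nearW. Qed.

Lemma rint_measT (h : R -> R) : measurable_fun D h ->
  (\int[mu]_(t in D) `|(h t)%:E| < +oo)%E -> rint h.
Proof. by move=> mh H; apply/integrableP; split => //; exact/measurable_EFinP. Qed.

(** * Almost everywhere convergence of rapidly Cauchy sequences *)

Section Subsequence.
Variable u : nat -> R -> R.
Hypothesis mu_u : forall n, measurable_fun D (u n).
Hypothesis iu : forall p q, rint (fun t => (u p t - u q t) ^+ 2).
Hypothesis fast : forall k, \int[mu]_(t in D) (u k.+1 t - u k t) ^+ 2 <= expVn k ^+ 2.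

Let a k t := `|u k.+1 t - u k t|.

Let ma k : measurable_fun D (a k).
Proof. by apply: measurableT_comp => //; exact: measurable_funB. Qed.

Let a_int k : (\int[mu]_(t in D) (a k t)%:E <= (expVn k)%:E)%E.
Proof.
have e0 := expVn_gt0 k.
(* The weighted inequality x <= e/2 + x^2/(2e) with e = 2^-k turns the L^2 bound 2^-k into an L^1
   bound 2^-k. *)
pose h t := 2^-1 * expVn k + 2^-1 * (expVn k)^-1 * (u k.+1 t - u k t) ^+ 2.
have ih : rint h by apply: rintD; [exact: rint_cst|exact: rintZ].
have ah t : a k t <= h t.
  rewrite /a /h -[_ ^+ 2]real_normK ?num_real //; set x := `|_|.
  have : 0 <= (x - expVn k) ^+ 2 / (2 * expVn k).
    by rewrite divr_ge0 ?sqr_ge0 ?mulr_ge0 // ltW.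
  rewrite [X in 0 <= X](_ : _ = 2^-1 * expVn k + 2^-1 * (expVn k)^-1 * x ^+ 2 - x).
    by rewrite subr_ge0.
  by field; rewrite gt_eqF.
apply: (@le_trans _ _ (\int[mu]_(t in D) (h t)%:E)%E).
  apply: ge0_le_integral => //.
  - by move=> t _; rewrite lee_fin normr_ge0.
  - exact: meas_EFin.
  - by apply: meas_EFin; exact: rint_meas.
  - by move=> t _; rewrite lee_fin ah.
rewrite rintE // lee_fin /h rintegralD; [|exact: rint_cst|exact: rintZ].
rewrite rintegral_cst rintegralZ //.
apply: (@le_trans _ _ (2^-1 * expVn k + 2^-1 * (expVn k)^-1 * expVn k ^+ 2)).
  by rewrite lerD2l ler_wpM2l ?fast // mulr_ge0 // invr_ge0 ltW.
by rewrite le_eqVlt; apply/orP; left; apply/eqP; field; rewrite gt_eqF.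
Qed.

(** By monotone convergence the sum of the increments has integral at most 2, hence is finite almost
    everywhere. *)
Let sum_a_fin : {ae mu, forall t, D t -> (\sum_(0 <= k <oo) (a k t)%:E < +oo)%E}.
Proof.
have ms : measurable_fun D (fun t => \sum_(0 <= k <oo) (a k t)%:E)%E.
  apply: (@ge0_emeasurable_sum _ _ _ _ (fun k t => (a k t)%:E) xpredT).
    by move=> k t _ _; rewrite lee_fin normr_ge0.
  by move=> k _; exact: meas_EFin.
have H : (\int[mu]_(t in D) (\sum_(0 <= k <oo) (a k t)%:E) <= 2%:E)%E.
  rewrite integral_nneseries //; [|by move=> k; exact: meas_EFin|by move=> k t _; rewrite lee_fin normr_ge0].
  apply: lime_le.
    by apply: is_cvg_nneseries => k _ _; apply: integral_ge0 => t _; rewrite lee_fin normr_ge0.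
  apply: nearW => n; rewrite big_mkord.
  apply: (@le_trans _ _ (\sum_(k < n) (expVn k)%:E)%E).
    by apply: lee_sum => k _; exact: a_int.
  by rewrite sumEFin lee_fin.
have : mu.-integrable D (fun t => \sum_(0 <= k <oo) (a k t)%:E)%E.
  apply/integrableP; split => //; apply: le_lt_trans (ltry 2).
  apply: le_trans H; rewrite le_eqVlt; apply/orP; left; apply/eqP.
  apply: eq_integral => t _; rewrite gee0_abs //.
  by apply: nneseries_ge0 => k _ _; rewrite lee_fin normr_ge0.
move=> /(integrable_ae (@measurable_Tdom R)); apply: aeS => t H2 Dt.
by have := H2 Dt; rewrite fin_numE => /andP[_]; rewrite ltey.
Qed.

Let u_cvg t : (\sum_(0 <= k <oo) (a k t)%:E < +oo)%E -> exists l : R, u n t @[n --> \oo] --> l.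
Proof.
move=> fin; have s0 : (0 <= \sum_(0 <= k <oo) (a k t)%:E)%E.
  by apply: nneseries_ge0 => k _ _; rewrite lee_fin normr_ge0.
have c1 : cvgn [normed series (fun k => u k.+1 t - u k t)].
  apply: nondecreasing_is_cvgn.
    apply/nondecreasing_seqP => n.
    change (\sum_(0 <= k < n) a k t <= \sum_(0 <= k < n.+1) a k t).
    by rewrite big_nat_recr //= lerDl; exact: normr_ge0.
  exists (fine (\sum_(0 <= k <oo) (a k t)%:E)%E) => _ [n _ <-].
  change (\sum_(0 <= k < n) a k t <= fine (\sum_(0 <= k <oo) (a k t)%:E)%E).
  rewrite -lee_fin fineK ?ge0_fin_numE // -sumEFin.
  by apply: nneseries_lim_ge => k _ _; rewrite lee_fin normr_ge0.
have c2 := normed_cvg c1.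
exists (u 0%N t + limn (series (fun k => u k.+1 t - u k t))).
have -> : (fun n => u n t) = (fun n => u 0%N t + series (fun k => u k.+1 t - u k t) n).
  by apply/funext => n; rewrite /series /= telescope_sumr // addrC subrK.
by apply: cvgD => //; exact: cvg_cst.
Qed.

(** An upper limit in the extended reals is measurable whether or not the sequence converges; [fine]
    maps infinite values to 0, which affects a null set only. *)
Definition ae_lim t := fine (limn_esup (fun n => (u n t)%:E)).

Lemma ae_limP : {ae mu, forall t, D t -> u n t @[n --> \oo] --> ae_lim t}.
Proof.
apply: (aeS _ sum_a_fin) => t H Dt; have [l ul] := u_cvg (H Dt).
suff -> : ae_lim t = l by [].
by have [_ E] := cvg_limn_einf_sup (cvg_rEFin ul); rewrite /ae_lim E.
Qed.

Lemma meas_ae_lim : measurable_fun D ae_lim.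
Proof.
apply: (measurableT_comp (f := @fine R)) => //.
by apply: measurable_fun_limn_esup => n; exact: meas_EFin.
Qed.

Lemma ae_lim_fatou N e : 
  (forall p q, (N <= p)%N -> (N <= q)%N -> \int[mu]_(t in D) (u p t - u q t) ^+ 2 <= e) ->
  forall p, (N <= p)%N -> rint (fun t => (u p t - ae_lim t) ^+ 2) /\
     \int[mu]_(t in D) (u p t - ae_lim t) ^+ 2 <= e.
Proof.
move=> H p Np.
(* The index is shifted by [N] so that the Cauchy bound applies to every term entering Fatou's
   lemma. *)
pose f k t := ((u p t - u (k + N)%N t) ^+ 2)%:E.
have mf k : measurable_fun D (f k).
  by apply: meas_EFin; apply: measurable_funX; exact: measurable_funB.
have mg : measurable_fun D (fun t => (u p t - ae_lim t) ^+ 2).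
  by apply: measurable_funX; apply: measurable_funB => //; exact: meas_ae_lim.
have f0 k t : D t -> (0 <= f k t)%E by move=> _; rewrite lee_fin sqr_ge0.
have := fatou mu (@measurable_Tdom R) mf f0.
have -> : (\int[mu]_(t in D) limn_einf (f^~ t) = \int[mu]_(t in D) ((u p t - ae_lim t) ^+ 2)%:E)%E.
  apply: ae_eq_integral => //.
  - apply: (measurableT_comp (f := @oppe R) (g := fun t => limn_esup (fun k => - f k t)%E)) => //.
    apply: (@measurable_fun_limn_esup _ _ _ _ (fun k t => - f k t)%E) => k.
    apply: (measurableT_comp (f := @oppe R) (g := f k)); [exact: oppe_measurable|exact: mf].
  - exact: (meas_EFin mg).
  - apply: (aeS _ ae_limP) => t H2 Dt; have {}H2 := H2 Dt.
    have cN : u (k + N)%N t @[k --> \oo] --> ae_lim t by rewrite -(cvg_shiftn N) in H2.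
    have c1 : u p t - u (k + N)%N t @[k --> \oo] --> u p t - ae_lim t.
      by apply: cvgB => //; exact: cvg_cst.
    have c2 : (u p t - u (k + N)%N t) ^+ 2 @[k --> \oo] --> (u p t - ae_lim t) ^+ 2.
      by under eq_fun do rewrite expr2; rewrite expr2; exact: cvgM.
    by have [E _] := cvg_limn_einf_sup (cvg_rEFin c2); rewrite -E.
move=> fat.
have le_e : (\int[mu]_(t in D) ((u p t - ae_lim t) ^+ 2)%:E <= e%:E)%E.
  apply: le_trans fat _; rewrite limn_einf_lim; apply: lime_le; first exact: is_cvg_einfs.
  apply: nearW => k; apply: (@le_trans _ _ (\int[mu]_(x in D) f k x)%E).
    by apply: ereal_inf_lbound; exists k => /=.
  by rewrite rintE // lee_fin; apply: H => //; rewrite leq_addl.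
have ir : rint (fun t => (u p t - ae_lim t) ^+ 2).
  apply: rint_measT => //; apply: le_lt_trans (ltry e); apply: le_trans le_e.
  rewrite le_eqVlt; apply/orP; left; apply/eqP; apply: eq_integral => t _.
  by rewrite gee0_abs // lee_fin sqr_ge0.
by split => //; move: le_e; rewrite rintE.
Qed.

End Subsequence.

Lemma riesz_fischer (u : nat -> R -> R) :
  (forall n, measurable_fun D (u n)) -> (forall n, rint (fun t => u n t ^+ 2)) ->
  (forall e, 0 < e -> exists N, forall p q, (N <= p)%N -> (N <= q)%N ->
     \int[mu]_(t in D) (u p t - u q t) ^+ 2 <= e) ->
  exists g : R -> R, [/\ measurable_fun D g, rint (fun t => g t ^+ 2),
    (forall p, rint (fun t => (u p t - g t) ^+ 2)) &
    forall e, 0 < e -> exists N, forall p, (N <= p)%N ->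
     \int[mu]_(t in D) (u p t - g t) ^+ 2 <= e].
Proof.
move=> mu_u iu cau.
have rintB2 (f g : R -> R) : measurable_fun D f -> measurable_fun D g ->
    rint (fun t => f t ^+ 2) -> rint (fun t => g t ^+ 2) -> rint (fun t => (f t - g t) ^+ 2).
  move=> mf mg i_f i_g; apply: (@rint_le _ _ (fun t => 2 * f t ^+ 2 + 2 * g t ^+ 2)).
  - by apply: measurable_funX; exact: measurable_funB.
  - by apply: rintD; exact: rintZ.
  - move=> t _; rewrite ger0_norm ?sqr_ge0 //.
    have := sqr_ge0 (f t + g t); rewrite !expr2; nra.
have e_gt0 k : 0 < expVn k ^+ 2 by rewrite exprn_gt0.
have [phi phiP] := choice (fun k => cau _ (e_gt0 k)).
(* The running maximum makes the chosen indices nondecreasing, so the bound for [phi k] also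
   controls [psi k.+1]. *)
pose psi k := (\max_(i < k.+1) phi i)%N.
have psi_ge k l : (k <= l)%N -> (phi k <= psi l)%N.
  by move=> kl; rewrite -ltnS in kl; have := @leq_bigmax _ (fun i : 'I_l.+1 => phi i) (Ordinal kl).
pose v k := u (psi k).
have mv n : measurable_fun D (v n) by exact: mu_u.
have iv p q : rint (fun t => (v p t - v q t) ^+ 2).
  exact: (rintB2 _ _ (mv p) (mv q) (iu _) (iu _)).
have fast k : \int[mu]_(t in D) (v k.+1 t - v k t) ^+ 2 <= expVn k ^+ 2.
  by apply: phiP; exact: psi_ge.
pose g := ae_lim v.
have mg : measurable_fun D g by exact: meas_ae_lim.
have cv k p : (k <= p)%N -> rint (fun t => (v p t - g t) ^+ 2) /\
     \int[mu]_(t in D) (v p t - g t) ^+ 2 <= expVn k ^+ 2.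
  move=> kp; apply: (ae_lim_fatou mv iv fast _ kp) => p' q' h1 h2.
  by apply: phiP; exact: psi_ge.
have ig : rint (fun t => g t ^+ 2).
  have [i0 _] := cv 0%N 0%N (leqnn _).
  have := rintB2 _ _ (mv 0%N) _ (iu _) i0.
  move=> /(_ (measurable_funB (mv 0%N) mg)); apply: eq_integrable => // t _.
  by rewrite /= /v; congr (_ ^+ 2)%:E; ring.
exists g; split => // [p|e e0]; first exact: (rintB2 _ _ (mu_u p) mg (iu _) ig).
have [N NP] : exists k, expVn k ^+ 2 <= e / 4.
  have e4 : 0 < e / 4 by rewrite divr_gt0.
  have : expVn n @[n --> \oo] --> (0 : R).
    by apply: cvg_expr; rewrite ger0_norm ?invr_ge0 // invf_lt1 // ltr1n.
  move=> /cvgrPdist_le/(_ _ e4)[k _ /(_ k (leqnn k))] /=.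
  have v0 := ltW (expVn_gt0 k).
  rewrite sub0r normrN ger0_norm // => H; exists k.
  apply: le_trans H; rewrite expr2 ler_piMl //.
  by rewrite exprn_ile1 // ?invr_ge0 // invf_le1 // ler1n.
exists (phi N) => p Np.
have [i1 b1] := cv N N (leqnn _).
have b2 : \int[mu]_(t in D) (u p t - v N t) ^+ 2 <= expVn N ^+ 2.
  by apply: phiP => //; exact: psi_ge.
have i2 : rint (fun t => (u p t - v N t) ^+ 2).
  exact: (rintB2 _ _ (mu_u p) (mv N) (iu _) (iu _)).
apply: (@le_trans _ _ (2 * (e / 4) + 2 * (e / 4))); last by lra.
apply: le_trans (lerD (ler_wpM2l _ (le_trans b2 NP)) (ler_wpM2l _ (le_trans b1 NP))) => //.
rewrite -!rintegralZ // -rintegralD; [|exact: rintZ..].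
apply: le_rint; [exact: (rintB2 _ _ (mu_u p) mg (iu _) ig)|by apply: rintD; exact: rintZ|] => t _.
have := sqr_ge0 ((u p t - v N t) - (v N t - g t)); rewrite !expr2; nra.
Qed.

End RieszFischer.

(** * Uniqueness of Fourier coefficients *)

Section Uniqueness.
Variable R : realType.
Local Notation C := (R[i]).
Local Notation mu := (@lebesgue_measure R).
Local Notation D := (@Tdom R : set (measurableTypeR R)).
Local Hint Resolve measurable_Tdom : core.

Lemma ae_neq (a : R) : {ae mu, forall t, t <> a}.
Proof.
exists [set a]; split; [exact: measurable_set1|exact: lebesgue_measure_set1|].
by move=> t /=; rewrite not_notE.
Qed.

Lemma rint_lim (h : nat -> R -> R) (g G : R -> R) :
  (forall n, measurable_fun D (h n)) -> measurable_fun D g -> rint G ->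
  (forall n t, D t -> `|h n t| <= G t) ->
  (forall t, D t -> h n t @[n --> \oo] --> g t) ->
  \int[mu]_(t in D) h n t @[n --> \oo] --> \int[mu]_(t in D) g t.
Proof.
move=> mh mg iG hG hg.
have [||||||_ _ cv] := @dominated_convergence _ _ _ mu D _ (fun n t => (h n t)%:E)
   (fun t => (g t)%:E) (fun t => (G t)%:E).
- exact: measurable_Tdom.
- by move=> n; exact: (meas_EFin (mh n)).
- exact: (meas_EFin mg).
- by apply: aeT => t Dt; apply: cvg_rEFin; exact: hg.
- exact: iG.
- by apply: aeT => t n Dt; rewrite lee_fin; exact: hG.
have ih n : rint (h n) by apply: (rint_le (mh n) iG) => t Dt; exact: hG.
have ig : rint g.
  apply: (rint_le mg iG) => t Dt; have c := hg t Dt.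
  have /cvg_lim <- // : `|h n t| @[n --> \oo] --> `|g t| by exact: cvg_norm.
  by apply: limr_le; [apply/cvg_ex; exists `|g t|; exact: cvg_norm|apply: nearW => n; exact: hG].
by move: cv; rewrite (rintE ig) => /fine_cvgP[_].
Qed.

Lemma rint_lim0 (h : nat -> R -> R) (g G : R -> R) :
  (forall n, measurable_fun D (h n)) -> measurable_fun D g -> rint G ->
  (forall n t, D t -> `|h n t| <= G t) ->
  (forall t, D t -> h n t @[n --> \oo] --> g t) ->
  (forall n, \int[mu]_(t in D) h n t = 0) -> \int[mu]_(t in D) g t = 0.
Proof.
move=> mh mg iG hG hg h0; have := rint_lim mh mg iG hG hg.
by under eq_fun do rewrite h0; move/cvg_lim => <- //; rewrite lim_cst.
Qed.

(* The iteration s -> s (3 - s^2) / 2 maps [-1, 1] to itself and converges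
   pointwise to the sign function. *)
Fixpoint sgn_iter (n : nat) (x : R) : R :=
  if n is n'.+1 then 2^-1 * (sgn_iter n' x * (3 - sgn_iter n' x ^+ 2)) else x.

Lemma sgn_iterN n x : sgn_iter n (- x) = - sgn_iter n x.
Proof. by elim: n => //= n ->; rewrite sqrrN mulNr mulrN. Qed.

Lemma sgn_iter0 n : sgn_iter n 0 = 0.
Proof. by elim: n => //= n ->; rewrite mul0r mulr0. Qed.

(** One step multiplies the gap [1 - s] by [1 - s * (1 + s) / 2], which is at most [1 - x / 2] as
    long as [s >= x]. *)
Lemma sgn_iter_bnd n x : 0 <= x <= 1 ->
  [/\ x <= sgn_iter n x, sgn_iter n x <= 1 & 1 - sgn_iter n x <= (1 - x / 2) ^+ n].
Proof.
move=> /andP[x0 x1]; elim: n => [|n [IH1 IH2 IH3]] /=.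
  by split => //; rewrite expr0; lra.
move: (sgn_iter n x) IH1 IH2 IH3 => s IH1 IH2 IH3.
have s0 : 0 <= s by exact: le_trans IH1.
split.
- have -> : 2^-1 * (s * (3 - s ^+ 2)) = s + 2^-1 * (s * (1 - s) * (1 + s)) by field.
  by apply: le_trans IH1 _; rewrite lerDl !mulr_ge0 //; lra.
- have -> : 2^-1 * (s * (3 - s ^+ 2)) = 1 - 2^-1 * ((1 - s) * (1 - s) * (2 + s)) by field.
  by rewrite gerBl !mulr_ge0 //; lra.
- rewrite [leRHS]exprS; apply: (@le_trans _ _ ((1 - x / 2) * (1 - s))).
    have -> : 1 - 2^-1 * (s * (3 - s ^+ 2)) = (1 - x / 2) * (1 - s) - 2^-1 * ((1 - s) * ((s - x) + s * s)).
      by field.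
    have h1 : 0 <= 1 - s by lra.
    have h2 : 0 <= s * s by exact: mulr_ge0.
    by rewrite gerBl !mulr_ge0 //; lra.
  by rewrite ler_wpM2l //; lra.
Qed.

Lemma sgn_iter_norm n x : `|x| <= 1 -> `|sgn_iter n x| <= 1.
Proof.
move=> H; have [x0|x0] := leP 0 x.
  rewrite ger0_norm // in H; have /(sgn_iter_bnd n)[h1 h2 _] : 0 <= x <= 1 by rewrite x0.
  by rewrite ger0_norm // (le_trans x0).
rewrite ltr0_norm // in H; have nx : 0 <= - x by rewrite oppr_ge0 ltW.
have /(sgn_iter_bnd n)[h1 h2 _] : 0 <= - x <= 1 by rewrite nx.
by rewrite -normrN -sgn_iterN ger0_norm // (le_trans nx).
Qed.

Lemma sgn_iter_cvg x : `|x| <= 1 -> sgn_iter n x @[n --> \oo] --> Num.sg x.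
Proof.
have pos y : 0 < y <= 1 -> sgn_iter n y @[n --> \oo] --> (1 : R).
  move=> /andP[y0 y1].
  have c : (1 - y / 2) ^+ n @[n --> \oo] --> (0 : R).
    by apply: cvg_expr; rewrite ger0_norm; lra.
  have H n : (1 - (1 - y / 2) ^+ n <= sgn_iter n y <= 1).
    by have [|_ h2 h3] := @sgn_iter_bnd n y; [rewrite (ltW y0)|rewrite h2 andbT; lra].
  apply: (squeeze_cvgr (f := fun n => 1 - (1 - y / 2) ^+ n) (h := fun=> 1)).
  - by apply: nearW => n; exact: H.
  - rewrite -[X in _ --> X]subr0; apply: cvgB => //; exact: cvg_cst.
  - exact: cvg_cst.
move=> H; have [x0|x0|<-] := ltrgtP 0 x.
- by rewrite gtr0_sg //; apply: pos; rewrite x0 -[x]ger0_norm // ltW.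
- rewrite ltr0_sg //.
  have nx : 0 < - x <= 1 by rewrite oppr_gt0 x0 -ltr0_norm.
  have -> : (fun n => sgn_iter n x) = (fun n => - sgn_iter n (- x)).
    by apply/funext => n; rewrite sgn_iterN opprK.
  by apply: cvgN; exact: pos.
- rewrite sgr0; under eq_fun do rewrite sgn_iter0; exact: cvg_cst.
Qed.

Lemma meas_sgn_iter n (h : R -> R) : measurable_fun D h ->
  measurable_fun D (fun t => sgn_iter n (h t)).
Proof.
move=> mh; elim: n => //= n IH; apply: measurable_funM; first exact: measurable_cst.
by apply: measurable_funM => //; apply: measurable_funB => //; exact: measurable_funX.
Qed.

(** * Indicators of intervals from signs of trigonometric polynomials *)

Section Annihilator.
Variable f : R -> C.
Hypothesis L1f : Lp 1 f.
Hypothesis f0 : forall j, fourier f j = 0.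

(* Bounded multipliers that keep all Fourier coefficients of [f] zero: they are stable under
   products with signs of trigonometric polynomials, which yield indicators of intervals. *)
Definition annih (h : R -> R) := [/\ measurable_fun D h,
  exists M, forall t, D t -> `|h t| <= M &
  forall j, cint (fun t => (h t)%:C%C * (f t * ek j t)) = 0].

Lemma annih_L1 h j : annih h -> Lp 1 (fun t => (h t)%:C%C * (f t * ek j t)).
Proof.
move=> [mh [M hM] _]; apply: (@L1_bmul _ _ (fun t => (h t)%:C%C) M).
- exact: cmeas_real.
- exact: L1_ek.
- by apply: aeT => t Dt; rewrite cabsr hM.
Qed.

Lemma annih1 : annih (cst 1).
Proof.
split; [exact: measurable_cst|by exists 1 => t _; rewrite normr1|move=> j].
have := f0 (- j); rewrite fourierE opprK => <-.
by congr cint; apply/funext => t; rewrite mul1r.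
Qed.

Lemma annihD h h' : annih h -> annih h' -> annih (fun t => h t + h' t).
Proof.
move=> Kh Kh'; have [mh [M hM] zh] := Kh; have [mh' [M' hM'] zh'] := Kh'.
split; first exact: measurable_funD.
  by exists (M + M') => t Dt; apply: le_trans (ler_normD _ _) _; rewrite lerD ?hM ?hM'.
move=> j; rewrite -[RHS]addr0 -[X in _ = X + _](zh j) -[X in _ = _ + X](zh' j).
rewrite -cintD; [|exact: annih_L1..]; congr cint; apply/funext => t.
by rewrite rmorphD mulrDl.
Qed.

Lemma annihZ (a : R) h : annih h -> annih (fun t => a * h t).
Proof.
move=> Kh; have [mh [M hM] zh] := Kh; split; first by apply: measurable_funM => //; exact: measurable_cst.
  by exists (`|a| * M) => t Dt; rewrite normrM ler_wpM2l // hM.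
move=> j; rewrite -[RHS](mulr0 a%:C%C) -(zh j) -cintZ; last exact: annih_L1.
by congr cint; apply/funext => t; rewrite rmorphM -mulrA.
Qed.

Lemma ek_Re j t : (complex.Re (ek j t))%:C%C = 2^-1 * (ek j t + ek (- j) t) :> C.
Proof. by rewrite -ekJ; apply: eqC; rewrite (ReM, ImM) /=; field. Qed.

Lemma ek_Im j t : (complex.Im (ek j t))%:C%C = (Complex 0 (- 2^-1)) * (ek j t - ek (- j) t) :> C.
Proof. by rewrite -ekJ; apply: eqC; rewrite (ReM, ImM) /=; field. Qed.

(** Degree one is enough: initial intervals are cut out by the signs of a sine and of a cosine minus
    a constant. *)
Definition trig (a b c t : R) : R := a * complex.Re (ek 1 t) + b * complex.Im (ek 1 t) + c.

Lemma annih_trig a b c h : annih h -> annih (fun t => h t * trig a b c t).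
Proof.
move=> Kh; have [mh [M hM] zh] := Kh; have [m1 m2] := cmeas_ek R 1.
have KR : annih (fun t => complex.Re (ek 1 t) * h t).
  split; first exact: measurable_funM.
    exists M => t Dt; rewrite normrM; apply: le_trans (hM t Dt).
    by rewrite ler_piMl // (le_trans (le_Re_cabs _)) // cabs_ek.
  move=> j; have -> : (fun t => (complex.Re (ek 1 t) * h t)%:C%C * (f t * ek j t)) =
      (fun t => 2^-1 * ((h t)%:C%C * (f t * ek (1 + j) t) + (h t)%:C%C * (f t * ek (- 1 + j) t))).
    by apply/funext => t; rewrite rmorphM /= ek_Re !ekD; ring.
  rewrite cintZ ?cintD ?zh ?addr0 ?mulr0 //; try exact: annih_L1.
  by apply: L1D; exact: annih_L1.
have KI : annih (fun t => complex.Im (ek 1 t) * h t).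
  split; first exact: measurable_funM.
    exists M => t Dt; rewrite normrM; apply: le_trans (hM t Dt).
    by rewrite ler_piMl // (le_trans (le_Im_cabs _)) // cabs_ek.
  move=> j; have -> : (fun t => (complex.Im (ek 1 t) * h t)%:C%C * (f t * ek j t)) =
      (fun t => (Complex 0 (- 2^-1)) * ((h t)%:C%C * (f t * ek (1 + j) t) - (h t)%:C%C * (f t * ek (- 1 + j) t))).
    by apply/funext => t; rewrite rmorphM /= ek_Im !ekD; ring.
  rewrite cintZ ?cintB ?zh ?subr0 ?mulr0 //; try exact: annih_L1.
  by apply: L1B; exact: annih_L1.
have := annihD (annihD (annihZ a KR) (annihZ b KI)) (annihZ c Kh).
by congr annih; apply/funext => t; rewrite /trig; ring.
Qed.

Lemma annih_sgn_iter a b c n h : annih h -> annih (fun t => h t * sgn_iter n (trig a b c t)).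
Proof.
elim: n h => [|n IH] h Kh; first exact: annih_trig.
(* [K1] multiplies by the iterate and [K3] by its cube; the next iterate is a linear combination of
   the two. *)
have K1 := IH _ Kh; have K3 := IH _ (IH _ K1).
have := annihD (annihZ (3 / 2) K1) (annihZ (- 2^-1) K3).
by congr annih; apply/funext => t /=; field.
Qed.

Lemma meas_trig a b c : measurable_fun D (trig a b c).
Proof.
have [m1 m2] := cmeas_ek R 1.
apply: measurable_funD; last exact: measurable_cst.
by apply: measurable_funD; apply: measurable_funM.
Qed.

(** Dominated convergence along [sgn_iter]: the bound on [trig] keeps all iterates in [-1, 1], so a
    multiple of the modulus of [f] dominates. *)
Lemma annih_sg a b c h : (forall t, `|trig a b c t| <= 1) -> annih h ->
  annih (fun t => h t * Num.sg (trig a b c t)).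
Proof.
move=> H Kh; have [mh [M hM] zh] := Kh.
have ms : measurable_fun D (fun t => Num.sg (trig a b c t)).
  apply: (@measurable_fun_cvg _ _ _ _ (fun n t => sgn_iter n (trig a b c t))) => n.
    exact: meas_sgn_iter (meas_trig _ _ _).
  by move=> _; exact: sgn_iter_cvg.
have mhs : measurable_fun D (fun t => h t * Num.sg (trig a b c t)) by exact: measurable_funM.
split => //.
  exists M => t Dt; rewrite normrM; apply: le_trans (hM t Dt).
  by rewrite ler_piMr // normr_sg; case: (_ != _).
move=> j; pose G t := `|M| * cabs (f t * ek j t).
have L1fe : Lp 1 (fun t => f t * ek j t) by exact: L1_ek.
have iG : rint G by apply: rintZ; exact: L1_cabs.
pose u n t := (h t * sgn_iter n (trig a b c t))%:C%C * (f t * ek j t).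
have Ku n := annih_sgn_iter a b c n Kh.
have Lu n : Lp 1 (u n) by exact: annih_L1.
have uG n t : D t -> cabs (u n t) <= G t.
  move=> Dt; rewrite cabsM ler_wpM2r ?cabs_ge0 // cabsr normrM.
  apply: le_trans (ler_piMr _ (sgn_iter_norm n (H t))) _ => //.
  by apply: le_trans (hM t Dt) _; exact: ler_norm.
have [mR mI] : cmeas (fun t => (h t * Num.sg (trig a b c t))%:C%C * (f t * ek j t)).
  by apply: cmeasM; [exact: cmeas_real|case: L1fe].
have cvu (z : C) t : (complex.Re ((h t * sgn_iter n (trig a b c t))%:C%C * z) @[n --> \oo] -->
     complex.Re ((h t * Num.sg (trig a b c t))%:C%C * z)) /\
   (complex.Im ((h t * sgn_iter n (trig a b c t))%:C%C * z) @[n --> \oo] -->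
     complex.Im ((h t * Num.sg (trig a b c t))%:C%C * z)).
  have cs : h t * sgn_iter n (trig a b c t) @[n --> \oo] --> h t * Num.sg (trig a b c t).
    by apply: cvgM; [exact: cvg_cst|exact: sgn_iter_cvg].
  split.
    under eq_fun do rewrite ReM /= mul0r subr0; rewrite ReM /= mul0r subr0.
    by apply: cvgM => //; exact: cvg_cst.
  under eq_fun do rewrite ImM /= mul0r addr0; rewrite ImM /= mul0r addr0.
  by apply: cvgM => //; exact: cvg_cst.
apply: eqC => /=.
  apply: (@rint_lim0 (fun n t => complex.Re (u n t)) _ G) => //.
  - by move=> n; have [[]] := Lu n.
  - by move=> n t Dt; apply: le_trans (le_Re_cabs _) (uG n t Dt).
  - by move=> t Dt; have [] := cvu (f t * ek j t) t.
  - by move=> n; have [_ _ /(_ j)] := Ku n; move=> /(congr1 (@complex.Re R)).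
apply: (@rint_lim0 (fun n t => complex.Im (u n t)) _ G) => //.
- by move=> n; have [[]] := Lu n.
- by move=> n t Dt; apply: le_trans (le_Im_cabs _) (uG n t Dt).
- by move=> t Dt; have [] := cvu (f t * ek j t) t.
- by move=> n; have [_ _ /(_ j)] := Ku n; move=> /(congr1 (@complex.Im R)).
Qed.

(** The factor is the indicator of positivity of [trig] for [s = 1], and of negativity for
    [s = -1]. *)
Lemma annih_sg_pos a b c h (s : R) : (forall t, `|trig a b c t| <= 1) -> annih h ->
  annih (fun t => h t * (2^-1 * (Num.sg (trig a b c t) ^+ 2 + s * Num.sg (trig a b c t)))).
Proof.
move=> H Kh; have K1 := annih_sg H Kh; have K2 := annih_sg H K1.
have := annihZ 2^-1 (annihD K2 (annihZ s K1)).
by congr annih; apply/funext => t; ring.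
Qed.

(** The sign of [S] separates the two halves of the circle, on each of which the cosine is monotone,
    so that the sign of [Co x] compares [t] with [x] there. The factor 1/2 in [Co] keeps it in
    [-1, 1]. *)
Let S := trig 0 1 0.
Let Co x := trig 2^-1 0 (- 2^-1 * cos (2 * pi * x)).

Let S_E t : S t = sin (2 * pi * t).
Proof. by rewrite /S /trig mul0r add0r mul1r addr0 /ek /= mulr1. Qed.

Let Co_E x t : Co x t = 2^-1 * (cos (2 * pi * t) - cos (2 * pi * x)).
Proof. by rewrite /Co /trig mul0r addr0 /ek /= mulr1; ring. Qed.

Let S_le1 t : `|S t| <= 1.
Proof. by rewrite S_E ler_norml sin_geN1 sin_le1. Qed.

Let Co_le1 x t : `|Co x t| <= 1.
Proof.
rewrite Co_E ler_norml; have := cos_geN1 (2 * pi * t); have := cos_geN1 (2 * pi * x).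
have := cos_le1 (2 * pi * t); have := cos_le1 (2 * pi * x); lra.
Qed.

Let pi0 : 0 < pi :> R. Proof. exact: pi_gt0. Qed.

Let pi2_lt (t : R) : t < 2^-1 -> 2 * pi * t < pi :> R.
Proof.
move=> t1; have -> : 2 * pi * t = pi * (2 * t) by ring.
by rewrite gtr_pMr //; lra.
Qed.

Let pi2_le (t : R) : t <= 2^-1 -> 2 * pi * t <= pi :> R.
Proof.
move=> t1; have -> : 2 * pi * t = pi * (2 * t) by ring.
by rewrite ger_pMr //; lra.
Qed.

Let sgS_pos (t : R) : 0 < t < 2^-1 -> Num.sg (S t) = 1.
Proof.
move=> /andP[t0 t1]; rewrite S_E gtr0_sg // sin_gt0_pi //.
by rewrite !mulr_gt0 // pi2_lt.
Qed.

Let cos_refl (t : R) : cos (2 * pi * t) = cos (2 * pi * (1 - t)).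
Proof.
have -> : 2 * pi * (1 - t) = - (2 * pi * t) + pi *+ 2 by ring.
by rewrite cosD2pi cosN.
Qed.

Let sgS_neg (t : R) : 2^-1 < t < 1 -> Num.sg (S t) = -1.
Proof.
move=> /andP[t0 t1]; rewrite S_E ltr0_sg //.
have -> : 2 * pi * t = - (2 * pi * (1 - t)) + pi *+ 2 by ring.
by rewrite sinD2pi sinN oppr_lt0 sin_gt0_pi // !mulr_gt0 ?subr_gt0 //= pi2_lt //; lra.
Qed.

Let sgS_half : Num.sg (S 2^-1) = 0.
Proof.
by rewrite S_E (_ : 2 * pi * 2^-1 = pi) ?sinpi ?sgr0 //; field.
Qed.

Let cos_lt (t x : R) : 0 <= t -> t < x -> x <= 2^-1 -> cos (2 * pi * x) < cos (2 * pi * t).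
Proof.
move=> t0 tx x1; have ht : t <= 2^-1 by lra.
have hx : 0 <= x by lra.
have p0 := ltW pi0.
rewrite ltr_cos ?in_itv /= ?pi2_le ?mulr_ge0 //.
by rewrite ltr_pM2l // mulr_gt0.
Qed.

(** On the first half the cosine decreases, so the indicator is the product of those of [S > 0] and
    [Co x > 0]. *)
Let annih_le_lo (x : R) : 0 < x < 2^-1 ->
  exists2 h, annih h & forall t, 0 < t < 1 -> t <> x -> h t = (t <= x)%R%:R.
Proof.
move=> /andP[x0 x1].
exists (fun t => cst 1 t * (2^-1 * (Num.sg (S t) ^+ 2 + 1 * Num.sg (S t)))
     * (2^-1 * (Num.sg (Co x t) ^+ 2 + 1 * Num.sg (Co x t)))).
  apply: (annih_sg_pos _ (Co_le1 x)); apply: (@annih_sg_pos 0 1 0 (cst 1) 1 S_le1); exact: annih1.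
move=> t /andP[t0 t1] tx; rewrite /= mul1r.
have [th|th|th] := ltrgtP t 2^-1.
- rewrite sgS_pos ?t0 //; have [tlx|tlx|//] := ltrgtP t x.
    by rewrite gtr0_sg ?Co_E ?mulr_gt0 ?subr_gt0 ?cos_lt ?ltW //=; field.
  by rewrite ltr0_sg ?Co_E ?pmulr_rlt0 ?subr_lt0 ?cos_lt ?ltW //=; field.
- by rewrite sgS_neg ?th // leNgt (lt_trans x1 th) /=; ring.
- by rewrite th sgS_half leNgt x1 /=; ring.
Qed.

(** On the second half the cosine increases, so [S < 0] together with [Co x > 0] describes the
    complement [t > x], whose indicator is subtracted from 1. *)
Let annih_le_hi (x : R) : 2^-1 <= x < 1 ->
  exists2 h, annih h & forall t, 0 < t < 1 -> t <> x -> h t = (t <= x)%R%:R.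
Proof.
move=> /andP[x0 x1].
exists (fun t => cst 1 t + (-1) * (cst 1 t * (2^-1 * (Num.sg (S t) ^+ 2 + (-1) * Num.sg (S t)))
     * (2^-1 * (Num.sg (Co x t) ^+ 2 + 1 * Num.sg (Co x t))))).
  apply: annihD; [exact: annih1|apply: annihZ].
  apply: (annih_sg_pos _ (Co_le1 x)); apply: (@annih_sg_pos 0 1 0 (cst 1) (-1) S_le1); exact: annih1.
move=> t /andP[t0 t1] tx; rewrite /= mul1r.
have [th|th|th] := ltrgtP t 2^-1.
- by rewrite sgS_pos ?t0 // (ltW (lt_le_trans th x0)) /=; ring.
- rewrite sgS_neg ?th //; have [tlx|tlx|//] := ltrgtP t x.
    rewrite ltr0_sg ?Co_E ?pmulr_rlt0 ?subr_lt0 ?[cos (_ * t)]cos_refl ?[cos (_ * x)]cos_refl //.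
      by rewrite /=; field.
    by apply: cos_lt; lra.
  rewrite gtr0_sg ?Co_E ?mulr_gt0 ?subr_gt0 ?[cos (_ * t)]cos_refl ?[cos (_ * x)]cos_refl //.
    by rewrite /=; field.
  by apply: cos_lt; lra.
- by rewrite th sgS_half x0 /=; ring.
Qed.

Lemma annih_le (x : R) : exists2 h, annih h &
  {ae mu, forall t, D t -> h t = (t <= x)%R%:R}.
Proof.
have key h : (forall t, 0 < t < 1 -> t <> x -> h t = (t <= x)%R%:R) ->
    {ae mu, forall t, D t -> h t = (t <= x)%R%:R}.
  move=> H; apply: (aeS _ (aeI (aeI (ae_neq 0) (ae_neq 1)) (ae_neq x))) => t [[t0 t1] tx].
  rewrite /Tdom /= in_itv /= => /andP[h0 h1]; apply: H => //.
  by rewrite !lt_neqAle h0 h1 !andbT; apply/andP; split; apply/eqP => // /esym.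
have [x0|x0] := leP x 0.
  exists (fun t => 0 * cst 1 t); first by apply: annihZ; exact: annih1.
  by apply: key => t /andP[t0 _] _; rewrite mul0r leNgt (le_lt_trans x0 t0).
have [x1|x1] := leP 1 x.
  exists (cst 1); first exact: annih1.
  by apply: key => t /andP[_ t1] _; rewrite (le_trans (ltW t1) x1).
have [xh|xh] := ltP x 2^-1.
  by have [|h Kh H] := @annih_le_lo x; [rewrite x0|exists h => //; exact: key].
by have [|h Kh H] := @annih_le_hi x; [rewrite xh|exists h => //; exact: key].
Qed.

End Annihilator.

(** The primitive of the extension of [g] by zero vanishes identically; by Lebesgue differentiation
    its derivative is [g] almost everywhere. *)
Lemma rint_le_eq0 (g : R -> R) : rint g ->
  (forall x, \int[mu]_(t in D) ((t <= x)%R%:R * g t) = 0) ->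
  {ae mu, forall t, D t -> g t = 0}.
Proof.
move=> ig H.
pose gD : measurableTypeR R -> R := g \_ D.
have igD : mu.-integrable setT (EFin \o gD).
  have := ig; rewrite /rint (integrable_mkcond _ (@measurable_Tdom R)).
  by rewrite restrict_EFin.
have iy (y : R) : mu.-integrable `]-oo, y] (EFin \o gD).
  by apply: integrableS igD => //; exact: measurable_itv.
have lg : locally_integrable [set: R] gD.
  by apply: open_integrable_locally => //; exact: openT.
have := FTC1Ny iy lg.
have -> : (fun x : R => \int[mu]_(t in `]-oo, x]) gD t) = cst 0.
  apply/funext => x /=; rewrite -[RHS](H x) /gD -Rintegral_mkcondr setIC Rintegral_mkcondr.
  apply: eq_Rintegral => t _; rewrite patchE; case: ifPn => [|].
    by rewrite inE /= in_itv /= => ->; rewrite mul1r.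
  by rewrite notin_setE /= in_itv /= => /negP/negPf ->; rewrite mul0r.
apply: aeS => t [_]; rewrite derive1_cst => E Dt.
by rewrite E /gD patchE mem_set.
Qed.

(** Stated for integrable functions because it is applied to products of two square-integrable
    ones. *)
Lemma fourier_unique (f : R -> C) : Lp 1 f -> (forall j, fourier f j = 0) ->
  {ae mu, forall t, D t -> f t = 0}.
Proof.
move=> L1f f0; have [iR iI] := (L1P f).1 L1f.
have key (x : R) : \int[mu]_(t in D) ((t <= x)%R%:R * complex.Re (f t)) = 0 /\
    \int[mu]_(t in D) ((t <= x)%R%:R * complex.Im (f t)) = 0.
  have [h Kh hE] := annih_le L1f f0 x; have [mh _ /(_ 0) z] := Kh.
  have mle : measurable_fun D (fun t => (t <= x)%R%:R : R).
    have -> : (fun t => (t <= x)%R%:R) = \1_(`]-oo, x]%classic : set (measurableTypeR R)) :> (_ -> R).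
      by apply/funext => t; rewrite indicE mem_setE in_itv.
    by apply: measurable_indic; exact: measurable_itv.
  split.
    have := congr1 (@complex.Re R) z; rewrite Re_cint /= => <-.
    apply: ae_eq_rint.
    - by apply: measurable_funM => //; exact: rint_meas.
    - by have [[]] := @annih_L1 f L1f h 0 Kh.
    - apply: (aeS _ hE) => t E Dt; by rewrite ek0 mulr1 ReM /= mul0r subr0 E.
  have := congr1 (@complex.Im R) z; rewrite /= => <-.
  apply: ae_eq_rint.
  - by apply: measurable_funM => //; exact: rint_meas.
  - by have [[]] := @annih_L1 f L1f h 0 Kh.
  - apply: (aeS _ hE) => t E Dt; by rewrite ek0 mulr1 ImM /= mul0r addr0 E.
have HR := rint_le_eq0 iR (fun x => (key x).1).
have HI := rint_le_eq0 iI (fun x => (key x).2).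
by apply: (aeS _ (aeI HR HI)) => t [h1 h2] Dt; apply: eqC; [exact: h1|exact: h2].
Qed.

End Uniqueness.

(** * Square-integrable matrix functions *)

Section MatrixL2.
Variable R : realType.
Local Notation C := (R[i]).
Local Notation mu := (@lebesgue_measure R).
Local Notation D := (@Tdom R : set (measurableTypeR R)).
Local Hint Resolve measurable_Tdom : core.
Local Notation L1m := (entrywise (@Lp R 1)).
Local Notation L2m := (entrywise (@Lp R 2)).
Local Notation Mm := (entrywise (@cmeas R)).

Lemma conjcM (x y : C) : conjc (x * y) = conjc x * conjc y.
Proof. exact: rmorphM. Qed.

Lemma Re_conji (z : C) : complex.Re (conjc (Complex 0 1) * z) = complex.Im z.
Proof. by case: z => a b /=; ring. Qed.

Lemma Re_Ni (z : C) : complex.Re (Complex 0 (-1) * z) = complex.Im z.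
Proof. by case: z => a b /=; ring. Qed.

Lemma Lp_ext p (f g : R -> C) : (forall t, f t = g t) -> Lp p f -> Lp p g.
Proof. by move=> E; rewrite (_ : f = g) //; exact/funext. Qed.

Lemma L2m_meas m n (F : R -> 'M[C]_(m, n)) : L2m F -> Mm F.
Proof. by move=> H i j; case: (H i j). Qed.

Lemma L1m_meas m n (F : R -> 'M[C]_(m, n)) : L1m F -> Mm F.
Proof. by move=> H i j; case: (H i j). Qed.

Lemma L2mD m n (F G : R -> 'M[C]_(m, n)) : L2m F -> L2m G -> L2m (F + G).
Proof.
by move=> HF HG i j; apply: (@Lp_ext _ (fun t => F t i j + G t i j)) => [t|]; [rewrite mxE|exact: L2D].
Qed.

Lemma L2mZ m n (c : C) (F : R -> 'M[C]_(m, n)) : L2m F -> L2m (c *: F).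
Proof.
by move=> HF i j; apply: (@Lp_ext _ (fun t => c * F t i j)) => [t|]; [rewrite mxE|exact: L2Z].
Qed.

Lemma L2mN m n (F : R -> 'M[C]_(m, n)) : L2m F -> L2m (- F).
Proof. by move=> /(L2mZ (-1)); rewrite scaleN1r. Qed.

Lemma L2mB m n (F G : R -> 'M[C]_(m, n)) : L2m F -> L2m G -> L2m (F - G).
Proof. by move=> HF HG; apply: L2mD => //; exact: L2mN. Qed.

Lemma L2m0 m n : L2m (0 : R -> 'M[C]_(m, n)).
Proof. by move=> i j; apply: (Lp_ext _ (@L2_cst R 0)) => t; rewrite mxE. Qed.

Lemma L2m_star m n (F : R -> 'M[C]_(m, n)) : L2m F -> L2m (fun t => star (F t)).
Proof.
by move=> H i j; apply: (Lp_ext _ (L2J (H j i))) => t; rewrite starE.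
Qed.

Lemma Mm_star m n (F : R -> 'M[C]_(m, n)) : Mm F -> Mm (fun t => star (F t)).
Proof.
move=> H i j; have := cmeasJ (H j i); congr cmeas.
by apply/funext => t; rewrite starE.
Qed.

Lemma MmM m n p (F : R -> 'M[C]_(m, n)) (G : R -> 'M[C]_(n, p)) :
  Mm F -> Mm G -> Mm (fun t => F t *m G t).
Proof.
move=> HF HG i j.
have := @cmeas_sum R _ (index_enum 'I_n) (fun k t => F t i k * G t k j) (fun k => cmeasM (HF i k) (HG k j)).
by congr cmeas; apply/funext => t; rewrite mxE.
Qed.

Lemma MmD m n (F G : R -> 'M[C]_(m, n)) : Mm F -> Mm G -> Mm (fun t => F t + G t).
Proof.
move=> HF HG i j; have := cmeasD (HF i j) (HG i j).
by congr cmeas; apply/funext => t; rewrite mxE.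
Qed.

Lemma MmZ m n (w : R -> C) (F : R -> 'M[C]_(m, n)) : cmeas w -> Mm F -> Mm (fun t => w t *: F t).
Proof.
move=> Hw HF i j; have := cmeasM Hw (HF i j).
by congr cmeas; apply/funext => t; rewrite mxE.
Qed.

Lemma MmN m n (F : R -> 'M[C]_(m, n)) : Mm F -> Mm (fun t => - F t).
Proof.
move=> HF i j; have := cmeasN (HF i j).
by congr cmeas; apply/funext => t; rewrite mxE.
Qed.

Lemma Mm_cst m n (A : 'M[C]_(m, n)) : Mm (fun=> A).
Proof. by move=> i j; exact: cmeas_cst. Qed.

Lemma meas_nrm2 m n (F : R -> 'M[C]_(m, n)) : Mm F -> measurable_fun D (fun t => nrm2 (F t)).
Proof.
move=> H; apply: measurable_sum => i; apply: measurable_sum => j.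
exact: meas_cabs2.
Qed.

Lemma rint_nrm2 m n (F : R -> 'M[C]_(m, n)) : L2m F -> rint (fun t => nrm2 (F t)).
Proof. by move=> H; apply: rint_sum => i; apply: rint_sum => j; exact: L2_cabs2. Qed.

Lemma L2m_le_ae m n (F : R -> 'M[C]_(m, n)) (h : R -> R) : Mm F -> rint h ->
  {ae mu, forall t, D t -> nrm2 (F t) <= h t} -> L2m F.
Proof.
move=> mF ih H i j; apply: (L2_le_ae (mF i j) ih); apply: (aeS _ H) => t {}H Dt.
by apply: le_trans (H Dt); exact: cabs2_le_nrm2.
Qed.

Lemma L1mM m n p (F : R -> 'M[C]_(m, n)) (G : R -> 'M[C]_(n, p)) :
  L2m F -> L2m G -> L1m (fun t => F t *m G t).
Proof.
move=> HF HG i j.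
apply: (@Lp_ext _ (fun t => \sum_k F t i k * G t k j)) => [t|]; first by rewrite mxE.
by apply: L1_sum => k; exact: L2_mul.
Qed.

Lemma L1_tr n (F : R -> 'M[C]_n) : L1m F -> Lp 1 (fun t => \tr (F t)).
Proof. by move=> HF; apply: L1_sum => k. Qed.

Fact cip_key : unit. Proof. exact: tt. Qed.

(* locked, because failing conversions would otherwise unfold the integrals *)
Definition cip m n (F G : R -> 'M[C]_(m, n)) : C :=
  locked_with cip_key (cint (fun t => \tr (F t *m star (G t)))).

Lemma cipE m n (F G : R -> 'M[C]_(m, n)) : cip F G = cint (fun t => \tr (F t *m star (G t))).
Proof. by rewrite /cip unlock. Qed.

Definition rip m n (F G : R -> 'M[C]_(m, n)) : R := complex.Re (cip F G).

Lemma ripE m n (F G : R -> 'M[C]_(m, n)) : rip F G = \int[mu]_(t in D) dotr (F t) (G t).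
Proof. by rewrite /rip cipE. Qed.

Lemma cip0l m n (F : R -> 'M[C]_(m, n)) : cip 0 F = 0.
Proof.
rewrite cipE -[RHS](@cint_cst R); congr cint; apply/funext => t.
by rewrite mul0mx mxtrace0.
Qed.

Lemma cip_L1 m n (F G : R -> 'M[C]_(m, n)) : L2m F -> L2m G ->
  Lp 1 (fun t => \tr (F t *m star (G t))).
Proof. by move=> HF HG; apply: L1_tr; apply: L1mM => //; exact: L2m_star. Qed.

Lemma cipDl m n (F G H : R -> 'M[C]_(m, n)) : L2m F -> L2m G -> L2m H ->
  cip (F + G) H = cip F H + cip G H.
Proof.
move=> HF HG HH; rewrite !cipE -cintD; [|exact: cip_L1..].
by congr cint; apply/funext => t; rewrite mulmxDl linearD.
Qed.

Lemma cipZl m n (c : C) (F H : R -> 'M[C]_(m, n)) : L2m F -> L2m H ->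
  cip (c *: F) H = c * cip F H.
Proof.
move=> HF HH; rewrite !cipE -cintZ; last exact: cip_L1.
by congr cint; apply/funext => t; rewrite -scalemxAl linearZ.
Qed.

Lemma cipC m n (F G : R -> 'M[C]_(m, n)) : L2m F -> L2m G -> cip F G = conjc (cip G F).
Proof.
move=> HF HG; rewrite !cipE -cintJ; last exact: cip_L1.
by congr cint; apply/funext => t; rewrite -tr_star starM starK.
Qed.

Lemma cipBl m n (F G H : R -> 'M[C]_(m, n)) : L2m F -> L2m G -> L2m H ->
  cip (F - G) H = cip F H - cip G H.
Proof.
by move=> HF HG HH; rewrite -scaleN1r cipDl ?cipZl ?mulN1r //; exact: L2mZ.
Qed.

Lemma cipZr m n (c : C) (F H : R -> 'M[C]_(m, n)) : L2m F -> L2m H ->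
  cip H (c *: F) = conjc c * cip H F.
Proof.
move=> HF HH; rewrite (cipC HH (L2mZ c HF)) (cipZl c HF HH) conjcM.
by rewrite (cipC HH HF).
Qed.

Lemma rip_self m n (F : R -> 'M[C]_(m, n)) : rip F F = \int[mu]_(t in D) nrm2 (F t).
Proof. by rewrite ripE; apply: eq_Rintegral => t _; rewrite nrm2_dotr. Qed.

Lemma rip_cip m n (F G : R -> 'M[C]_(m, n)) : rip F G = complex.Re (cip F G).
Proof. by []. Qed.

Lemma ripBl m n (F G H : R -> 'M[C]_(m, n)) : L2m F -> L2m G -> L2m H ->
  rip (F - G) H = rip F H - rip G H.
Proof. by move=> HF HG HH; rewrite /rip (cipBl HF HG HH) ReD ReN. Qed.

Lemma rip_ge0 m n (F : R -> 'M[C]_(m, n)) : 0 <= rip F F.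
Proof. by rewrite rip_self; apply: rint_ge0 => t _; exact: nrm2_ge0. Qed.

Lemma rip_eq0_ae m n (F : R -> 'M[C]_(m, n)) : L2m F -> rip F F = 0 ->
  {ae mu, forall t, D t -> F t = 0}.
Proof.
move=> HF; rewrite rip_self => E.
have := rint_eq0_ae (rint_nrm2 HF) (fun t _ => nrm2_ge0 (F t)) E.
by apply: aeS => t H Dt; apply/eqP; rewrite -nrm2_eq0; apply/eqP; exact: H.
Qed.

Lemma ripC m n (F G : R -> 'M[C]_(m, n)) : rip F G = rip G F.
Proof. by rewrite !ripE; apply: eq_Rintegral => t _; rewrite dotrC. Qed.

Lemma ripDl m n (F G H : R -> 'M[C]_(m, n)) : L2m F -> L2m G -> L2m H ->
  rip (F + G) H = rip F H + rip G H.
Proof. by move=> *; rewrite !rip_cip cipDl // ReD. Qed.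

Lemma ripZl m n (a : R) (F H : R -> 'M[C]_(m, n)) : L2m F -> L2m H ->
  rip (a%:C%C *: F) H = a * rip F H.
Proof. by move=> *; rewrite !rip_cip cipZl // ReM /= mul0r subr0. Qed.

Lemma rip_CS m n (F G : R -> 'M[C]_(m, n)) : L2m F -> L2m G ->
  rip F G ^+ 2 <= rip F F * rip G G.
Proof.
apply: (@ip_CS R (R -> 'M[C]_(m, n)) L2m (@rip m n)).
- by move=> *; exact: L2mD.
- by move=> *; exact: L2mZ.
- by move=> *; exact: ripC.
- by move=> *; exact: ripDl.
- by move=> *; exact: ripZl.
- by move=> *; exact: rip_ge0.
Qed.

(** Real coordinates of a matrix, through which completeness reduces to the scalar case. *)
Let comp m n (k : 'I_m * 'I_n * bool) (A : 'M[C]_(m, n)) : R :=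
  if k.2 then complex.Re (A k.1.1 k.1.2) else complex.Im (A k.1.1 k.1.2).

Let nrm2_comp m n (A : 'M[C]_(m, n)) : nrm2 A = \sum_k comp k A ^+ 2.
Proof.
rewrite -(pair_bigA _ (fun ij b => comp (ij, b) A ^+ 2)) /=.
rewrite -(pair_bigA _ (fun i j => \sum_(b : bool) comp (i, j, b) A ^+ 2)) /=.
by apply: eq_bigr => i _; apply: eq_bigr => j _; rewrite big_bool.
Qed.

Let compB m n k (A B : 'M[C]_(m, n)) : comp k (A - B) = comp k A - comp k B.
Proof. by rewrite /comp !mxE; case: k.2; rewrite (ReD, ImD) (ReN, ImN). Qed.

Lemma L2m_complete m n (u : nat -> R -> 'M[C]_(m, n)) : (forall p, L2m (u p)) ->
  (forall e, 0 < e -> exists N, forall p q, (N <= p)%N -> (N <= q)%N ->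
     rip (u p - u q) (u p - u q) <= e) ->
  exists l, L2m l /\ (forall e, 0 < e -> exists N, forall p, (N <= p)%N ->
     rip (u p - l) (u p - l) <= e).
Proof.
move=> Hu cau.
have mcomp (F : R -> 'M[C]_(m, n)) k : Mm F -> measurable_fun D (fun t => comp k (F t)).
  by move=> mF; have [a b] := mF k.1.1 k.1.2; rewrite /comp; case: k.2.
have icomp (F : R -> 'M[C]_(m, n)) k : L2m F -> rint (fun t => comp k (F t) ^+ 2).
  move=> HF; apply: (rint_le _ (rint_nrm2 HF)).
    by apply: measurable_funX; apply: mcomp; exact: L2m_meas.
  move=> t _; rewrite ger0_norm ?sqr_ge0 // nrm2_comp (bigD1 k) //= lerDl.
  by apply: sumr_ge0 => *; exact: sqr_ge0.
have lecomp (F : R -> 'M[C]_(m, n)) k : L2m F ->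
    \int[mu]_(t in D) comp k (F t) ^+ 2 <= rip F F.
  move=> HF; rewrite rip_self; apply: le_rint; [exact: icomp|exact: rint_nrm2|] => t _.
  rewrite nrm2_comp (bigD1 k) //= lerDl.
  by apply: sumr_ge0 => *; exact: sqr_ge0.
have exg k : exists g : R -> R, [/\ measurable_fun D g, rint (fun t => g t ^+ 2),
    (forall p, rint (fun t => (comp k (u p t) - g t) ^+ 2)) &
    forall e, 0 < e -> exists N, forall p, (N <= p)%N ->
     \int[mu]_(t in D) (comp k (u p t) - g t) ^+ 2 <= e].
  apply: riesz_fischer => [p|p|e e0].
  - by apply: mcomp; exact: L2m_meas.
  - exact: icomp.
  - have [N NP] := cau _ e0; exists N => p q Np Nq.
    apply: le_trans (NP _ _ Np Nq).
    have := lecomp (u p - u q) k (L2mB (Hu p) (Hu q)); congr (_ <= _).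
    by apply: eq_Rintegral => t _; rewrite compB.
have [g gP] := choice exg.
pose l t : 'M[C]_(m, n) := \matrix_(i, j) Complex (g (i, j, true) t) (g (i, j, false) t).
have compl k t : comp k (l t) = g k t by rewrite /comp; case: k => [[i j] []]; rewrite !mxE.
have Ml : Mm l.
  move=> i j; split.
    by have [h _ _ _] := gP (i, j, true); under [fun t => _]funext => t do rewrite mxE.
  by have [h _ _ _] := gP (i, j, false); under [fun t => _]funext => t do rewrite mxE.
have L2l : L2m l.
  apply: (@L2m_le_ae _ _ _ (fun t => \sum_k g k t ^+ 2)) => //.
    by apply: rint_sum => k; case: (gP k).
  apply: aeT => t _; rewrite nrm2_comp.
  by under eq_bigr do rewrite compl.
exists l; split => // e e0.
pose K := #|{: 'I_m * 'I_n * bool}|%:R : R.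
have K0 : 0 <= K by exact: ler0n.
have e1 : 0 < e / (K + 1) by rewrite divr_gt0 // ltr_wpDl.
have exN k : exists N, forall p, (N <= p)%N ->
     \int[mu]_(t in D) (comp k (u p t) - g k t) ^+ 2 <= e / (K + 1).
  by case: (gP k) => _ _ _; exact.
have [N NP] := choice exN.
exists (\max_k N k)%N => p Np.
rewrite rip_self.
have -> : \int[mu]_(t in D) nrm2 ((u p - l) t) =
    \sum_k \int[mu]_(t in D) (comp k (u p t) - g k t) ^+ 2.
  rewrite -rintegral_sum; last by move=> k; case: (gP k).
  apply: eq_Rintegral => t _; rewrite nrm2_comp; apply: eq_bigr => k _.
  by rewrite compB compl.
apply: (@le_trans _ _ (\sum_(k : 'I_m * 'I_n * bool) e / (K + 1))).
  apply: ler_sum => k _; apply: NP; apply: leq_trans Np.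
  exact: leq_bigmax.
rewrite sumr_const -[_ *+ _]mulr_natr -/K mulrAC ler_pdivrMr ?ltr_wpDl //.
by rewrite ler_pM2l // lerDl.
Qed.

(** The complement is taken inside L^2. Applied twice, it represents the closed span of [A], so that
    no topology on functions has to be set up. *)
Definition perp m n (A : set (R -> 'M[C]_(m, n))) (F : R -> 'M[C]_(m, n)) :=
  L2m F /\ forall a, A a -> cip F a = 0.

Section Perp.
Variables (m n : nat) (A : set (R -> 'M[C]_(m, n))).
Hypothesis AL2 : forall a, A a -> L2m a.

Lemma perpD F G : perp A F -> perp A G -> perp A (F + G).
Proof.
move=> [HF ZF] [HG ZG]; split; first exact: L2mD.
by move=> a Aa; rewrite (cipDl HF HG (AL2 Aa)) (ZF a Aa) (ZG a Aa) addr0.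
Qed.

Lemma perpZ c F : perp A F -> perp A (c *: F).
Proof.
move=> [HF ZF]; split; first exact: L2mZ.
by move=> a Aa; rewrite (cipZl c HF (AL2 Aa)) (ZF a Aa) mulr0.
Qed.

Lemma perpB F G : perp A F -> perp A G -> perp A (F - G).
Proof.
move=> HF HG.
have E : F - G = F + (-1) *: G by rewrite scaleN1r.
rewrite E.
exact: (perpD HF (perpZ (-1) HG)).
Qed.

Lemma perp0 : perp A 0.
Proof.
split=> [|a Aa]; first exact: L2m0.
exact: cip0l.
Qed.

Lemma sub_biperp a : A a -> perp (perp A) a.
Proof.
move=> Aa; split=> [|x [Lx Zx]]; first exact: AL2.
by rewrite (cipC (AL2 Aa) Lx) (Zx a Aa) conjc0.
Qed.

Lemma perp_complete (u : nat -> R -> 'M[C]_(m, n)) : (forall p, perp A (u p)) ->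
  (forall e, 0 < e -> exists N, forall p q, (N <= p)%N -> (N <= q)%N ->
     rip (u p - u q) (u p - u q) <= e) ->
  exists l, perp A l /\ (forall e, 0 < e -> exists N, forall p, (N <= p)%N ->
     rip (u p - l) (u p - l) <= e).
Proof.
move=> Hu cau; have [|l [Ll lP]] := L2m_complete _ cau; first by move=> p; case: (Hu p).
exists l; split => //; split => // a Aa; have La := AL2 Aa.
(* Cauchy-Schwarz controls the real pairing only; the multiples of [l] by 1 and by -i recover the
   real and imaginary parts of [cip l a]. *)
have key c : rip (c *: l) a = 0.
  apply/eqP; rewrite -sqrf_eq0 eq_le sqr_ge0 andbT.
  apply/ler_addgt0Pl => e e0; rewrite addr0.
  have q0 := rip_ge0 a.
  have c0 := cabs2_ge0 c.
  have d0 : 0 < e / (cabs2 c * rip a a + 1) by rewrite divr_gt0 // ltr_wpDl // mulr_ge0.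
  have [N /(_ N (leqnn N)) H] := lP _ d0.
  have [LN ZN] := Hu N.
  have E : rip (c *: (u N - l)) a = - rip (c *: l) a.
    by rewrite !rip_cip (cipZl c (L2mB LN Ll) La) (cipZl c Ll La) (cipBl LN Ll La) (ZN _ Aa) sub0r mulrN ReN.
  rewrite -sqrrN -E; apply: le_trans (rip_CS (L2mZ _ (L2mB LN Ll)) La) _.
  have -> : rip (c *: (u N - l)) (c *: (u N - l)) = cabs2 c * rip (u N - l) (u N - l).
    rewrite !rip_self -rintegralZ; last by apply: rint_nrm2; exact: L2mB.
    by apply: eq_Rintegral => t _; rewrite -nrm2Z.
  rewrite mulrAC; apply: le_trans (ler_wpM2l (mulr_ge0 c0 q0) H) _.
  rewrite mulrCA; apply: ler_piMr; first exact: ltW.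
  have X1 : 0 < cabs2 c * rip a a + 1 by rewrite ltr_wpDl // mulr_ge0.
  by rewrite ler_pdivrMr // mul1r lerDl.
apply: eqC.
  by have := key 1; rewrite (scale1r l).
have := key (Complex 0 (-1)); rewrite rip_cip (cipZl _ Ll La) Re_Ni => H.
exact: H.
Qed.

Lemma perp_riesz (l : (R -> 'M[C]_(m, n)) -> R) (c : R) :
  (forall x y, perp A x -> perp A y -> l (x + y) = l x + l y) ->
  (forall (a : R) x, perp A x -> l (a%:C%C *: x) = a * l x) ->
  0 <= c -> (forall x, perp A x -> l x ^+ 2 <= c * rip x x) ->
  exists2 g, perp A g & forall x, perp A x -> l x = rip g x.
Proof.
move=> lD lZ c0 lc.
exact: (@riesz R (R -> 'M[C]_(m, n)) (perp A) (@rip m n)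
  (fun x y hx hy => perpD hx hy) (fun a x hx => perpZ a%:C%C hx)
  (fun x y _ _ => ripC x y) (fun x y z hx hy hz => ripDl hx.1 hy.1 hz.1)
  (fun a x z hx hz => ripZl a hx.1 hz.1) (fun x _ => rip_ge0 x) perp_complete
  l c lD lZ c0 lc perp0).
Qed.

(** The projection is the Riesz representative of the functional [rip F] on the closed subspace;
    testing on multiples by i upgrades real orthogonality to complex. *)
Lemma perp_proj F : L2m F -> exists2 P, perp A P & forall x, perp A x -> cip (F - P) x = 0.
Proof.
move=> LF; have [|||x [Lx _]|P AP PE] := @perp_riesz (fun x => rip F x) (rip F F).
- by move=> x y [Lx _] [Ly _]; rewrite ![rip F _]ripC (ripDl Lx Ly LF).
- by move=> a x [Lx _]; rewrite ![rip F _]ripC (ripZl a Lx LF).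
- exact: rip_ge0.
- exact: rip_CS.
exists P => // x Ax; have LP := AP.1; have Lx := Ax.1.
have key y : perp A y -> rip (F - P) y = 0.
  move=> Ay; rewrite (ripBl LF LP Ay.1).
  have E : rip F y = rip P y by exact: PE.
  by rewrite E subrr.
apply: eqC; first exact: key.
have := key _ (perpZ (Complex 0 1) Ax).
rewrite rip_cip (cipZr _ Lx (L2mB LF LP)) Re_conji => H.
exact: H.
Qed.

End Perp.

End MatrixL2.

(** * Products of Hardy functions *)

Section HardyProducts.
Variable R : realType.
Local Notation C := (R[i]).
Local Notation mu := (@lebesgue_measure R).
Local Notation D := (@Tdom R : set (measurableTypeR R)).
Local Hint Resolve measurable_Tdom : core.
Local Notation L2m := (entrywise (@Lp R 2)).

Lemma ek_at1 j : ek j (1 : R) = 1.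
Proof.
have e1 : ek 1 (1 : R) = 1.
  by rewrite /ek !mulr1 /expi mulr_natl cos2pi sin2pi.
have en (n : nat) : ek n (1 : R) = 1.
  elim: n => [|n IH]; first exact: ek0.
  by rewrite -addn1 PoszD ekD IH e1 mulr1.
case: j => n; first exact: en.
by rewrite NegzE -ekJ en conjc1.
Qed.

Lemma cint_ek j : j != 0 -> cint (@ek R j) = 0.
Proof.
move=> j0; pose a : R := 2 * pi * j%:~R.
have a0 : a != 0.
  by rewrite !mulf_neq0 ?intr_eq0 // gt_eqF ?pi_gt0.
have [s1 c1] : sin a = 0 /\ cos a = 1.
  have := ek_at1 j; rewrite /ek mulr1 -/a => -[? ?]; by split.
have dS (x : R) : is_derive x (1 : R) (fun t => a^-1 * sin (a * t)) (cos (a * x)).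
  apply: is_derive_eq.
  by rewrite /GRing.scale /= ; field.
have dC (x : R) : is_derive x (1 : R) (fun t => - a^-1 * cos (a * t)) (sin (a * x)).
  apply: is_derive_eq.
  by rewrite /GRing.scale /= ; field.
have ftc (F f : R -> R) : (forall x : R, is_derive x (1 : R) F (f x)) -> continuous f ->
    \int[mu]_(t in D) f t = F 1 - F 0.
  move=> dF cf; have cF : continuous F.
    by move=> x; apply/differentiable_continuous/derivable1_diffP; case: (dF x).
  rewrite /Rintegral /Tdom (@continuous_FTC2 R f F 0 1 ltr01) //.
  - by apply: continuous_subspaceT.
  - split; first by move=> x _; case: (dF x).
      by apply: cvg_at_right_filter; exact: cF.
    by apply: cvg_at_left_filter; exact: cF.
  - by move=> x _; rewrite derive1E; case: (dF x).
have cax : continuous (fun t : R => a * t).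
  by move=> x; apply: cvgM; [exact: cvg_cst|exact: cvg_id].
apply: eqC => /=.
  rewrite (ftc _ _ dS); last first.
    by move=> x; apply: continuous_comp; [exact: cax|exact: continuous_cos].
  by rewrite mulr1 mulr0 s1 sin0 subrr.
rewrite (ftc _ _ dC); last first.
  by move=> x; apply: continuous_comp; [exact: cax|exact: continuous_sin].
by rewrite mulr1 mulr0 c1 cos0 subrr.
Qed.

(** Scalar functions are treated as 1 x 1 matrix functions in order to use the projection
    theorem. *)
Let mx1 (f : R -> C) : R -> 'M[C]_1 := fun t => (f t)%:M.

Let mx1E f t i j : mx1 f t i j = f t.
Proof. by rewrite !ord1 mxE. Qed.

Let L2mx1 f : Lp 2 f -> L2m (mx1 f).
Proof. by move=> Lf i j; apply: (Lp_ext _ Lf) => t; rewrite mx1E. Qed.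

Let cip_mx1 (F : R -> 'M[C]_1) g : cip F (mx1 g) = cint (fun t => F t 0 0 * conjc (g t)).
Proof.
rewrite cipE; congr cint; apply/funext => t.
by rewrite tr_scal mxE big_ord1 starE mx1E.
Qed.

(* [H^2] is the closed span of the [ek j], [j >= 0]: the projection of [f] onto
   their orthogonal complement has no nonzero Fourier coefficient. *)
Lemma H2_perp (f x : R -> C) : Hp 2 f -> Lp 2 x ->
  (forall j : int, 0 <= j -> cint (fun t => x t * ek j t) = 0) ->
  cint (fun t => f t * x t) = 0.
Proof.
move=> [Lf f0] Lx x0.
pose A := [set a | exists2 j : int, 0 <= j & a = mx1 (ek j)].
have AL a : A a -> L2m a by move=> [j _ ->]; apply: L2mx1; exact: L2_ek1.
have [P AP PE] := perp_proj AL (L2mx1 Lf).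
have LP := AP.1.
have Pj j : cint (fun t => P t 0 0 * ek (- j) t) = 0.
  have -> : (fun t => P t 0 0 * ek (- j) t) = (fun t => P t 0 0 * conjc (ek j t)).
    by apply/funext => t; rewrite ekJ.
  (* For [j >= 0] the coefficient vanishes because [P] is in [perp A]. For [j < 0] the function
     [ek j] is itself in [perp A], so [P] and [f] have the same coefficient, which is 0. *)
  rewrite -cip_mx1; have [j0|j0] := leP 0 j.
    by apply: AP.2; exists j.
  have Lj : L2m (mx1 (ek j)) by apply: L2mx1; exact: L2_ek1.
  have Aj : perp A (mx1 (ek j)).
    split; first exact: Lj.
    move=> _ [i i0 ->]; rewrite cip_mx1.
    have -> : (fun t => mx1 (ek j) t 0 0 * conjc (ek i t)) = ek (j - i).
      by apply/funext => t; rewrite mx1E ekJ ekD.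
    apply: cint_ek; rewrite subr_eq0; apply: contraTneq j0 => ->.
    by rewrite -leNgt.
  have := PE _ Aj; rewrite (cipBl (L2mx1 Lf) LP Lj).
  have -> : cip (mx1 f) (mx1 (ek j)) = 0.
    rewrite cip_mx1 -(f0 j j0) fourierE; congr cint; apply/funext => t.
    by rewrite mx1E ekJ.
  by move=> /eqP; rewrite sub0r oppr_eq0 => /eqP.
have P0 : {ae mu, forall t, D t -> P t 0 0 = 0}.
  apply: (@fourier_unique R (fun t => P t 0 0)) => [|j]; first exact: L2_L1 (LP 0 0).
  by rewrite fourierE.
have Lxc : L2m (mx1 (fun t => conjc (x t))) by apply: L2mx1; exact: L2J.
have Ax : perp A (mx1 (fun t => conjc (x t))).
  split; first exact: Lxc.
  move=> _ [i i0 ->]; rewrite cip_mx1 -[RHS]conjc0 -(x0 i i0) -cintJ; last exact/L2_L1/L2_ek.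
  by congr cint; apply/funext => t; rewrite mx1E conjcM.
have := PE _ Ax; rewrite (cipBl (L2mx1 Lf) LP Lxc) !cip_mx1.
have -> : cint (fun t => P t 0 0 * conjc (conjc (x t))) = 0.
  rewrite -[RHS](@cint_cst R); apply: cint_ae.
  - apply: cmeasM; first by case: (LP 0 0).
    by apply: cmeasJ; apply: cmeasJ; case: Lx.
  - exact: cmeas_cst.
  - by apply: (aeS _ P0) => t H Dt; rewrite H // mul0r.
rewrite subr0 => H; rewrite -[RHS]H; congr cint; apply/funext => t.
by rewrite mx1E conjcK.
Qed.

Lemma Hp0_coef p (f : R -> C) (l : int) : Hp0 p f -> 0 <= l -> cint (fun t => f t * ek l t) = 0.
Proof.
move=> [[Lf f1] f2] l0; have E : cint (fun t => f t * ek l t) = fourier f (- l).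
  by rewrite fourierE opprK.
rewrite E; have [->|ln0] := eqVneq l 0; first by rewrite oppr0.
by apply: f1; rewrite oppr_lt0 lt_neqAle eq_sym ln0.
Qed.

Lemma Hp_coef p (f : R -> C) (l : int) : Hp p f -> 0 < l -> cint (fun t => f t * ek l t) = 0.
Proof.
move=> [Lf f1] l0; have E : cint (fun t => f t * ek l t) = fourier f (- l).
  by rewrite fourierE opprK.
by rewrite E; apply: f1; rewrite oppr_lt0.
Qed.

Lemma Hp0_intro p (f : R -> C) : Lp p f -> (forall l : int, 0 <= l -> cint (fun t => f t * ek l t) = 0) ->
  Hp0 p f.
Proof.
by move=> Lf H; split; [split => // j j0|]; rewrite fourierE; apply: H; rewrite oppr_ge0 // ltW.
Qed.

Lemma Hp_intro p (f : R -> C) : Lp p f -> (forall l : int, 0 < l -> cint (fun t => f t * ek l t) = 0) ->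
  Hp p f.
Proof. by move=> Lf H; split => // j j0; rewrite fourierE; apply: H; rewrite oppr_gt0. Qed.

Lemma H2_mul_H20 (f g : R -> C) : Hp 2 f -> Hp0 2 g -> Hp0 1 (fun t => f t * g t).
Proof.
move=> Hf Hg; have Lf := Hf.1; have Lg := Hg.1.1; apply: Hp0_intro; first exact: L2_mul.
move=> l l0; have -> : (fun t => f t * g t * ek l t) = (fun t => f t * (g t * ek l t)).
  by apply/funext => t; rewrite mulrA.
apply: H2_perp => [//||j j0]; first exact: L2_ek.
rewrite -(Hp0_coef Hg (addr_ge0 l0 j0)); congr cint; apply/funext => t.
by rewrite ekD mulrA.
Qed.

End HardyProducts.

(** * Measurable matrix functions *)

Section MeasurableMatrices.
Variable R : realType.
Local Notation C := (R[i]).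
Local Notation mu := (@lebesgue_measure R).
Local Notation D := (@Tdom R : set (measurableTypeR R)).
Local Hint Resolve measurable_Tdom : core.
Local Notation Mm := (entrywise (@cmeas R)).

(** The inverse is the pointwise limit of the continuous functions x / (x^2 + 1/(n+1)), including at
    0, where the limit 0 is the value of [0^-1]. *)
Lemma meas_inv (h : R -> R) : measurable_fun D h -> measurable_fun D (fun t => (h t)^-1).
Proof.
move=> mh; pose g (n : nat) (x : R) : R := x / (x ^+ 2 + n.+1%:R^-1).
have den0 (n : nat) (x : R) : x ^+ 2 + n.+1%:R^-1 != 0.
  by rewrite gt_eqF // ltr_wpDl ?sqr_ge0 // invr_gt0.
have cg n : continuous (g n).
  move=> x; apply: cvgM; first exact: cvg_id.
  apply: cvgV; first exact: den0.
  apply: cvgD; last exact: cvg_cst.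
  exact: exprn_continuous.
apply: (@measurable_fun_cvg _ _ _ _ (fun n t => g n (h t))) => [n|t _].
  apply: (measurableT_comp (f := g n)) => //.
  exact: continuous_measurable_fun (cg n).
move: (h t) => x; have [->|x0] := eqVneq x 0.
  by rewrite invr0 /g; under eq_fun do rewrite mul0r; exact: cvg_cst.
rewrite /g; have -> : x^-1 = x / (x ^+ 2 + 0) by rewrite addr0; field.
apply: cvgM; first exact: cvg_cst.
apply: cvgV; first by rewrite addr0 sqrf_eq0.
by apply: cvgD; [exact: cvg_cst|exact: cvg_harmonic].
Qed.

Definition ratmx m n (q : 'M[rat * rat]_(m, n)) : 'M[C]_(m, n) :=
  \matrix_(i, j) Complex (ratr (q i j).1) (ratr (q i j).2).

Definition ratmx_seq m n (k : nat) : 'M[C]_(m, n) :=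
  if unpickle k is Some q then ratmx q else 0.

Lemma ratmx_dense m n (A : 'M[C]_(m, n)) (e : R) : 0 < e ->
  exists k, Num.sqrt (nrm2 (A - ratmx_seq m n k)) <= e.
Proof.
move=> e0; pose K : R := m%:R * (n%:R * 2).
have K0 : 0 <= K by rewrite !mulr_ge0.
pose d := e / (K + 1).
have K1 : 0 < K + 1 by rewrite ltr_wpDl.
have d0 : 0 < d by rewrite divr_gt0.
have exq (ij : 'I_m * 'I_n) : exists q : rat * rat,
    cabs2 (A ij.1 ij.2 - Complex (ratr q.1) (ratr q.2)) <= 2 * d ^+ 2.
  have near1 (x : R) : exists q : rat, (x - ratr q) ^+ 2 <= d ^+ 2.
    have [|q] := @rat_in_itvoo _ (x - d) (x + d); first by lra.
    rewrite in_itv /= => /andP[h1 h2]; exists q.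
    have H : `|x - ratr q| <= d by rewrite ler_norml; lra.
    by rewrite -[leLHS]real_normK ?num_real // ler_sqr ?nnegrE // ltW.
  have [q1 h1] := near1 (complex.Re (A ij.1 ij.2)).
  have [q2 h2] := near1 (complex.Im (A ij.1 ij.2)).
  exists (q1, q2); rewrite /cabs2 (ReD, ImD) ReN ImD ImN /=.
  by apply: le_trans (lerD h1 h2) _; rewrite mulr_natl mulr2n.
have [q qP] := choice exq.
exists (pickle (\matrix_(i, j) q (i, j))); rewrite /ratmx_seq pickleK.
rewrite -[leRHS](ger0_norm (ltW e0)) -sqrtr_sqr ler_sqrt ?sqr_ge0 //.
apply: (@le_trans _ _ (\sum_(i < m) \sum_(j < n) 2 * d ^+ 2)).
  apply: ler_sum => i _; apply: ler_sum => j _.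
  by have := qP (i, j); rewrite !mxE.
rewrite !sumr_const !card_ord -[_ *+ m]mulr_natl -[_ *+ n]mulr_natl.
have -> : m%:R * (n%:R * (2 * d ^+ 2)) = K * d ^+ 2 by rewrite /K; ring.
have dE : d * (K + 1) = e by rewrite /d divfK // gt_eqF.
rewrite -dE; move: d {d0 exq q qP dE} => d.
rewrite exprMn mulrC ler_wpM2l ?sqr_ge0 // expr2.
have := mulr_ge0 K0 K0; lra.
Qed.

(* [g] is the infimum of countably many functions [g q + c * |_ - q|], [q] rational. *)
Lemma meas_lipschitz m n (g : 'M[C]_(m, n) -> R) (c : R) (F : R -> 'M[C]_(m, n)) :
  0 <= c -> (forall A B, g A <= g B + c * Num.sqrt (nrm2 (A - B))) -> Mm F ->
  measurable_fun D (fun t => g (F t)).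
Proof.
move=> c0 lip mF.
pose h (k : nat) (t : R) := g (ratmx_seq m n k) + c * Num.sqrt (nrm2 (F t - ratmx_seq m n k)).
have lbh t : lbound (range (h ^~ t)) (g (F t)) by move=> _ [k _ <-]; exact: lip.
have -> : (fun t => g (F t)) = (fun t => infs (h ^~ t) 0).
  apply/funext => t.
  have hi : has_inf (sdrop (h ^~ t) 0).
    split; first by exists (h 0%N t); exists 0%N.
    by exists (g (F t)) => _ [k _ <-]; exact: lip.
  apply/eqP; rewrite eq_le; apply/andP; split.
    by apply: lb_le_inf => [|_ [k _ <-]]; [case: hi|exact: lip].
  apply/ler_addgt0Pr => e e0.
  have e1 : 0 < e / (2 * c + 1) by rewrite divr_gt0 // ltr_wpDl // mulr_ge0.
  have [k kP] := ratmx_dense (F t) e1.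
  apply: (@le_trans _ _ (h k t)).
    by apply: ge_inf; [case: hi|exists k].
  have := lip (ratmx_seq m n k) (F t).
  have -> : nrm2 (ratmx_seq m n k - F t) = nrm2 (F t - ratmx_seq m n k).
    by rewrite -opprB -scaleN1r nrm2Z /cabs2 /= oppr0 expr0n addr0 sqrrN expr1n mul1r.
  rewrite /h; set x := Num.sqrt _ in kP *; move=> H.
  have : (2 * c + 1) * x <= e.
    by rewrite mulrC -ler_pdivlMr // ltr_wpDl // mulr_ge0.
  have : 0 <= x by exact: sqrtr_ge0.
  move: H; nra.
apply: measurable_fun_infs => [t _|k]; first by exists (g (F t)); exact: lbh.
apply: measurable_funD; first exact: measurable_cst.
apply: measurable_funM; first exact: measurable_cst.
apply: meas_sqrt; apply: meas_nrm2.
by apply: MmD => //; exact: Mm_cst.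
Qed.

Lemma meas_opnorm m n (F : R -> 'M[C]_(m, n)) : Mm F -> measurable_fun D (fun t => opnorm (F t)).
Proof.
apply: (@meas_lipschitz _ _ (@opnorm R m n) 1) => // A B.
rewrite -[A in leLHS](subrK B) mul1r [leRHS]addrC.
by apply: le_trans (opnormD _ _) _; rewrite lerD2r opnorm_le_hs.
Qed.

Lemma meas_trnorm m n (F : R -> 'M[C]_(m, n)) : Mm F -> measurable_fun D (fun t => trnorm (F t)).
Proof.
apply: (@meas_lipschitz _ _ (@trnorm R m n) m%:R) => // A B.
rewrite -[A in leLHS](subrK B) [leRHS]addrC.
by apply: le_trans (trnormD _ _) _; rewrite lerD2r trnorm_le_hs.
Qed.

(* One step of Gram-Schmidt: P is enlarged by the direction of c - P c, which
   contributes nothing when it vanishes since then its inverse norm is 0. *)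
Definition gs_step n (c : 'cV[C]_n) (P : 'M[C]_n) : 'M[C]_n :=
  P + (nrm2 (c - P *m c))^-1%:C%C *: ((c - P *m c) *m star (c - P *m c)).

Lemma gs_stepP n (c : 'cV[C]_n) (P : 'M[C]_n) : star P = P -> P *m P = P ->
  [/\ star (gs_step c P) = gs_step c P, gs_step c P *m gs_step c P = gs_step c P,
      gs_step c P *m c = c, forall x : 'cV[C]_n, P *m x = x -> gs_step c P *m x = x &
      forall p (y : 'M[C]_(p, n)), y *m P = 0 -> y *m c = 0 -> y *m gs_step c P = 0].
Proof.
move=> sP PP; rewrite /gs_step; set d := c - P *m c; set a := _%:C%C.
have Pd : P *m d = 0 by rewrite /d mulmxBr mulmxA PP subrr.
have dP : star d *m P = 0 by rewrite -sP -starM Pd star0.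
have dd : star d *m d = (nrm2 d)%:C%C%:M.
  rewrite -[nrm2 d]nrm2_star nrm2E starK tr_scal; apply/matrixP => i j.
  by rewrite !ord1 [RHS]mxE eqxx mulr1n.
have dc : star d *m c = (nrm2 d)%:C%C%:M.
  have -> : c = d + P *m c by rewrite /d subrK.
  by rewrite mulmxDr mulmxA dP mul0mx addr0.
have aa : a * (nrm2 d)%:C%C * a = a.
  rewrite /a -!rmorphM /=; congr (_%:C%C).
  have [->|d0] := eqVneq (nrm2 d) 0; first by rewrite invr0 !mul0r.
  by rewrite mulVf // mul1r.
have ad : (a * (nrm2 d)%:C%C) *: d = d.
  have [d0|d0] := eqVneq d 0; first by rewrite d0 scaler0.
  by rewrite /a -rmorphM /= mulVf ?nrm2_eq0 // scale1r.
split.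
- by rewrite starD starZ starM starK sP /a; congr (_ + _ *: _); apply: eqC => //=; rewrite oppr0.
- rewrite mulmxDl !mulmxDr PP -!scalemxAl -!scalemxAr mulmxA Pd mul0mx scaler0 addr0.
  rewrite -[d *m star d *m P]mulmxA dP mulmx0 scaler0 add0r; congr (_ + _).
  rewrite -[d *m star d *m _]mulmxA (mulmxA (star d)) dd mul_scalar_mx -scalemxAr !scalerA.
  by congr (_ *: _); rewrite -[RHS]aa; ring.
- rewrite mulmxDl -scalemxAl -mulmxA dc mul_mx_scalar scalerA ad /d.
  by rewrite addrC subrK.
- move=> x Px; rewrite mulmxDl -scalemxAl -mulmxA.
  have -> : star d *m x = 0 by rewrite -Px mulmxA dP mul0mx.
  by rewrite mulmx0 scaler0 addr0.
- move=> p y yP yc; rewrite mulmxDr yP add0r -scalemxAr mulmxA.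
  have -> : y *m d = 0 by rewrite /d mulmxBr yc mulmxA yP mul0mx subr0.
  by rewrite mul0mx scaler0.
Qed.

Definition colproj_seq m n (W : 'M[C]_(n, m)) (s : seq 'I_m) : 'M[C]_n :=
  foldr (fun j P => gs_step (col j W) P) 0 s.

(** The orthogonal projection onto the column space; its construction by Gram-Schmidt makes it
    depend measurably on the matrix. *)
Definition colproj m n (W : 'M[C]_(n, m)) : 'M[C]_n := colproj_seq W (enum 'I_m).

Lemma colproj_seqP m n (W : 'M[C]_(n, m)) s :
  [/\ star (colproj_seq W s) = colproj_seq W s,
      colproj_seq W s *m colproj_seq W s = colproj_seq W s,
      forall j, j \in s -> colproj_seq W s *m col j W = col j W &
      forall p (y : 'M[C]_(p, n)), y *m W = 0 -> y *m colproj_seq W s = 0].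
Proof.
elim: s => [|j s [I1 I2 I3 I4]] /=.
  by split=> [||//|p y _]; rewrite ?star0 ?mulmx0.
have [S1 S2 S3 S4 S5] := gs_stepP (col j W) I1 I2.
split => // [i|p y yW].
  by rewrite in_cons => /orP[/eqP ->|/I3 H]; [exact: S3|exact: S4].
by apply: S5; [exact: I4|rewrite colE mulmxA yW mul0mx].
Qed.

Lemma colproj_star m n (W : 'M[C]_(n, m)) : star (colproj W) = colproj W.
Proof. by have [] := colproj_seqP W (enum 'I_m). Qed.

Lemma colprojK m n (W : 'M[C]_(n, m)) : colproj W *m colproj W = colproj W.
Proof. by have [] := colproj_seqP W (enum 'I_m). Qed.

Lemma colproj_id m n (W : 'M[C]_(n, m)) : colproj W *m W = W.
Proof.
have [_ _ H _] := colproj_seqP W (enum 'I_m).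
apply/matrixP => i j; transitivity ((colproj W *m col j W) i 0).
  by rewrite !mxE; apply: eq_bigr => k _; rewrite !mxE.
by rewrite /colproj H ?mem_enum // mxE.
Qed.

Lemma colproj_kill m n p (W : 'M[C]_(n, m)) (y : 'M[C]_(p, n)) : y *m W = 0 -> y *m colproj W = 0.
Proof. by have [_ _ _ H] := colproj_seqP W (enum 'I_m); exact: H. Qed.

(** Rows that kill [W] kill the projection, and they form a space of dimension [n - \rank W]. *)
Lemma colproj_rank m n (W : 'M[C]_(n, m)) : (\rank (colproj W) <= \rank W)%N.
Proof.
have /mulmx0_rank_max : kermx W *m colproj W = 0.
  by apply: colproj_kill; exact: mulmx_ker.
rewrite mxrank_ker; have := rank_leq_row W.
by move=> rn H; rewrite -(leq_add2l (n - \rank W)) (subnK rn).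
Qed.

Lemma Mm_gs_step n (c : R -> 'cV[C]_n) (P : R -> 'M[C]_n) : Mm c -> Mm P ->
  Mm (fun t => gs_step (c t) (P t)).
Proof.
move=> mc mP.
have md : Mm (fun t => c t - P t *m c t) by apply: MmD => //; apply: MmN; exact: MmM.
apply: MmD => //; apply: MmZ.
  by apply: cmeas_real; apply: meas_inv; exact: meas_nrm2.
by apply: MmM => //; exact: Mm_star.
Qed.

Lemma Mm_colproj m n (W : R -> 'M[C]_(n, m)) : Mm W -> Mm (fun t => colproj (W t)).
Proof.
move=> mW; rewrite /colproj; elim: (enum 'I_m) => [|j s IH] /=; first exact: Mm_cst.
apply: Mm_gs_step => // i k; have := mW i j; congr cmeas.
by apply/funext => t; rewrite mxE.
Qed.

End MeasurableMatrices.

(** * Factorization of functions of bounded rank *)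

Section Shift.
Variable R : realType.
Local Notation C := (R[i]).
Local Notation mu := (@lebesgue_measure R).
Local Notation D := (@Tdom R : set (measurableTypeR R)).
Local Notation L2m := (entrywise (@Lp R 2)).
Local Notation Mm := (entrywise (@cmeas R)).
Variables (m n : nat).
Implicit Types F G : R -> 'M[C]_(m, n).

Definition shift (i : int) F : R -> 'M[C]_(m, n) := fun t => ek i t *: F t.

Lemma L2m_shift i F : L2m F -> L2m (shift i F).
Proof.
move=> LF a b; apply: (Lp_ext _ (L2_ek i (LF a b))) => t.
by rewrite mxE mulrC.
Qed.

Lemma cip_shift i F G : cip (shift i F) G = cip F (shift (- i) G).
Proof.
rewrite !cipE; congr cint; apply/funext => t.
by rewrite starZ ekJ opprK -scalemxAl -scalemxAr.
Qed.

Lemma cip_shiftl i F G : cip (shift i F) G = cint (fun t => \tr (F t *m star (G t)) * ek i t).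
Proof.
by rewrite cipE; congr cint; apply/funext => t; rewrite -scalemxAl mxtraceZ mulrC.
Qed.

Lemma shiftK i F : shift i (shift (- i) F) = F.
Proof. by apply/funext => t; rewrite /shift scalerA ekK scale1r. Qed.

Lemma cip_ae F F' G : L2m F -> L2m F' -> L2m G -> {ae mu, forall t, D t -> F t = F' t} ->
  cip F G = cip F' G.
Proof.
move=> LF LF' LG H; rewrite !cipE; apply: cint_ae.
- by case: (cip_L1 LF LG).
- by case: (cip_L1 LF' LG).
- by apply: (aeS _ H) => t {}H Dt; rewrite H.
Qed.

Lemma ae_exists (P : R -> Prop) : {ae mu, forall t, D t -> P t} -> exists2 t, D t & P t.
Proof.
move=> H; apply: contrapT => nP.
have : {ae mu, forall t, ~ D t} by apply: (aeS _ H) => t {}H Dt; apply: nP; exists t => //; exact: H.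
move=> [N [mN N0 sN]].
have : (mu D <= mu N)%E.
  apply: le_measure; rewrite ?inE //; first exact: measurable_Tdom.
  by move=> t Dt; apply: sN => /=; exact.
by rewrite N0 mu_Tdom lee_fin ler10.
Qed.

Lemma L2m_mul_bnd p (T : R -> 'M[C]_(p, m)) F (c : R) : Mm T -> L2m F ->
  {ae mu, forall t, D t -> nrm2 (T t) <= c} -> L2m (fun t => T t *m F t).
Proof.
move=> mT LF H; apply: (@L2m_le_ae _ _ _ _ (fun t => c * nrm2 (F t))).
- by apply: MmM => //; exact: L2m_meas.
- by apply: rintZ; exact: rint_nrm2.
- apply: (aeS _ H) => t {}H Dt; apply: le_trans (nrm2M _ _) _.
  by rewrite ler_wpM2r ?nrm2_ge0 ?H.
Qed.

Lemma const_ae (p : R -> C) : Lp 1 p ->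
  (forall l : int, l != 0 -> cint (fun t => p t * ek l t) = 0) ->
  {ae mu, forall t, D t -> p t = cint p}.
Proof.
move=> Lp0 H; pose c := cint p.
have Lc : Lp 1 (cst c) by exact: L1_cst.
have : {ae mu, forall t, D t -> p t - cst c t = 0}.
  apply: fourier_unique => [|j]; first exact: L1B.
  rewrite fourierE.
  have -> : (fun t => (p t - cst c t) * ek (- j) t) = (fun t => p t * ek (- j) t - c * ek (- j) t).
    by apply/funext => t; rewrite mulrBl.
  have L1e : Lp 1 (@ek R (- j)) by apply: L2_L1; exact: L2_ek1.
  rewrite cintB; [|exact: L1_ek|exact: L1Z].
  rewrite cintZ; last exact: L1e.
  have [->|j0] := eqVneq j 0.
    rewrite oppr0; have -> : (fun t => p t * ek 0 t) = p by apply/funext => t; rewrite ek0 mulr1.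
    have -> : @ek R 0 = cst 1 by apply/funext => t; rewrite ek0.
    by rewrite cint_cst mulr1 subrr.
  by rewrite H ?cint_ek ?oppr_eq0 // mulr0 subrr.
by apply: aeS => t E Dt; apply/eqP; rewrite -subr_eq0; apply/eqP; exact: E.
Qed.

End Shift.

Section Pointwise.
Variable R : realType.
Local Notation C := (R[i]).
Local Notation mu := (@lebesgue_measure R).
Local Notation D := (@Tdom R : set (measurableTypeR R)).
Local Notation L2m := (entrywise (@Lp R 2)).
Local Notation Mm := (entrywise (@cmeas R)).

Lemma ae_forall (I : finType) (P : I -> R -> Prop) :
  (forall i, {ae mu, forall t, P i t}) -> {ae mu, forall t, forall i, P i t}.
Proof.
move=> H; have := @filter_forall _ I (fun i => [set t | P i t]) _ (ae_filter_ringOfSetsType mu) H.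
by [].
Qed.

Lemma cip_eq0 m n (F G : R -> 'M[C]_(m, n)) :
  (forall t, \tr (F t *m star (G t)) = 0) -> cip F G = 0.
Proof.
move=> H; rewrite cipE -[RHS](@cint_cst R); congr cint.
by apply/funext => t; rewrite H.
Qed.

Lemma cip_eq0_ae m n (F G : R -> 'M[C]_(m, n)) : L2m F -> L2m G ->
  {ae mu, forall t, D t -> \tr (F t *m star (G t)) = 0} -> cip F G = 0.
Proof.
move=> LF LG H; rewrite cipE -[RHS](@cint_cst R); apply: cint_ae.
- by case: (cip_L1 LF LG).
- exact: cmeas_cst.
- exact: H.
Qed.

Lemma perp_sum m n (A : set (R -> 'M[C]_(m, n))) (I : Type) (s : seq I)
    (f : I -> R -> 'M[C]_(m, n)) : (forall a, A a -> L2m a) ->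
  (forall i, perp A (f i)) -> perp A (\sum_(i <- s) f i).
Proof.
move=> AL H; elim: s => [|i s IH]; first by rewrite big_nil; exact: perp0.
by rewrite big_cons; exact: (perpD AL (H i) IH).
Qed.

Lemma perp_mulc n r (A : set (R -> 'cV[C]_n)) (T : R -> 'M[C]_(n, r)) (c : 'cV[C]_r) :
  (forall a, A a -> L2m a) ->
  (forall i, perp A (fun t => col i (T t))) -> perp A (fun t => T t *m c).
Proof.
move=> AL H.
have -> : (fun t => T t *m c) = \sum_i c i 0 *: (fun t => col i (T t)).
  apply/funext => t; rewrite fct_sumE; apply/matrixP => a b.
  by rewrite !ord1 summxE mxE; apply: eq_bigr => i _; rewrite !mxE mulrC.
apply: (perp_sum _ AL) => i; exact: (perpZ AL (c i 0) (H i)).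
Qed.

Lemma nrm2_proj_le n p (P : 'M[C]_n) (x : 'M[C]_(n, p)) : star P = P -> P *m P = P ->
  nrm2 (P *m x) <= nrm2 x.
Proof.
move=> sP PP; have E : dotr x (P *m x) = nrm2 (P *m x).
  rewrite nrm2_dotr /dotr !starM sP !mulmxA [in RHS]mxtrace_mulC !mulmxA PP.
  by rewrite [in LHS]mxtrace_mulC mulmxA.
rewrite -subr_ge0; have := nrm2_ge0 (x - 1%:C%C *: (P *m x)).
by rewrite dotr_quad E expr1n; lra.
Qed.

Lemma tr_star_delta n (u : 'cV[C]_n) i : \tr (u *m star (delta_mx i 0)) = u i 0.
Proof.
have -> : star (delta_mx i 0 : 'cV[C]_n) = delta_mx 0 i.
  apply/matrixP => a b; rewrite starE !mxE [(_ == _) && _]andbC.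
  by case: (_ && _); rewrite (conjc1, conjc0).
by rewrite mxtrace_mulC -rowE tr_scal mxE.
Qed.

End Pointwise.

(** * Wold decomposition of the span of the normalized columns *)

Section Factorization.
Variable R : realType.
Local Notation C := (R[i]).
Local Notation mu := (@lebesgue_measure R).
Local Notation D := (@Tdom R : set (measurableTypeR R)).
Local Notation L2m := (entrywise (@Lp R 2)).
Local Notation Mm := (entrywise (@cmeas R)).
Variables (m n k : nat) (Psi : R -> 'M[C]_(n, m)).
Hypothesis PsiH : entrywise (@Hp0 R 1) Psi.
Hypothesis Psi_rank : {ae mu, forall t, D t -> (\rank (Psi t) <= k)%N}.

Let w t : R := Num.sqrt (opnorm (Psi t)).
(** Where [Psi t = 0] the convention [0^-1 = 0] gives [W t = 0], so that [w] times [W] is [Psi]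
    everywhere. *)
Let W t : 'M[C]_(n, m) := (w t)^-1%:C%C *: Psi t.

Let w_ge0 t : 0 <= w t. Proof. exact: sqrtr_ge0. Qed.

Let w2 t : w t ^+ 2 = opnorm (Psi t).
Proof. by rewrite sqr_sqrtr // opnorm_ge0. Qed.

Let mPsi : Mm Psi. Proof. by move=> i j; case: (PsiH i j) => -[[]]. Qed.

Let mw : measurable_fun D w.
Proof. by apply: meas_sqrt; exact: meas_opnorm. Qed.

Let iw2 : rint (fun t => w t ^+ 2).
Proof.
apply: (@rint_le _ _ (fun t => \sum_i \sum_j cabs (Psi t i j))).
- exact: measurable_funX.
- by apply: rint_sum => i; apply: rint_sum => j; apply: L1_cabs; case: (PsiH i j) => -[].
- move=> t _; rewrite w2 ger0_norm ?opnorm_ge0 //; apply: le_trans (opnorm_le_hs _) _.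
  rewrite -[leRHS]ger0_norm; last by apply: sumr_ge0 => i _; apply: sumr_ge0 => j _; exact: cabs_ge0.
  rewrite -sqrtr_sqr ler_sqrt ?sqr_ge0 // /nrm2 !pair_bigA /=.
  have sqsum (I : Type) (s : seq I) (f : I -> R) : (forall i, 0 <= f i) ->
      \sum_(i <- s) f i ^+ 2 <= (\sum_(i <- s) f i) ^+ 2.
    move=> f0; elim: s => [|i s IH]; first by rewrite !big_nil expr0n.
    rewrite !big_cons sqrrD; have : 0 <= f i * \sum_(j <- s) f j.
      by rewrite mulr_ge0 // sumr_ge0.
    by rewrite mulr2n; move: IH; lra.
  under eq_bigr do rewrite -sqr_cabs.
  by apply: sqsum => ij; exact: cabs_ge0.
Qed.

Let wW t : (w t)%:C%C *: W t = Psi t.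
Proof.
rewrite /W scalerA -rmorphM /=; have [w0|w0] := eqVneq (w t) 0; last first.
  by rewrite divff // scale1r.
have /eqP : opnorm (Psi t) = 0 by rewrite -w2 w0 expr0n.
by rewrite opnorm_eq0 => /eqP ->; rewrite scaler0.
Qed.

Let opW t : opnorm (W t) <= w t.
Proof.
rewrite opnormZ cabsr ger0_norm ?invr_ge0 // -w2.
have [->|w0] := eqVneq (w t) 0; first by rewrite expr0n mulr0.
by rewrite expr2 mulKf.
Qed.

Let mW : Mm W.
Proof. by apply: MmZ => //; apply: cmeas_real; exact: meas_inv. Qed.

Let LW : L2m W.
Proof.
apply: (@L2m_le_ae _ _ _ _ (fun t => m%:R * w t ^+ 2)) => //; first exact: rintZ.
apply: aeT => t _; apply: le_trans (nrm2_le_opnorm _) _.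
by rewrite ler_wpM2l ?ler0n // ler_sqr ?nnegrE ?opnorm_ge0 ?opW //.
Qed.

Let Wc j t : 'cV[C]_n := col j (W t).

Let LWc j : L2m (Wc j).
Proof. by move=> a b; apply: (Lp_ext _ (LW a j)) => t; rewrite [RHS]mxE. Qed.

Definition colset (l : int) : set (R -> 'cV[C]_n) :=
  [set a | exists i j, l <= i /\ a = shift i (Wc j)].

Let AL2 l a : colset l a -> L2m a.
Proof. by move=> [i [j [_ ->]]]; exact: L2m_shift. Qed.

(* [M l] is the closed span of the [z ^ i W_j] with [l <= i]. *)
Let B l := perp (colset l).
Let M l := perp (B l).

Let BL2 l a : B l a -> L2m a. Proof. by case. Qed.
Let ML2 l a : M l a -> L2m a. Proof. by case. Qed.

Let MB l x y : M l x -> B l y -> cip x y = 0.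
Proof. by move=> [_ H] By; exact: H. Qed.

Let BM l x y : M l x -> B l y -> cip y x = 0.
Proof. by move=> Mx By; rewrite (cipC (BL2 By) (ML2 Mx)) (MB Mx By) conjc0. Qed.

Let AM l a : colset l a -> M l a.
Proof. exact: sub_biperp (@AL2 l) a. Qed.

Let B_shift l i y : B l y -> B (l + i) (shift i y).
Proof.
move=> [Ly Zy]; split; first exact: L2m_shift.
move=> _ [q [j [lq ->]]]; rewrite cip_shift; apply: Zy.
exists (q - i), j; split; first by rewrite lerBrDr.
by apply/funext => t; rewrite /shift scalerA -ekD addrC.
Qed.

Let M_shift l i x : M l x -> M (l + i) (shift i x).
Proof.
move=> Mx; split; first exact: L2m_shift (ML2 Mx).
move=> y By; rewrite cip_shift; apply: (MB Mx).
by have := B_shift (- i) By; rewrite addrK.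
Qed.

Let B_le l l' x : l <= l' -> B l x -> B l' x.
Proof.
move=> ll' [Lx Zx]; split; first exact: Lx.
move=> a [i [j [li ->]]]; apply: Zx; exists i, j; split => //; exact: le_trans li.
Qed.

Let M_le l l' x : l' <= l -> M l x -> M l' x.
Proof.
move=> ll' [Lx Zx]; split; first exact: Lx.
by move=> y By; apply: Zx; exact: B_le By.
Qed.

(* The wandering subspace of [M (-1)]: multiplying by a nonzero power of [z] makes an element
   of [E] orthogonal to [E], so the pointwise inner products of [E] are constant. *)
Let E x := M (-1) x /\ B 0 x.

Let sprod (x y : R -> 'cV[C]_n) t : C := \tr (x t *m star (y t)).

Let E_const x y : E x -> E y -> {ae mu, forall t, D t -> sprod x y t = cip x y}.
Proof.
move=> [Mx Bx] [My By].
rewrite cipE; apply: const_ae; first exact: cip_L1 (ML2 Mx) (ML2 My).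
move=> l l0; rewrite -cip_shiftl.
(* For [l > 0] the shifted [x] lies in [M 0], to which [y] is orthogonal; for [l < 0] the shift is
   moved to [y] and the roles are exchanged. *)
have [lp|ln] := ltP 0 l.
  apply: (@MB 0) => //; apply: (@M_le (-1 + l)); last exact: M_shift.
  by lia.
rewrite cip_shift; apply: (@BM 0) => //.
apply: (@M_le (-1 + - l)); last exact: M_shift.
by lia.
Qed.

Let Pi t := colproj (W t).

Let mPi : Mm Pi. Proof. exact: Mm_colproj. Qed.

(** The defect [x - Pi x] is pointwise orthogonal to all columns of [W], hence lies in [B l] and is
    orthogonal to [x]; its pairing with [x] is its own squared norm. *)
Let M_Pi l x : M l x -> {ae mu, forall t, D t -> Pi t *m x t = x t}.
Proof.
move=> Mx; have Lx := ML2 Mx; pose h : R -> 'cV[C]_n := fun t => x t - Pi t *m x t.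
have LPx : L2m (fun t => Pi t *m x t).
  apply: (@L2m_le_ae _ _ _ _ (fun t => nrm2 (x t))); last apply: aeT => t _.
  - by apply: MmM => //; exact: L2m_meas.
  - exact: rint_nrm2.
  - by apply: nrm2_proj_le; [exact: colproj_star|exact: colprojK].
have Lh : L2m h by exact: L2mB.
have Bh : B l h.
  split; first exact: Lh.
  move=> _ [i [j [_ ->]]]; apply: cip_eq0 => t; rewrite mxtrace_mulC.
  have E2 : Pi t *m shift i (Wc j) t = shift i (Wc j) t.
    by rewrite /shift -scalemxAr /Wc colE mulmxA colproj_id.
  rewrite /h mulmxBr mulmxA -[Pi t]colproj_star -starM.
  by rewrite E2 subrr mxtrace0.
have h0 : rip h h = 0.
  rewrite rip_cip; have -> : cip h h = cip x h.
    rewrite !cipE; congr cint; apply/funext => t.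
    have Z : \tr (Pi t *m x t *m star (h t)) = 0.
      rewrite -mulmxA mxtrace_mulC -mulmxA -[Pi t]colproj_star -starM.
      have -> : Pi t *m h t = 0 by rewrite /h mulmxBr mulmxA colprojK subrr.
      by rewrite star0 mulmx0 mxtrace0.
    by rewrite [X in X *m _](_ : h t = x t - Pi t *m x t) // mulmxBl linearB /= Z subr0.
  by rewrite (MB Mx Bh).
apply: (aeS _ (rip_eq0_ae Lh h0)) => t H Dt.
by apply/eqP; rewrite eq_sym -subr_eq0; apply/eqP; exact: H.
Qed.

Let sw t : C := (w t)%:C%C.

Let Lsw : Lp 2 sw.
Proof.
apply: (@L2_le_ae _ _ (fun t => w t ^+ 2)); [exact: (cmeas_real mw)|exact: iw2|].
by apply: aeT => t _; rewrite cabs2r.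
Qed.

(** The coefficient is the pairing of [x] with [y = w z^(-l) e_i]. Since [w] times [W] is [Psi],
    pairing [y] with z^p W_j yields a Fourier coefficient of [Psi]; for [p >= q] it is one that
    vanishes for functions in H^1_0. *)
Let wcoef q l x i : M q x -> - q <= l -> cint (fun t => (sw t * x t i 0) * ek l t) = 0.
Proof.
move=> Mx ql; pose y : R -> 'cV[C]_n := fun t => (sw t * ek (- l) t) *: delta_mx i 0.
have Ly : L2m y.
  move=> a b; have := L2Z ((delta_mx i 0 : 'cV[C]_n) a b) (L2_ek (- l) Lsw).
  by apply: Lp_ext => t; rewrite [RHS]mxE mulrC.
have conjE t : conjc (sw t * ek (- l) t) = sw t * ek l t.
  by rewrite conjcM conjc_real ekJ opprK.
have By : B q y.
  split; first exact: Ly.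
  move=> _ [p [j [qp ->]]].
  have La : L2m (shift p (Wc j)) by exact: L2m_shift.
  rewrite (cipC Ly La); have -> : cip (shift p (Wc j)) y = 0; last exact: conjc0.
  have pl : 0 <= p + l by lia.
  rewrite -(Hp0_coef (PsiH i j) pl) cipE; congr cint; apply/funext => t.
  rewrite /y starZ conjE -scalemxAr mxtraceZ tr_star_delta.
  have -> : shift p (Wc j) t i 0 = ek p t * W t i j by rewrite [LHS]mxE [X in _ * X]mxE.
  have -> : Psi t i j = sw t * W t i j by rewrite -wW [LHS]mxE.
  by rewrite ekD; move: (W t i j) (sw t) => a b; ring.
rewrite -(MB Mx By) cipE; congr cint; apply/funext => t.
by rewrite /y starZ conjE -scalemxAr mxtraceZ tr_star_delta; ring.
Qed.

(** Purity of the shift: all Fourier coefficients of [w] times [x] vanish, hence so does this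
    product. *)
Let M_inf x : (forall q, M q x) -> {ae mu, forall t, D t -> x t = 0}.
Proof.
move=> H; have Lx := ML2 (H 0).
have wx i : {ae mu, forall t, D t -> sw t * x t i 0 = 0}.
  apply: fourier_unique => [|j]; first exact: L2_mul Lsw (Lx i 0).
  by rewrite fourierE; apply: (wcoef i (H j)).
have wxa : {ae mu, forall t, D t -> forall i, sw t * x t i 0 = 0}.
  have : {ae mu, forall t, forall i, D t -> sw t * x t i 0 = 0}.
    exact: ae_forall.
  by apply: aeS => t {}H Dt i; exact: H.
apply: (aeS _ (aeI wxa (M_Pi (H 0)))) => t [h1 h2] Dt.
(* Where [w] vanishes the product says nothing, but there [W] and hence [Pi] vanish, and
   [x = Pi x]. *)
have [w0|w0] := eqVneq (w t) 0.
  have W0 : W t = 0 by rewrite /W w0 invr0 scale0r.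
  have P0 : Pi t = 0.
    by have := colproj_kill (W := W t) (y := 1%:M); rewrite !mul1mx; apply.
  by rewrite -(h2 Dt) P0 mul0mx.
apply/matrixP => i j; rewrite !ord1 [RHS]mxE; have /eqP := h1 Dt i.
by rewrite mulf_eq0 => /orP[|/eqP //]; rewrite /sw -(rmorph0 (real_complex R)) => /eqP/complexI/eqP; rewrite (negPf w0).
Qed.

Let EL2 x : E x -> L2m x. Proof. by move=> [[]]. Qed.

Let EZ c x : E x -> E (c *: x).
Proof.
by move=> [Mx Bx]; split; [exact: (perpZ (@BL2 _) c Mx)|exact: (perpZ (@AL2 _) c Bx)].
Qed.

Let EB x y : E x -> E y -> E (x - y).
Proof.
move=> [Mx Bx] [My By].
by split; [exact: (perpB (@BL2 _) Mx My)|exact: (perpB (@AL2 _) Bx By)].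
Qed.

Let Emul r (T : R -> 'M[C]_(n, r)) c : (forall i, E (fun t => col i (T t))) ->
  E (fun t => T t *m c).
Proof.
move=> H; split.
  by apply: perp_mulc => [|i]; [exact: (@BL2 _)|have [] := H i].
by apply: perp_mulc => [|i]; [exact: (@AL2 _)|have [] := H i].
Qed.

Let ofam r (T : R -> 'M[C]_(n, r)) := (forall i, E (fun t => col i (T t))) /\
  {ae mu, forall t, D t -> star (T t) *m T t = 1%:M}.

Let ofam_L2 r (T : R -> 'M[C]_(n, r)) : ofam T -> L2m T.
Proof.
by move=> [H _] i j; apply: (Lp_ext _ (EL2 (H j) i 0)) => t; rewrite mxE.
Qed.

Let ofam_nrm2 r (T : R -> 'M[C]_(n, r)) : ofam T -> {ae mu, forall t, D t -> nrm2 (T t) <= r%:R}.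
Proof.
move=> [_ H]; apply: (aeS _ H) => t {}H Dt; rewrite -lecR -nrm2_star nrm2E starK.
by rewrite H // mxtrace1 rmorph_nat.
Qed.

Let ofam_Pi r (T : R -> 'M[C]_(n, r)) : ofam T -> {ae mu, forall t, D t -> Pi t *m T t = T t}.
Proof.
move=> [HE _].
have : {ae mu, forall t, forall i, D t -> Pi t *m col i (T t) = col i (T t)}.
  by apply: ae_forall => i; apply: (@M_Pi (-1)); case: (HE i).
apply: aeS => t H Dt; apply/matrixP => i j; transitivity ((Pi t *m col j (T t)) i 0).
  by rewrite !mxE; apply: eq_bigr => l _; rewrite !mxE.
by rewrite H // mxE.
Qed.

(** A single point outside the null sets suffices: there [r] orthonormal vectors lie in the column
    space of [W t], of dimension at most [k]. *)
Let ofam_rank r (T : R -> 'M[C]_(n, r)) : ofam T -> (r <= k)%N.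
Proof.
move=> oT; have oT2 := oT.2.
have [t _ [[h1 h2] h3]] : exists2 t, D t & (Pi t *m T t = T t /\ star (T t) *m T t = 1%:M) /\
    (\rank (Psi t) <= k)%N.
  apply: ae_exists; apply: (aeS _ (aeI (aeI (ofam_Pi oT) oT2) Psi_rank)) => t [[g1 g2] g3] Dt.
  by split; [split; [exact: g1|exact: g2]|exact: g3].
rewrite -(mxrank1 C r) -h2; apply: leq_trans (mxrankM_maxr _ _) _.
rewrite -h1; apply: leq_trans (mxrankM_maxl _ _) _.
apply: leq_trans (colproj_rank _) _; apply: leq_trans h3.
by rewrite /W -mul_scalar_mx; exact: mxrankM_maxr.
Qed.

Let ofam_max : exists r (T : R -> 'M[C]_(n, r)), ofam T /\
  forall T' : R -> 'M[C]_(n, r + 1), ~ ofam T'.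
Proof.
pose P (r : nat) := `[< exists T : R -> 'M[C]_(n, r), ofam T >].
have exP : exists r, P r.
  (* The empty family is orthonormal. *)
  exists 0%N; apply/asboolP; exists (fun=> 0); split; first by case.
  by apply: aeT => t _; apply/matrixP => -[].
have ubP r : P r -> (r <= k)%N by move=> /asboolP[T]; exact: ofam_rank.
have [r Pr rmax] := ex_maxnP exP ubP.
have [T oT] := asboolW Pr.
exists r, T; split => // T' oT'.
have : P (r + 1)%N by apply/asboolP; exists T'.
by move=> /rmax; rewrite addn1 ltnn.
Qed.

(** * Consequences of maximality of a pointwise-orthonormal family *)

Section Maximal.
Variables (r : nat) (T : R -> 'M[C]_(n, r)).
Hypothesis oT : ofam T.
Hypothesis maxT : forall T' : R -> 'M[C]_(n, r + 1), ~ ofam T'.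

Let LT : L2m T. Proof. exact: ofam_L2. Qed.
Let mT : Mm T. Proof. exact: L2m_meas. Qed.

(** Inner products in [E] are constant, so [e] minus its pointwise projection on [T] is again in
    [E], with constant pointwise norm. If that norm were not zero, the normalized remainder would be
    an additional column of [T]. *)
Let E_span e : E e -> exists c, {ae mu, forall t, D t -> e t = T t *m c}.
Proof.
move=> Ee; pose c : 'cV[C]_r := \col_i cip e (fun t => col i (T t)).
have Te : {ae mu, forall t, D t -> star (T t) *m e t = c}.
  have : {ae mu, forall t, forall i, D t -> sprod e (fun t => col i (T t)) t = c i 0}.
    apply: ae_forall => i; rewrite mxE; apply: (E_const Ee); exact: oT.1.
  apply: aeS => t H Dt; apply/matrixP => i j; rewrite ord1 -H // /sprod mxtrace_mulC tr_scal.
  by rewrite !mxE; apply: eq_bigr => l _; rewrite !mxE.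
pose e' : R -> 'cV[C]_n := e - (fun t => T t *m c).
have Ee' : E e' by exact: (EB Ee (Emul c oT.1)).
have Te' : {ae mu, forall t, D t -> star (T t) *m e' t = 0}.
  apply: (aeS _ (aeI Te oT.2)) => t [h1 h2] Dt.
  have -> : e' t = e t - T t *m c by [].
  by rewrite mulmxBr mulmxA h1 // h2 // mul1mx subrr.
pose d := rip e' e'.
have nd : {ae mu, forall t, D t -> nrm2 (e' t) = d}.
  apply: (aeS _ (E_const Ee' Ee')) => t H Dt.
  by rewrite nrm2_dotr /d rip_cip -H.
have [d0|d0] := eqVneq d 0.
  exists c; apply: (aeS _ nd) => t H Dt; have /eqP := H Dt.
  rewrite d0 nrm2_eq0 => /eqP E0; apply/eqP; rewrite -subr_eq0; apply/eqP; exact: E0.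
have dp : 0 < d by rewrite lt_neqAle eq_sym d0 rip_ge0.
pose s := (Num.sqrt d)^-1.
exfalso; apply: (maxT (T' := fun t => row_mx (T t) (s%:C%C *: e' t))); split.
  move=> i; rewrite -(splitK i); case: (fintype.split i) => j /=.
    by under [fun t => _]funext => t do rewrite colKl; exact: oT.1.
  under [fun t => _]funext => t do rewrite colKr.
  have -> : (fun t => col j (s%:C%C *: e' t)) = s%:C%C *: e'.
    by apply/funext => t; apply/matrixP => a b; rewrite !ord1 mxE.
  exact: EZ.
apply: (aeS _ (aeI (aeI Te' nd) oT.2)) => t [[h1 h2] h3] Dt.
have -> : star (row_mx (T t) (s%:C%C *: e' t)) = col_mx (star (T t)) (star (s%:C%C *: e' t)).
  by rewrite /star tr_row_mx map_col_mx.
rewrite mul_col_row (h3 Dt) -scalemxAr (h1 Dt) scaler0.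
have -> : star (s%:C%C *: e' t) *m T t = 0.
  rewrite starZ -scalemxAl; have -> : star (e' t) *m T t = star (star (T t) *m e' t).
    by rewrite starM starK.
  by rewrite (h1 Dt) star0 scaler0.
rewrite scalar_mx_block; congr block_mx.
rewrite starZ -scalemxAl -scalemxAr scalerA conjc_real -rmorphM /=.
have -> : star (e' t) *m e' t = (nrm2 (e' t))%:C%C%:M.
  rewrite -[nrm2 _]nrm2_star nrm2E starK tr_scal; apply/matrixP => a b.
  by rewrite !ord1 [RHS]mxE eqxx mulr1n.
rewrite (h2 Dt) scale_scalar_mx -rmorphM /=.
suff -> : s * s * d = 1 by [].
have sd : Num.sqrt d != 0 by rewrite sqrtr_eq0 -ltNge.
by rewrite /s -[X in _ * X](sqr_sqrtr (ltW dp)); field.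
Qed.

(* If [T] is a maximal pointwise-orthonormal family in [E], the [E]-component of [h] is
   spanned by [T], hence vanishes. *)
Let M_step h : M (-1) h -> {ae mu, forall t, D t -> star (T t) *m h t = 0} -> M 0 h.
Proof.
move=> Mh Th; have Lh := ML2 Mh.
have [h0 Mh0 H0] := perp_proj (@BL2 0) Lh.
have Lh0 := ML2 Mh0.
pose e : R -> 'cV[C]_n := h - h0.
have Le : L2m e by exact: L2mB.
have Mh0' : M (-1) h0 by apply: (@M_le 0).
have Me : M (-1) e by exact: (perpB (@BL2 _) Mh Mh0').
have Be : B 0 e.
  by split; [exact: Le|move=> a Aa; apply: H0; exact: AM].
have [c ec] := E_span (conj Me Be).
have z1 : cip h e = 0.
  apply: (cip_eq0_ae Lh Le); apply: (aeS _ (aeI ec Th)) => t [h1 h2] Dt.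
  by rewrite h1 // starM mxtrace_mulC -mulmxA h2 // mulmx0 mxtrace0.
have z2 : rip e e = 0.
  by rewrite rip_cip (cipBl Lh Lh0 Le) z1 (MB Mh0 Be) subrr.
have e0 := rip_eq0_ae Le z2.
split; first exact: Lh.
move=> y By; rewrite -(MB Mh0 By); apply: (cip_ae Lh Lh0 (BL2 By)).
apply: (aeS _ e0) => t H Dt; apply/eqP; rewrite -subr_eq0; apply/eqP; exact: H.
Qed.

(** Shifting preserves pointwise orthogonality to [T], so [M_step] can be iterated: [h] lies in all
    the spaces [M q], and purity applies. *)
Let M_all h : M (-1) h -> {ae mu, forall t, D t -> star (T t) *m h t = 0} ->
  {ae mu, forall t, D t -> h t = 0}.
Proof.
move=> Mh Th; apply: M_inf => q.
have all (N : nat) : M (-1 + N%:Z) h.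
  elim: N => [|N IH]; first by rewrite addr0.
  have H1 : M (-1) (shift (- N%:Z) h).
    by have := M_shift (- N%:Z) IH; rewrite addrK.
  have H2 : {ae mu, forall t, D t -> star (T t) *m shift (- N%:Z) h t = 0}.
    by apply: (aeS _ Th) => t H Dt; rewrite /shift -scalemxAr H // scaler0.
  have := M_shift N%:Z (M_step H1 H2); rewrite shiftK.
  by rewrite add0r (_ : -1 + N.+1%:Z = N%:Z) //; lia.
(* Any natural number that is at least [q + 1] would do in place of the absolute value. *)
by apply: (@M_le (-1 + (absz (q + 1)%R)%:Z)); [lia|exact: all].
Qed.

(** The columns of [T] lie in [B 0], that is, they are orthogonal to z^l W_j for [l >= 0]. The case
    [l = 0] removes the constant term, which places the factor in H^2_0. *)
Let TW_coef i j (l : int) : 0 <= l -> cint (fun t => (star (T t) *m W t) i j * ek l t) = 0.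
Proof.
move=> l0; have [_ Bi] := oT.1 i.
have Ai : colset 0 (shift l (Wc j)) by exists l, j.
have La := AL2 Ai; have Li := BL2 Bi.
rewrite -[RHS]conjc0 -(Bi.2 _ Ai) -(cipC La Li) cip_shiftl; congr cint; apply/funext => t.
rewrite mxtrace_mulC tr_scal; congr (_ * _).
by rewrite !mxE; apply: eq_bigr => a _; rewrite !mxE.
Qed.

Let L2TW : L2m (fun t => star (T t) *m W t).
Proof.
apply: (@L2m_mul_bnd R n m r (fun t => star (T t)) W r%:R); [exact: Mm_star|exact: LW|].
by apply: (aeS _ (ofam_nrm2 oT)) => t H Dt; rewrite nrm2_star H.
Qed.

Let TW_H20 i j : Hp0 2 (fun t => (star (T t) *m W t) i j).
Proof. by apply: Hp0_intro => [|l l0]; [exact: L2TW|exact: TW_coef]. Qed.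

(** The remainder [h] of a column of [W] is pointwise orthogonal to [T], so [M_all] makes it vanish
    once it is known to lie in [M (-1)]. For this, its pairing with [B (-1)] is computed through
    products of Hardy functions. *)
Let TTW_W : {ae mu, forall t, D t -> T t *m (star (T t) *m W t) = W t}.
Proof.
have L2TTW : L2m (fun t => T t *m (star (T t) *m W t)).
  by apply: (@L2m_mul_bnd R r m n T _ r%:R); [exact: mT|exact: L2TW|exact: ofam_nrm2].
suff : {ae mu, forall t, forall j, D t -> Wc j t - T t *m (star (T t) *m Wc j t) = 0}.
  apply: aeS => t H Dt; apply/matrixP => i j; have /matrixP/(_ i 0)/eqP := H j Dt.
  rewrite mxE [X in _ == X]mxE [X in _ + X]mxE subr_eq0 /Wc mxE => /eqP ->.
  by rewrite colE !mulmxA -colE [RHS]mxE.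
apply: ae_forall => j.
pose h : R -> 'cV[C]_n := fun t => Wc j t - T t *m (star (T t) *m Wc j t).
have LTg : L2m (fun t => T t *m (star (T t) *m Wc j t)).
  move=> a b; apply: (Lp_ext _ (L2TTW a j)) => t.
  by rewrite !ord1 /Wc colE !mulmxA -colE [RHS]mxE.
have Lh : L2m h by exact: (L2mB (LWc j) LTg).
apply: (@M_all h); last first.
  apply: (aeS _ oT.2) => t H Dt; rewrite /h mulmxBr !mulmxA H // mul1mx subrr //.
split; first exact: Lh.
move=> y By; have Ly := BL2 By.
rewrite (cipBl (LWc j) LTg Ly).
have Aj : colset (-1) (Wc j).
  exists 0, j; split => //; apply/funext => t.
  by rewrite /shift ek0 scale1r.
rewrite (MB (AM Aj) By) sub0r; apply/eqP; rewrite oppr_eq0; apply/eqP.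
(* As z^l T_i lies in [M (-1)] for [l >= 0], the coefficients of [x i] that pair with H^2 vanish.
   The pairing of the projected column with [y] is a sum of integrals of [x i] against entries in
   H^2. *)
pose x i t := (star (y t) *m T t) 0 i.
have Lx i : Lp 2 (x i).
  have Lyt : L2m (fun t => star (T t) *m y t).
    apply: (@L2m_mul_bnd R n 1 r (fun t => star (T t)) y r%:R); [exact: Mm_star|exact: Ly|].
    by apply: (aeS _ (ofam_nrm2 oT)) => t H Dt; rewrite nrm2_star H.
  apply: (Lp_ext _ (L2J (Lyt i 0))) => t.
  by rewrite /x -[star (y t) *m T t]starK starE starM starK.
have xcoef i (l : int) : 0 <= l -> cint (fun t => x i t * ek l t) = 0.
  move=> l0; have Mi : M (-1) (shift l (fun t => col i (T t))).
    by apply: (@M_le (-1 + l)); [lia|apply: M_shift; case: (oT.1 i)].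
  rewrite -(MB Mi By) cip_shiftl; congr cint; apply/funext => t; congr (_ * _).
  by rewrite mxtrace_mulC tr_scal /x !mxE; apply: eq_bigr => a _; rewrite !mxE.
rewrite cipE.
have -> : (fun t => \tr (T t *m (star (T t) *m Wc j t) *m star (y t))) =
    (fun t => \sum_i (star (T t) *m W t) i j * x i t).
  apply/funext => t; rewrite mxtrace_mulC (mulmxA (star (y t)) (T t)) tr_scal mxE.
  apply: eq_bigr => i _; rewrite mulrC; congr (_ * _).
  by rewrite /Wc colE mulmxA -colE mxE.
rewrite cint_sum; last by move=> i; apply: L2_mul; [exact: L2TW|exact: Lx].
apply: big1 => i _; apply: H2_perp; [|exact: Lx|exact: xcoef].
by case: (TW_H20 i j).
Qed.

(** Membership in [M (-1)] makes the coefficients vanish from [l = 1] on, which is H^2 with the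
    constant term allowed. *)
Let wT_H2 i j : Hp 2 (fun t => ((w t)%:C%C *: T t) i j).
Proof.
apply: Hp_intro => [|l l0].
  apply: (@L2m_le_ae _ _ _ (fun t => (w t)%:C%C *: T t) (fun t => r%:R * w t ^+ 2)).
  - by apply: MmZ => //; exact: cmeas_real.
  - exact: rintZ.
  - apply: (aeS _ (ofam_nrm2 oT)) => t H Dt.
    by rewrite nrm2Z cabs2r mulrC ler_wpM2r ?sqr_ge0 ?H.
have Mj := (oT.1 j).1; have l1 : - (-1) <= l by lia.
rewrite -(wcoef i Mj l1); congr cint; apply/funext => t.
by rewrite !mxE.
Qed.

Lemma factorization_max : (r <= k)%N /\ exists (F : R -> 'M[C]_(n, k)) (G : R -> 'M[C]_(k, m)),
  [/\ entrywise (@Hp R 2) F, entrywise (@Hp0 R 2) G &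
      {ae mu, forall t, D t -> [/\ F t *m G t = Psi t, opnorm (F t) <= w t & opnorm (G t) <= w t]}].
Proof.
have rk : (r <= k)%N by exact: ofam_rank oT.
split => //.
(* The family may have fewer than [k] members; zero columns and rows fill up the inner dimension
   without changing the product or increasing the norms. *)
pose Jr : 'M[C]_(r, k) := pid_mx r; pose Jl : 'M[C]_(k, r) := pid_mx r.
have JJ : Jr *m Jl = 1%:M by rewrite /Jr /Jl pid_mx_id // pid_mx_1.
have sJ : star Jl = Jr.
  by rewrite /star /Jl tr_pid_mx map_pid_mx.
have Jl1 : opnorm Jl <= 1 by apply: opnorm_isom; rewrite sJ.
have Jr1 : opnorm Jr <= 1 by rewrite -sJ; exact: le_trans (opnorm_star _) Jl1.
exists (fun t => (w t)%:C%C *: T t *m Jr), (fun t => Jl *m (star (T t) *m W t)); split.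
- move=> i j; apply: Hp_intro => [|l l0].
    apply: (@Lp_ext _ _ (fun t => \sum_a Jr a j * ((w t)%:C%C *: T t) i a)) => [t|].
      by rewrite mxE; apply: eq_bigr => a _; rewrite mulrC.
    by apply: L2_sum => a; apply: L2Z; case: (wT_H2 i a).
  have -> : (fun t => ((w t)%:C%C *: T t *m Jr) i j * ek l t) =
      (fun t => \sum_a Jr a j * (((w t)%:C%C *: T t) i a * ek l t)).
    apply/funext => t; rewrite mxE mulr_suml; apply: eq_bigr => a _.
    by rewrite [_ * Jr a j]mulrC mulrA.
  have L1a a : Lp 1 (fun t => ((w t)%:C%C *: T t) i a * ek l t).
    by apply: L1_ek; apply: L2_L1; case: (wT_H2 i a).
  rewrite cint_sum; last by move=> a; exact: L1Z.
  by apply: big1 => a _; rewrite (cintZ _ (L1a a)) (Hp_coef (wT_H2 i a) l0) mulr0.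
- move=> i j; apply: Hp0_intro => [|l l0].
    apply: (@Lp_ext _ _ (fun t => \sum_a Jl i a * (star (T t) *m W t) a j)) => [t|].
      by rewrite [RHS]mxE.
    by apply: L2_sum => a; apply: L2Z; exact: L2TW.
  have -> : (fun t => (Jl *m (star (T t) *m W t)) i j * ek l t) =
      (fun t => \sum_a Jl i a * ((star (T t) *m W t) a j * ek l t)).
    apply/funext => t; rewrite mxE mulr_suml; apply: eq_bigr => a _.
    by rewrite mulrA.
  have L1a a : Lp 1 (fun t => (star (T t) *m W t) a j * ek l t).
    by apply: L1_ek; apply: L2_L1; exact: L2TW.
  rewrite cint_sum; last by move=> a; exact: L1Z.
  by apply: big1 => a _; rewrite (cintZ _ (L1a a)) (TW_coef a j l0) mulr0.
- apply: (aeS _ (aeI TTW_W oT.2)) => t [h1 h2] Dt.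
  have TT := h2 Dt; have T1 := opnorm_isom TT.
  have T1' : opnorm (star (T t)) <= 1 by exact: le_trans (opnorm_star _) T1.
  split.
  + rewrite mulmxA -[_ *m Jr *m Jl]mulmxA JJ mulmx1 -scalemxAl h1 // wW //.
  + apply: le_trans (opnormM _ _) _; rewrite opnormZ cabsr ger0_norm //.
    apply: le_trans (_ : w t * 1 * 1 <= _); last by rewrite !mulr1.
    by rewrite ler_pM ?mulr_ge0 ?opnorm_ge0 // ler_wpM2l.
  + apply: le_trans (opnormM _ _) _; apply: le_trans (_ : 1 * (1 * w t) <= _); last by rewrite !mul1r.
    rewrite ler_pM ?opnorm_ge0 //; apply: le_trans (opnormM _ _) _.
    by rewrite ler_pM ?opnorm_ge0.
Qed.

End Maximal.

Theorem rank_factorization : exists (F : R -> 'M[C]_(n, k)) (G : R -> 'M[C]_(k, m)),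
  [/\ entrywise (@Hp R 2) F, entrywise (@Hp0 R 2) G &
      {ae mu, forall t, D t -> [/\ F t *m G t = Psi t,
        opnorm (F t) ^+ 2 <= opnorm (Psi t) & opnorm (G t) ^+ 2 <= opnorm (Psi t)]}].
Proof.
have [r [T [oT maxT]]] := ofam_max.
have [_ [F [G [HF HG FG]]]] := factorization_max oT maxT.
exists F, G; split => //; apply: (aeS _ FG) => t H Dt; have [h1 h2 h3] := H Dt.
by split; [exact: h1|rewrite -w2 ler_sqr ?nnegrE ?opnorm_ge0|rewrite -w2 ler_sqr ?nnegrE ?opnorm_ge0].
Qed.

End Factorization.

(** * The quotient norm *)

Section SquareNorm.
Variable R : realType.
Local Notation C := (R[i]).
Local Notation mu := (@lebesgue_measure R).
Local Notation D := (@Tdom R : set (measurableTypeR R)).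
Implicit Types f g : R -> R.

Definition n2 g : R := Num.sqrt (\int[mu]_(t in D) (g t ^+ 2)).

Definition sq_int g := measurable_fun D g /\ rint (fun t => g t ^+ 2).

Lemma sq_int_mul f g : sq_int f -> sq_int g -> rint (fun t => f t * g t).
Proof.
move=> [mf i_f] [mg i_g]; apply: (@rint_le _ _ (fun t => f t ^+ 2 + g t ^+ 2)).
- exact: measurable_funM.
- exact: rintD.
- move=> t _; rewrite ler_norml; have := sqr_ge0 (f t + g t); have := sqr_ge0 (f t - g t).
  have := sqr_ge0 (f t); have := sqr_ge0 (g t).
  by rewrite !expr2 => *; apply/andP; split; nra.
Qed.

Lemma sq_intD f g : sq_int f -> sq_int g -> sq_int (fun t => f t + g t).
Proof.
move=> Sf Sg; have [mf i_f] := Sf; have [mg i_g] := Sg; split; first exact: measurable_funD.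
have := rintD (rintD i_f i_g) (rintZ 2 (sq_int_mul Sf Sg)).
by apply: eq_integrable => [|t _ /=]; [exact: measurable_Tdom|congr _%:E; ring].
Qed.

Lemma sq_int_le f g : measurable_fun D f -> sq_int g ->
  (forall t, D t -> `|f t| <= g t) -> sq_int f.
Proof.
move=> mf [mg ig] H; split => //; apply: (rint_le _ ig); first exact: measurable_funX.
move=> t Dt; rewrite ger0_norm ?sqr_ge0 // -[leLHS]real_normK ?num_real //.
by rewrite ler_sqr ?nnegrE ?H // (le_trans _ (H t Dt)).
Qed.

Lemma n2_ge0 g : 0 <= n2 g.
Proof. exact: sqrtr_ge0. Qed.

Lemma sqr_n2 g : n2 g ^+ 2 = \int[mu]_(t in D) (g t ^+ 2).
Proof. by rewrite sqr_sqrtr // rint_ge0 // => t _; exact: sqr_ge0. Qed.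

Lemma n2_CS f g : sq_int f -> sq_int g -> \int[mu]_(t in D) (f t * g t) <= n2 f * n2 g.
Proof.
move=> Sf Sg; have [_ i_f] := Sf; have [_ i_g] := Sg.
have ifg := sq_int_mul Sf Sg.
have H : (\int[mu]_(t in D) (f t * g t)) ^+ 2 <= (n2 f * n2 g) ^+ 2.
  rewrite exprMn !sqr_n2; apply: semi_CS => [||s].
  - by apply: rint_ge0 => t _; exact: sqr_ge0.
  - by apply: rint_ge0 => t _; exact: sqr_ge0.
  - rewrite -!rintegralZ // -rintegralB //; last exact: rintZ.
    rewrite -rintegralD; [|apply: rintB => //; exact: rintZ|exact: rintZ].
    apply: rint_ge0 => t _.
    rewrite [X in 0 <= X](_ : _ = (f t - s * g t) ^+ 2) ?sqr_ge0 //; ring.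
apply: le_trans (ler_norm _) _.
by rewrite -(@ler_sqr R) ?nnegrE ?mulr_ge0 ?n2_ge0 // real_normK ?num_real.
Qed.

Lemma n2_le f g : sq_int f -> sq_int g ->
  {ae mu, forall t, D t -> `|f t| <= `|g t|} -> n2 f <= n2 g.
Proof.
move=> [_ i_f] [_ i_g] H; rewrite /n2 ler_sqrt; last by apply: rint_ge0 => t _; exact: sqr_ge0.
apply: le_rint_ae => //; apply: (aeS _ H) => t {}H Dt.
rewrite -[leLHS]real_normK ?num_real // -[leRHS]real_normK ?num_real //.
by rewrite ler_sqr ?nnegrE ?H.
Qed.

Lemma n2D f g : sq_int f -> sq_int g -> n2 (fun t => f t + g t) <= n2 f + n2 g.
Proof.
move=> Sf Sg; have [_ i_f] := Sf; have [_ i_g] := Sg; have ifg := sq_int_mul Sf Sg.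
rewrite -(@ler_sqr R) ?nnegrE ?addr_ge0 ?n2_ge0 // sqrrD !sqr_n2.
have -> : \int[mu]_(t in D) ((f t + g t) ^+ 2) =
    \int[mu]_(t in D) (f t ^+ 2) + 2 * \int[mu]_(t in D) (f t * g t) +
    \int[mu]_(t in D) (g t ^+ 2).
  rewrite -rintegralZ // -rintegralD //; last exact: rintZ.
  rewrite -rintegralD //; last by apply: rintD => //; exact: rintZ.
  by apply: eq_Rintegral => t _; ring.
by rewrite lerD2r lerD2l mulr2n; have := n2_CS Sf Sg; lra.
Qed.

Lemma n2Z (a : R) g : sq_int g -> n2 (fun t => a * g t) = `|a| * n2 g.
Proof.
move=> [_ ig]; rewrite /n2 -[`|a|]sqrtr_sqr -sqrtrM ?sqr_ge0 //; congr Num.sqrt.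
by rewrite -rintegralZ //; apply: eq_Rintegral => t _; rewrite exprMn.
Qed.

Lemma L2nrmE g : sq_int g -> L2nrm g = (n2 g)%:E.
Proof. by move=> [_ ig]; rewrite /L2nrm rintE. Qed.

End SquareNorm.

(** * The distance to H^2 in L^2(S_1) as a sublinear functional *)

Section QuotientNorm.
Variable R : realType.
Local Notation C := (R[i]).
Local Notation mu := (@lebesgue_measure R).
Local Notation D := (@Tdom R : set (measurableTypeR R)).
Local Notation L2m := (entrywise (@Lp R 2)).
Local Notation Mm := (entrywise (@cmeas R)).
Local Notation H2m := (entrywise (@Hp R 2)).
Local Notation H20m := (entrywise (@Hp0 R 2)).

Lemma sq_int_hs m n (F : R -> 'M[C]_(m, n)) (c : R) : L2m F ->
  sq_int (fun t => c * Num.sqrt (nrm2 (F t))).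
Proof.
move=> LF; have mF := L2m_meas LF; split.
  by apply: measurable_funM; [exact: measurable_cst|apply: meas_sqrt; exact: meas_nrm2].
have := rintZ (c ^+ 2) (rint_nrm2 LF).
apply: eq_integrable => [|t _ /=]; first exact: measurable_Tdom.
by rewrite exprMn sqr_sqrtr // nrm2_ge0.
Qed.

Lemma sq_int_trnorm m n (F : R -> 'M[C]_(m, n)) : L2m F -> sq_int (fun t => trnorm (F t)).
Proof.
move=> LF; apply: (sq_int_le _ (sq_int_hs m%:R LF)).
  by apply: meas_trnorm; exact: L2m_meas.
by move=> t _; rewrite ger0_norm ?trnorm_ge0 // trnorm_le_hs.
Qed.

Lemma sq_int_opnorm m n (F : R -> 'M[C]_(m, n)) : L2m F -> sq_int (fun t => opnorm (F t)).
Proof.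
move=> LF; apply: (sq_int_le _ (sq_int_hs 1 LF)).
  by apply: meas_opnorm; exact: L2m_meas.
by move=> t _; rewrite ger0_norm ?opnorm_ge0 // mul1r opnorm_le_hs.
Qed.

Definition s1 m n (F : R -> 'M[C]_(m, n)) : R := n2 (fun t => trnorm (F t)).
Definition sop m n (F : R -> 'M[C]_(m, n)) : R := n2 (fun t => opnorm (F t)).

Lemma L2ME m n (F : R -> 'M[C]_(m, n)) : L2m F -> L2M F = (sop F)%:E.
Proof. by move=> LF; apply: L2nrmE; exact: sq_int_opnorm. Qed.

Lemma s1D m n (F G : R -> 'M[C]_(m, n)) : L2m F -> L2m G -> s1 (F + G) <= s1 F + s1 G.
Proof.
move=> LF LG; have SF := sq_int_trnorm LF; have SG := sq_int_trnorm LG.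
apply: le_trans (n2D SF SG); apply: n2_le.
- by apply: sq_int_trnorm; exact: L2mD.
- exact: sq_intD.
- apply: aeT => t _; rewrite ger0_norm ?trnorm_ge0 //.
  by apply: le_trans (trnormD _ _) _; exact: ler_norm.
Qed.

Lemma s1Z m n (c : C) (F : R -> 'M[C]_(m, n)) : L2m F -> s1 (c *: F) <= cabs c * s1 F.
Proof.
move=> LF; have SF := sq_int_trnorm LF.
rewrite -[cabs c]ger0_norm ?cabs_ge0 // -n2Z //; apply: n2_le.
- by apply: sq_int_trnorm; exact: L2mZ.
- have [m1 i1] := sq_int_trnorm LF; split.
    by apply: measurable_funM => //; exact: measurable_cst.
  have := rintZ (cabs c ^+ 2) i1; apply: eq_integrable => [|t _ /=]; first exact: measurable_Tdom.
  by rewrite exprMn.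
- apply: aeT => t _; rewrite ger0_norm ?trnorm_ge0 //.
  by apply: le_trans (trnorm_leZ _ _) _; exact: ler_norm.
Qed.

(** Makes a functional dominated by [s1] continuous for the Hilbert-Schmidt inner product, as the
    Riesz theorem requires. *)
Lemma s1_hs m n (F : R -> 'M[C]_(m, n)) : L2m F -> s1 F ^+ 2 <= m%:R ^+ 2 * rip F F.
Proof.
move=> LF; rewrite sqr_n2 rip_self -rintegralZ; last exact: rint_nrm2.
apply: le_rint; [by case: (sq_int_trnorm LF)|by apply: rintZ; exact: rint_nrm2|] => t _.
by rewrite -[nrm2 _]sqr_sqrtr ?nrm2_ge0 // -exprMn ler_sqr ?nnegrE ?trnorm_ge0 ?trnorm_le_hs ?mulr_ge0 ?sqrtr_ge0.
Qed.

Lemma H2m_L2m m n (F : R -> 'M[C]_(m, n)) : H2m F -> L2m F.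
Proof. by move=> H i j; case: (H i j). Qed.

Lemma H20m_L2m m n (F : R -> 'M[C]_(m, n)) : H20m F -> L2m F.
Proof. by move=> H i j; case: (H i j) => -[]. Qed.

Lemma Hp_comb p (a b : C) (f g : R -> C) : Lp p (fun t => a * f t + b * g t) ->
  Lp 1 f -> Lp 1 g -> Hp p f -> Hp p g -> Hp p (fun t => a * f t + b * g t).
Proof.
move=> L Lf Lg Hf Hg; apply: Hp_intro => // l l0.
have -> : (fun t => (a * f t + b * g t) * ek l t) =
    (fun t => a * (f t * ek l t) + b * (g t * ek l t)).
  by apply/funext => t; rewrite mulrDl !mulrA.
have L1f := L1_ek l Lf; have L1g := L1_ek l Lg.
rewrite cintD; [|exact: L1Z|exact: L1Z].
by rewrite (cintZ a L1f) (cintZ b L1g) (Hp_coef Hf l0) (Hp_coef Hg l0) !mulr0 addr0.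
Qed.

Lemma H2mD m n (F G : R -> 'M[C]_(m, n)) : H2m F -> H2m G -> H2m (F + G).
Proof.
move=> HF HG i j; have Lf := (HF i j).1; have Lg := (HG i j).1.
have -> : (fun t => (F + G) t i j) = (fun t => 1 * F t i j + 1 * G t i j).
  by apply/funext => t; rewrite mxE !mul1r.
apply: Hp_comb; [|exact: L2_L1|exact: L2_L1|exact: HF|exact: HG].
by apply: L2D; exact: L2Z.
Qed.

Lemma H2mZ m n (c : C) (F : R -> 'M[C]_(m, n)) : H2m F -> H2m (c *: F).
Proof.
move=> HF i j; have Lf := (HF i j).1.
have -> : (fun t => (c *: F) t i j) = (fun t => c * F t i j + 0 * F t i j).
  by apply/funext => t; rewrite mxE mul0r addr0.
apply: Hp_comb; [|exact: L2_L1|exact: L2_L1|exact: HF|exact: HF].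
by apply: L2D; exact: L2Z.
Qed.

Lemma H2_cst (z : C) : Hp 2 (fun=> z).
Proof.
apply: Hp_intro => [|l l0]; first exact: L2_cst.
have Le : Lp 1 (@ek R l) by apply: L2_L1; exact: L2_ek1.
by rewrite (cintZ z Le) cint_ek ?mulr0 // gt_eqF.
Qed.

Lemma H2m0 m n : H2m (0 : R -> 'M[C]_(m, n)).
Proof.
move=> i j; have -> : (fun t => (0 : R -> 'M[C]_(m, n)) t i j) = (fun=> 0).
  by apply/funext => t; rewrite mxE.
exact: H2_cst.
Qed.

Section Quotient.
Variables m k : nat.
Implicit Types X F : R -> 'M[C]_(m, k).

Definition pq X : R := inf [set s1 (X - F) | F in [set F | H2m F]].

Let pq_has_inf X : has_inf [set s1 (X - F) | F in [set F | H2m F]].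
Proof.
split; first by exists (s1 (X - 0)); exists 0 => //; exact: H2m0.
by exists 0 => _ [F _ <-]; exact: n2_ge0.
Qed.

Lemma pq_le X F : H2m F -> pq X <= s1 (X - F).
Proof. by move=> HF; apply: ge_inf; [case: (pq_has_inf X)|exists F]. Qed.

Lemma le_pq X c : (forall F, H2m F -> c <= s1 (X - F)) -> c <= pq X.
Proof.
move=> H; apply: lb_le_inf; first by case: (pq_has_inf X).
by move=> _ [F HF <-]; exact: H.
Qed.

Lemma pq_ge0 X : 0 <= pq X.
Proof. by apply: le_pq => F _; exact: n2_ge0. Qed.

Lemma qnormE X : L2m X -> qnorm X = (pq X)%:E.
Proof.
move=> LX; rewrite /qnorm /pq.
have -> : [set L2S1 (fun t => X t - F t) | F in [set F | entrywise (Hp 2) F]] =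
    EFin @` [set s1 (X - F) | F in [set F | H2m F]].
  have E F : H2m F -> L2S1 (fun t => X t - F t) = (s1 (X - F))%:E.
    move=> HF; apply: L2nrmE; apply: (sq_int_trnorm (F := X - F)).
    by apply: L2mB => //; exact: H2m_L2m.
  apply/seteqP; split => [_ [F HF <-]|_ [_ [F HF <-] <-]] /=.
    by exists (s1 (X - F)); [exists F|rewrite E].
  by exists F => //; rewrite E.
have [H1 H2] := pq_has_inf X.
by rewrite ereal_inf_EFin.
Qed.

Lemma pq_le_s1 X : pq X <= s1 X.
Proof. by have := pq_le X (@H2m0 m k); rewrite subr0. Qed.

Lemma pqZ_le X (a : R) : 0 <= a -> L2m X -> pq (a%:C%C *: X) <= a * pq X.
Proof.
move=> a0 LX.
have H F : H2m F -> pq (a%:C%C *: X) <= a * s1 (X - F).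
  move=> HF; apply: le_trans (pq_le _ (H2mZ a%:C%C HF)) _.
  have -> : a%:C%C *: X - a%:C%C *: F = a%:C%C *: (X - F) by rewrite scalerBr.
  apply: le_trans (s1Z _ (L2mB LX (H2m_L2m HF))) _.
  by rewrite cabsr ger0_norm.
have [a00|an0] := eqVneq a 0.
  by have := H 0 (@H2m0 m k); rewrite a00 !mul0r.
have ap : 0 < a by rewrite lt_neqAle eq_sym an0.
by rewrite -ler_pdivrMl //; apply: le_pq => F HF; rewrite ler_pdivrMl // H.
Qed.

Lemma pq_sublinear : sublinear (L2m : (R -> 'M[C]_(m, k)) -> Prop) pq.
Proof.
split => [X Y LX LY|a X a0 LX]; last exact: pqZ_le.
rewrite -lerBlDr; apply: le_pq => F HF; rewrite lerBlDr -lerBlDl.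
apply: le_pq => G HG; rewrite lerBlDl.
apply: le_trans (pq_le _ (H2mD HF HG)) _.
have -> : X + Y - (F + G) = (X - F) + (Y - G) by rewrite opprD addrACA.
by apply: s1D; apply: L2mB => //; exact: H2m_L2m.
Qed.

End Quotient.

Lemma cint_tr_H20 m k (F : R -> 'M[C]_(m, k)) (G : R -> 'M[C]_(k, m)) : H2m F -> H20m G ->
  cint (fun t => \tr (F t *m G t)) = 0.
Proof.
move=> HF HG.
have L1FG i j : Lp 1 (fun t => F t i j * G t j i).
  by apply: L2_mul; [case: (HF i j)|case: (HG j i) => -[]].
have -> : (fun t => \tr (F t *m G t)) = (fun t => \sum_i \sum_j F t i j * G t j i).
  by apply/funext => t; apply: eq_bigr => i _; rewrite mxE.
rewrite cint_sum; last by move=> i; exact: L1_sum.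
apply: big1 => i _; rewrite cint_sum //; apply: big1 => j _.
have := Hp0_coef (H2_mul_H20 (HF i j) (HG j i)) (lexx 0).
by under [fun t => _ * ek 0 t]funext => t do rewrite ek0 mulr1.
Qed.

(** The easy half of the duality: subtracting an element of H^2 from [X] does not change the
    integral, and the trace inequality applies to the difference. *)
Lemma pairing_le m k (X : R -> 'M[C]_(m, k)) (G : R -> 'M[C]_(k, m)) : L2m X -> H20m G ->
  cabs (cint (fun t => \tr (X t *m G t))) <= pq X * sop G.
Proof.
move=> LX HG; have LG := H20m_L2m HG.
have H F : H2m F -> cabs (cint (fun t => \tr (X t *m G t))) <= s1 (X - F) * sop G.
  move=> HF; have LF := H2m_L2m HF; have LXF := L2mB LX LF.
  have -> : cint (fun t => \tr (X t *m G t)) = cint (fun t => \tr ((X - F) t *m G t)).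
    rewrite -[LHS]subr0 -(cint_tr_H20 HF HG) -cintB; [|by apply: L1_tr; exact: L1mM..].
    by congr cint; apply/funext => t; rewrite mulmxBl linearB.
  have S1 := sq_int_trnorm LXF; have S2 := sq_int_opnorm LG.
  apply: le_trans (n2_CS S1 S2); apply: cabs_cint_le.
  - by apply: L1_tr; exact: L1mM.
  - exact: sq_int_mul.
  - by apply: aeT => t _; exact: tr_le_trnorm.
have [g0|g0] := eqVneq (sop G) 0.
  by have := H 0 (@H2m0 m k); rewrite g0 !mulr0.
have gp : 0 < sop G by rewrite lt_neqAle eq_sym g0 n2_ge0.
by rewrite -ler_pdivrMr //; apply: le_pq => F HF; rewrite ler_pdivrMr // H.
Qed.

End QuotientNorm.

(** * Duality for the quotient norm *)

Section DualMatrices.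
Variable R : realType.
Local Notation C := (R[i]).
Local Notation mu := (@lebesgue_measure R).
Local Notation D := (@Tdom R : set (measurableTypeR R)).
Local Notation L2m := (entrywise (@Lp R 2)).
Local Notation Mm := (entrywise (@cmeas R)).

(** [B] is [v] times the adjoint of [u = A *m v], divided by [vnorm u] (and zero if [u] is). Hence
    rank-one matrices already norm [A] in the duality between operator and trace norm. *)
Lemma rank1_dual m n (A : 'M[C]_(m, n)) (v : 'cV[C]_n) : vnorm v <= 1 ->
  exists B : 'M[C]_(n, m), [/\ trnorm B <= 1, opnorm B <= 1 & \tr (A *m B) = (vnorm (A *m v))%:C%C].
Proof.
move=> v1; set u := A *m v; have u0 := vnorm_ge0 u.
exists ((vnorm u)^-1%:C%C *: (v *m star u)).
have H : (vnorm u)^-1 * (vnorm v * vnorm u) <= 1.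
  have [->|un0] := eqVneq (vnorm u) 0; first by rewrite !mulr0.
  by rewrite mulrCA mulVf // mulr1.
have c0 : 0 <= (vnorm u)^-1 by rewrite invr_ge0.
split.
- apply: le_trans (trnorm_leZ _ _) _; rewrite cabsr ger0_norm //.
  by apply: le_trans H; apply: ler_wpM2l => //; exact: trnorm_rank1.
- rewrite opnormZ cabsr ger0_norm //.
  by apply: le_trans H; apply: ler_wpM2l => //; exact: opnorm_rank1.
- rewrite -scalemxAr linearZ /= mulmxA -/u -nrm2E -sqr_vnorm -rmorphM expr2.
  have [->|un0] := eqVneq (vnorm u) 0; first by rewrite !mulr0.
  by rewrite mulrA mulVf // mul1r.
Qed.

Lemma opnorm_le_trnorm m n (A : 'M[C]_(m, n)) : opnorm A <= trnorm A.
Proof.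
apply: sup_le_ub => [|_ [v v1 <-]].
  by case: (opnorm_has_sup A).
have [B [_ B1 E]] := rank1_dual A v1.
have := tr_le_trnorm A B; rewrite E cabsr ger0_norm ?vnorm_ge0 // => H.
by apply: le_trans H _; rewrite ler_piMr // trnorm_ge0.
Qed.

Lemma opnorm_adherent m n (A : 'M[C]_(m, n)) (e : R) : 0 < e ->
  exists2 v, vnorm v <= 1 & opnorm A - e < vnorm (A *m v).
Proof.
by move=> e0; have [_ [v v1 <-] hv] := sup_adherent e0 (opnorm_has_sup A); exists v.
Qed.

Local Opaque trnorm opnorm ratmx_seq.

(** Terms outside the unit ball are replaced by 0, so that every index can be used in the greedy
    search. *)
Definition ball_seq m n (q : nat) : 'M[C]_(m, n) :=
  if trnorm (ratmx_seq R m n q) <= 1 then ratmx_seq R m n q else 0.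

Lemma trnorm0 m n : trnorm (0 : 'M[C]_(m, n)) = 0.
Proof.
have H : trnorm (0 : 'M[C]_(m, n)) <= 0.
  apply: le_trans (trnorm_le_opnorm _) _.
  have /eqP -> : opnorm (0 : 'M[C]_(m, n)) == 0 by rewrite opnorm_eq0.
  by rewrite mulr0.
by apply/eqP; rewrite eq_le trnorm_ge0 H.
Qed.

Lemma trnorm_ball_seq m n q : trnorm (ball_seq m n q) <= 1.
Proof.
have H (b : bool) (Q : 'M[C]_(m, n)) : (b -> trnorm Q <= 1) -> trnorm (if b then Q else 0) <= 1.
  by case: b => [h|_]; [exact: h|rewrite trnorm0 ler01].
exact: H.
Qed.

Lemma trnormN m n (A : 'M[C]_(m, n)) : trnorm (- A) <= trnorm A.
Proof.
have E : (-1)%:C%C *: A = - A by rewrite raddfN /= scaleNr scale1r.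
rewrite -E.
apply: le_trans (trnorm_leZ (-1)%:C%C A) _.
by rewrite cabsr normrN1 mul1r.
Qed.

Lemma Re_tr_le m n (A : 'M[C]_(m, n)) (B : 'M[C]_(n, m)) :
  complex.Re (\tr (A *m B)) <= trnorm A * opnorm B.
Proof.
by apply: le_trans (tr_le_trnorm A B); apply: le_trans (le_Re_cabs _); exact: ler_norm.
Qed.

(** A rank-one near-maximizer of trace norm up to 1 is first shrunk, so that its rational
    approximation stays in the ball. *)
Lemma ball_seq_dense m n (A : 'M[C]_(m, n)) (e : R) : 0 < e ->
  exists q, opnorm A - e <= complex.Re (\tr (ball_seq n m q *m A)).
Proof.
move=> e0; set N := opnorm A; have N0 : 0 <= N by exact: opnorm_ge0.
have e20 : 0 < e / 2 by rewrite divr_gt0.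
have [v v1 hv] := opnorm_adherent A e20; rewrite -/N in hv.
have [B [B1 _ EB]] := rank1_dual A v1.
have {EB} EB : complex.Re (\tr (B *m A)) = vnorm (A *m v) by rewrite mxtrace_mulC EB.
have BN : complex.Re (\tr (B *m A)) <= N.
  by apply: le_trans (Re_tr_le B A) _; rewrite ler_piMl.
set n1 : R := n%:R; have n10 : 0 <= n1 by exact: ler0n.
(* Shrinking and approximating each lose at most [n1 * d * N]; the additional [N + 1] keeps [K]
   positive. *)
set K := 2 * n1 * N + N + 1.
have K0 : 0 < K by rewrite /K; nra.
(* the slack [n1 * d] absorbs the trace norm of the approximation error *)
pose d := Num.min (n1 + 1)^-1 (e / 2 / K).
have d0 : 0 < d by rewrite /d lt_min invr_gt0 divr_gt0 // andbT; lra.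
have d1 : n1 * d <= 1.
  have : d <= (n1 + 1)^-1 by rewrite /d ge_min lexx.
  rewrite -[X in _ -> _ <= X](@mulfV _ (n1 + 1)); last by lra.
  move=> h; apply: (@le_trans _ _ ((n1 + 1) * d)).
    by rewrite ler_wpM2r //; [exact: ltW|lra].
  by rewrite ler_wpM2l //; lra.
have d2 : d * K <= e / 2 by rewrite -ler_pdivlMr // /d ge_min lexx orbT.
set c := 1 - n1 * d; have c0 : 0 <= c by rewrite /c; lra.
have [q hq] := ratmx_dense (c%:C%C *: B) d0; exists q.
set Q := ratmx_seq R n m q in hq; set E := c%:C%C *: B - Q in hq.
have tE : trnorm E <= n1 * d.
  by apply: le_trans (trnorm_le_hs _) _; rewrite ler_wpM2l.
have EQ : Q = c%:C%C *: B + - E by rewrite /E opprB addrC subrK.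
have tQ : trnorm Q <= 1.
  rewrite EQ; apply: le_trans (trnormD _ _) _.
  have := trnorm_leZ c%:C%C B; rewrite cabsr ger0_norm // => h.
  have h2 : c * trnorm B <= c by rewrite ler_piMr.
  apply: le_trans (lerD h (trnormN E)) _; apply: le_trans (lerD h2 tE) _.
  by rewrite /c subrK.
have -> : ball_seq n m q = Q by rewrite /ball_seq -/Q tQ.
rewrite EQ mulmxDl linearD ReD -scalemxAl linearZ /=.
have -> : complex.Re (c%:C%C * \tr (B *m A)) = c * complex.Re (\tr (B *m A)).
  by rewrite ReM /= mul0r subr0.
have h3 : complex.Re (\tr (E *m A)) <= n1 * d * N.
  by apply: le_trans (Re_tr_le _ _) _; rewrite ler_wpM2r.
rewrite mulNmx linearN /= ReN.
set z := complex.Re (\tr (E *m A)) in h3 *; set b := complex.Re _ in EB BN *.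
rewrite -EB in hv; rewrite /K in d2; rewrite /c.
clear tE tQ EQ EB; clearbody z b N n1.
have h4 : n1 * d * b <= n1 * d * N by rewrite ler_wpM2l // mulr_ge0 // ltW.
have h5 : d * (2 * n1 * N) <= e / 2.
  by apply: le_trans d2; apply: ler_wpM2l; [exact: ltW|rewrite -addrA lerDl; lra].
by rewrite mulrBl mul1r; lra.
Qed.

End DualMatrices.

(** * Measurable choice of norming matrices *)

Section Greedy.
Variable R : realType.
Local Notation C := (R[i]).
Local Notation mu := (@lebesgue_measure R).
Local Notation D := (@Tdom R : set (measurableTypeR R)).
Local Notation L2m := (entrywise (@Lp R 2)).
Local Notation Mm := (entrywise (@cmeas R)).

Local Opaque trnorm opnorm ratmx_seq ball_seq.

Section Pointwise.
Variables m n : nat.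
Implicit Type A : 'M[C]_(n, m).

Let v A q : R := complex.Re (\tr (ball_seq R m n q *m A)).

(* A measurable near-maximizer of [Re (tr (X A))] over the unit ball of the trace norm,
   scaled by the value it achieves. *)
Fixpoint greedy A (N : nat) : R * 'M[C]_(m, n) :=
  if N is q.+1 then
    if (greedy A q).1 < v A q then (v A q, (v A q)%:C%C *: ball_seq R m n q) else greedy A q
  else (0, 0).

Lemma greedyP A N : [/\ 0 <= (greedy A N).1, trnorm (greedy A N).2 <= (greedy A N).1,
  complex.Re (\tr ((greedy A N).2 *m A)) = (greedy A N).1 ^+ 2,
  (greedy A N).1 <= opnorm A &
  forall q, (q < N)%N -> v A q <= (greedy A N).1].
Proof.
elim: N => [|N [H0 H1 H2 H3 H4]] /=.
  split; [exact: lexx|by rewrite trnorm0 lexx|by rewrite mul0mx linear0 expr2 mulr0|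
    exact: opnorm_ge0|by []].
have E : ((greedy A N).1 < v A N) \/ (v A N <= (greedy A N).1).
  by case: (ltP (greedy A N).1 (v A N)); [left|right].
case: E => h; last first.
  rewrite ltNge h /=; split; [exact: H0|exact: H1|exact: H2|exact: H3|] => q.
  by rewrite ltnS leq_eqVlt => /orP[/eqP ->|]; [exact: h|exact: H4].
rewrite h /=; have v0 : 0 <= v A N by apply: le_trans H0 _; exact: ltW.
split; [exact: v0| | | |].
- apply: le_trans (trnorm_leZ _ _) _; rewrite cabsr ger0_norm //.
  by rewrite ler_piMr //; exact: trnorm_ball_seq.
- by rewrite -scalemxAl linearZ /= ReM /= mul0r subr0 expr2.
- apply: le_trans (Re_tr_le _ _) _; rewrite ler_piMl //; first exact: opnorm_ge0.
  exact: trnorm_ball_seq.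
- move=> q; rewrite ltnS leq_eqVlt => /orP[/eqP ->|qN]; first exact: lexx.
  by apply: le_trans (ltW h); exact: H4.
Qed.

Lemma greedy_cvg A : (greedy A N).1 @[N --> \oo] --> opnorm A.
Proof.
apply/cvgrPdist_le => e e0; have [q hq] := ball_seq_dense A e0.
exists q.+1 => // N /= qN; have [_ _ _ H3 H4] := greedyP A N.
rewrite ger0_norm ?subr_ge0 // lerBlDl -lerBlDr.
by apply: le_trans hq _; exact: H4.
Qed.

End Pointwise.

Lemma meas_ifC (b : R -> bool) (f g : R -> R) : measurable_fun D b ->
  measurable_fun D f -> measurable_fun D g -> measurable_fun D (fun t => if b t then f t else g t).
Proof.
move=> mb mf mg; apply: measurable_fun_if => //; first exact: measurable_Tdom.
- by apply: measurable_funS mf; [exact: measurable_Tdom|exact: subIsetl].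
- by apply: measurable_funS mg; [exact: measurable_Tdom|exact: subIsetl].
Qed.

Lemma meas_greedy m n (G : R -> 'M[C]_(n, m)) N : Mm G ->
  measurable_fun D (fun t => (greedy (G t) N).1) /\ Mm (fun t => (greedy (G t) N).2).
Proof.
move=> mG; elim: N => [|N [IH1 IH2]] /=.
  by split; [exact: measurable_cst|exact: Mm_cst].
have mv : measurable_fun D (fun t => complex.Re (\tr (ball_seq R m n N *m G t))).
  have H : cmeas (fun t => \tr (ball_seq R m n N *m G t)).
    by apply: cmeas_sum => i; apply: (MmM (Mm_cst _) mG).
  by case: H.
have mb := measurable_fun_ltr IH1 mv.
split.
  have -> : (fun t => (if (greedy (G t) N).1 < complex.Re (\tr (ball_seq R m n N *m G t)) then
      (complex.Re (\tr (ball_seq R m n N *m G t)),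
       (complex.Re (\tr (ball_seq R m n N *m G t)))%:C%C *: ball_seq R m n N) else greedy (G t) N).1)
    = (fun t => if (greedy (G t) N).1 < complex.Re (\tr (ball_seq R m n N *m G t)) then
        complex.Re (\tr (ball_seq R m n N *m G t)) else (greedy (G t) N).1).
    by apply/funext => t; case: (_ < _).
  exact: meas_ifC.
have m2 := MmZ (cmeas_real mv) (Mm_cst (ball_seq R m n N)).
move=> i j; have [a1 a2] := m2 i j; have [b1 b2] := IH2 i j.
split.
- rewrite [X in measurable_fun _ X](_ : _ = (fun t =>
    if (greedy (G t) N).1 < complex.Re (\tr (ball_seq R m n N *m G t)) then
      complex.Re (((complex.Re (\tr (ball_seq R m n N *m G t)))%:C%C *: ball_seq R m n N) i j)
    else complex.Re ((greedy (G t) N).2 i j))); last by apply/funext => t; case: (_ < _).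
  exact: meas_ifC.
- rewrite [X in measurable_fun _ X](_ : _ = (fun t =>
    if (greedy (G t) N).1 < complex.Re (\tr (ball_seq R m n N *m G t)) then
      complex.Im (((complex.Re (\tr (ball_seq R m n N *m G t)))%:C%C *: ball_seq R m n N) i j)
    else complex.Im ((greedy (G t) N).2 i j))); last by apply/funext => t; case: (_ < _).
  exact: meas_ifC.
Qed.

(** The greedy matrix has trace norm at most its value [g] and pairs with [G] to [g^2]. Testing on
    it bounds the integral of [g^2] by its own square root, hence by 1. As the search goes on, [g]
    tends to [opnorm (G t)], and dominated convergence concludes. *)
Lemma sop_le1 m n (G : R -> 'M[C]_(n, m)) : L2m G ->
  (forall X : R -> 'M[C]_(m, n), L2m X ->
    complex.Re (cint (fun t => \tr (X t *m G t))) <= s1 X) ->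
  sop G <= 1.
Proof.
move=> LG H; have mG := L2m_meas LG.
pose g N t := (greedy (G t) N).1; pose X N t := (greedy (G t) N).2.
have mg N : measurable_fun D (g N) by have [] := meas_greedy N mG.
have mX N : Mm (X N) by have [] := meas_greedy N mG.
have g0 N t : 0 <= g N t by have [] := greedyP (G t) N.
have Xg N t : trnorm (X N t) <= g N t by have [] := greedyP (G t) N.
have gG N t : g N t <= opnorm (G t) by have [] := greedyP (G t) N.
have XG N t : complex.Re (\tr (X N t *m G t)) = g N t ^+ 2 by have [] := greedyP (G t) N.
have SG := sq_int_opnorm LG.
have Sg N : sq_int (g N) by apply: (sq_int_le (mg N) SG) => t _; rewrite ger0_norm.
have LX N : L2m (X N).
  have ih : rint (fun t => n%:R * opnorm (G t) ^+ 2) by apply: rintZ; case: SG.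
  apply: (L2m_le_ae (mX N) ih); apply: aeT => t _.
  apply: le_trans (nrm2_le_opnorm _) _; apply: ler_wpM2l; first exact: ler0n.
  rewrite ler_sqr ?nnegrE ?opnorm_ge0 //.
  by apply: le_trans (opnorm_le_trnorm _) _; apply: le_trans (Xg N t) _.
have g1 N : \int[mu]_(t in D) (g N t ^+ 2) <= 1.
  have E : \int[mu]_(t in D) (g N t ^+ 2) <= n2 (g N).
    have -> : \int[mu]_(t in D) (g N t ^+ 2) = complex.Re (cint (fun t => \tr (X N t *m G t))).
      by rewrite Re_cint; apply: eq_Rintegral => t _; rewrite XG.
    apply: le_trans (H _ (LX N)) _; apply: n2_le.
    - exact: sq_int_trnorm.
    - exact: Sg.
    - by apply: aeT => t _; rewrite !ger0_norm ?trnorm_ge0.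
  rewrite -sqr_n2 in E *; have := n2_ge0 (g N); move: (n2 (g N)) E => a; nra.
have cv : \int[mu]_(t in D) (g N t ^+ 2) @[N --> \oo] --> \int[mu]_(t in D) (opnorm (G t) ^+ 2).
  apply: (@rint_lim R (fun N t => g N t ^+ 2) _ (fun t => opnorm (G t) ^+ 2)).
  - by move=> N; apply: measurable_funX; exact: mg.
  - by apply: measurable_funX; case: SG.
  - by case: SG.
  - by move=> N t _; rewrite ger0_norm ?sqr_ge0 // ler_sqr ?nnegrE ?opnorm_ge0.
  - move=> t _; have c := @greedy_cvg _ _ (G t).
    by under eq_fun do rewrite expr2; rewrite expr2; exact: (cvgM c c).
have I1 : \int[mu]_(t in D) (opnorm (G t) ^+ 2) <= 1.
  move/cvg_lim : (cv) => <- //; apply: limr_le; first by apply/cvg_ex; eexists; exact: cv.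
  exact: nearW.
by rewrite /sop /n2 -[leRHS]sqrtr1 ler_wsqrtr.
Qed.

End Greedy.

(** * Attainment in the dual description of the distance *)

Section Duality.
Variable R : realType.
Local Notation C := (R[i]).
Local Notation mu := (@lebesgue_measure R).
Local Notation D := (@Tdom R : set (measurableTypeR R)).
Local Notation L2m := (entrywise (@Lp R 2)).
Local Notation H2m := (entrywise (@Hp R 2)).
Local Notation H20m := (entrywise (@Hp0 R 2)).

Local Opaque trnorm opnorm.

Variables m k : nat.

Lemma pq_H2m (F : R -> 'M[C]_(m, k)) : H2m F -> pq F <= 0.
Proof.
move=> HF; apply: le_trans (pq_le F HF) _; rewrite subrr /s1 /n2.
have -> : (fun t => trnorm ((0 : R -> 'M[C]_(m, k)) t) ^+ 2) = cst 0.
  by apply/funext => t; rewrite trnorm0 expr2 mulr0.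
by rewrite rintegral_cst sqrtr0.
Qed.

Lemma H20m_annih (G : R -> 'M[C]_(k, m)) : L2m G ->
  (forall F : R -> 'M[C]_(m, k), H2m F -> cint (fun t => \tr (F t *m G t)) = 0) -> H20m G.
Proof.
move=> LG H j i; apply: Hp0_intro; first exact: LG.
move=> l l0.
(* Testing on z^l times a matrix unit isolates one Fourier coefficient of one entry of [G]. *)
pose F : R -> 'M[C]_(m, k) := fun t => ek l t *: delta_mx i j.
have HF : H2m F.
  move=> a b; set c : C := (delta_mx i j : 'M[C]_(m, k)) a b.
  have E : (fun t => F t a b) = (fun t => c * ek l t).
    by apply/funext => t; rewrite mxE mulrC.
  rewrite E; apply: Hp_intro => [|l' l'0]; first by apply: L2Z; exact: L2_ek1.
  have -> : (fun t => c * ek l t * ek l' t) = (fun t => c * ek (l + l') t).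
    by apply/funext => t; rewrite ekD mulrA.
  have L1e : Lp 1 (@ek R (l + l')) by apply: L2_L1; exact: L2_ek1.
  by rewrite (cintZ c L1e) cint_ek ?mulr0 // gt_eqF // ltr_wpDl.
rewrite -[RHS](H F HF); congr cint; apply/funext => t.
rewrite -scalemxAl linearZ /= mulrC; congr (_ * _).
rewrite /mxtrace (bigD1 i) //= big1 => [|a ai]; last first.
  by rewrite mxE big1 // => b _; rewrite mxE (negPf ai) mul0r.
rewrite addr0 mxE (bigD1 j) //= big1 => [|b bj]; last by rewrite mxE (negPf bj) andbF mul0r.
by rewrite mxE !eqxx mul1r addr0.
Qed.

(** Domination by [pq] carries both properties of [G]: [pq] is at most 0 on H^2, so the functional
    vanishes there, and [pq <= s1] gives the norm bound. *)
Theorem pq_attain (X0 : R -> 'M[C]_(m, k)) : L2m X0 ->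
  exists G : R -> 'M[C]_(k, m), [/\ H20m G, sop G <= 1 &
    complex.Re (cint (fun t => \tr (X0 t *m G t))) = pq X0].
Proof.
move=> LX0.
have SD (x y : R -> 'M[C]_(m, k)) : L2m x -> L2m y -> L2m (x + y) by exact: L2mD.
have SZ (a : R) (x : R -> 'M[C]_(m, k)) : L2m x -> L2m (a%:C%C *: x) by exact: L2mZ.
have [l [lD lZ lp lX0]] := hahn_banach SD SZ (@pq_sublinear R m k) LX0.
have l_le X : L2m X -> `|l X| <= s1 X.
  move=> LX; rewrite ler_norml lerNl; apply/andP; split; last first.
    by apply: le_trans (lp _ LX) _; exact: pq_le_s1.
  have -> : - l X = l ((-1)%:C%C *: X) by rewrite lZ // mulN1r.
  apply: le_trans (lp _ (SZ (-1) X LX)) _; apply: le_trans (pq_le_s1 _) _.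
  by apply: le_trans (s1Z _ LX) _; rewrite cabsr normrN1 mul1r.
(* The complement of the empty set is the whole of L^2. *)
have [|||||g [Lg _] lg] := @perp_riesz R m k set0 _ l (m%:R ^+ 2).
- by [].
- by move=> x y [Lx _] [Ly _]; exact: lD.
- by move=> a x [Lx _]; exact: lZ.
- exact: sqr_ge0.
- move=> x [Lx _]; apply: le_trans (s1_hs Lx); rewrite -[leLHS]real_normK ?num_real //.
  by rewrite ler_sqr ?nnegrE ?n2_ge0 // l_le.
pose G t := star (g t).
have LG : L2m G by exact: L2m_star.
have lE X : L2m X -> l X = complex.Re (cint (fun t => \tr (X t *m G t))).
  move=> LX; have PX : perp set0 X by split.
  by rewrite (lg X PX) ripC rip_cip cipE.
exists G; split; last by rewrite -lE.
- apply: H20m_annih => // F HF.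
  (* The functional [l] sees real parts only; since H^2 is a complex space, [F] can be rotated until
     the integral is its modulus. *)
  set z := cint _; have [c c1 cz] := phase z.
  apply/eqP; rewrite -cabs_eq0 eq_le cabs_ge0 andbT -cz.
  have HcF := H2mZ c HF; have LcF := H2m_L2m HcF.
  have -> : complex.Re (c * z) = l (c *: F).
    rewrite lE // /z -cintZ; last by apply: L1_tr; apply: L1mM => //; exact: H2m_L2m.
    congr (complex.Re (cint _)); apply/funext => t.
    by rewrite -scalemxAl linearZ.
  by apply: le_trans (lp _ LcF) _; exact: pq_H2m.
- apply: sop_le1 => // X LX; rewrite -lE //.
  by apply: le_trans (ler_norm _) _; exact: l_le.
Qed.

End Duality.

(** * Extremal functions and maximizing vectors *)

Section Extremal.
Variable R : realType.
Local Notation C := (R[i]).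
Local Notation mu := (@lebesgue_measure R).
Local Notation D := (@Tdom R : set (measurableTypeR R)).
Local Notation L2m := (entrywise (@Lp R 2)).
Local Notation Mm := (entrywise (@cmeas R)).
Local Notation H2m := (entrywise (@Hp R 2)).
Local Notation H20m := (entrywise (@Hp0 R 2)).

Local Opaque trnorm opnorm.

Lemma sopZ m n (a : R) (F : R -> 'M[C]_(m, n)) : L2m F -> sop (a%:C%C *: F) = `|a| * sop F.
Proof.
move=> LF; rewrite /sop -n2Z; last exact: sq_int_opnorm.
rewrite /n2; congr Num.sqrt; apply: eq_Rintegral => t _.
by rewrite opnormZ cabsr !exprMn real_normK // num_real.
Qed.

Lemma sop_cst m n (A : 'M[C]_(m, n)) : sop (fun=> A) = opnorm A.
Proof.
rewrite /sop /n2 rintegral_cst sqrtr_sqr ger0_norm //; exact: opnorm_ge0.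
Qed.

(** Supplies a nonzero vector for the case of zero norm, and a witness that [sigma_k] is
    nonnegative. *)
Lemma exists_unit_cst m n : (0 < m)%N -> (0 < n)%N ->
  exists2 F : R -> 'M[C]_(m, n), H2m F & sop F = 1.
Proof.
case: m n => [//|m] [//|n] _ _; pose A : 'M[C]_(m.+1, n.+1) := delta_mx 0 0.
have A0 : opnorm A != 0.
  rewrite opnorm_eq0; apply/eqP => /matrixP/(_ 0 0); rewrite !mxE !eqxx /= => /eqP.
  by rewrite oner_eq0.
exists (fun=> (opnorm A)^-1%:C%C *: A); first by move=> i j; exact: H2_cst.
rewrite sop_cst opnormZ cabsr ger0_norm; last by rewrite invr_ge0; exact: opnorm_ge0.
by rewrite mulVf.
Qed.

Section Fixed.
Variables (m n k : nat) (Phi : R -> 'M[C]_(m, n)).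
Hypothesis PhiL : entrywise (@Linf R) Phi.

Lemma L2m_hankel (F : R -> 'M[C]_(n, k)) : L2m F -> L2m (hankelk Phi F).
Proof.
move=> LF i j.
have -> : (fun t => hankelk Phi F t i j) = (fun t => \sum_l Phi t i l * F t l j).
  by apply/funext => t; rewrite mxE.
apply: L2_sum => l; have [mP [M bM]] := PhiL i l.
exact: (L2_bmul mP (LF l j) bM).
Qed.

Lemma hankelkZ (c : C) (F : R -> 'M[C]_(n, k)) : hankelk Phi (c *: F) = c *: hankelk Phi F.
Proof. by apply/funext => t; exact: (esym (scalemxAr c (Phi t) (F t))). Qed.

Lemma Acal_mul (F : R -> 'M[C]_(n, k)) (G : R -> 'M[C]_(k, m)) : H2m F -> H20m G ->
  sop F <= 1 -> sop G <= 1 -> Acal k (fun t => F t *m G t).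
Proof.
move=> HF HG F1 G1; have LF := H2m_L2m HF; have LG := H20m_L2m HG.
have LFG := L1mM LF LG.
split; [|split].
- move=> i j; apply: Hp0_intro => [|l l0]; first exact: LFG.
  have E : (fun t => (F t *m G t) i j * ek l t) =
      (fun t => \sum_p (F t i p * G t p j) * ek l t).
    by apply/funext => t; rewrite mxE mulr_suml.
  rewrite E cint_sum; last first.
    by move=> p; apply: L1_ek; apply: L2_mul; [exact: LF|exact: LG].
  by apply: big1 => p _; apply: (Hp0_coef (H2_mul_H20 (HF i p) (HG p j)) l0).
- have SF := sq_int_opnorm LF; have SG := sq_int_opnorm LG.
  have iFG := sq_int_mul SF SG.
  have le t : `|opnorm (F t *m G t)| <= opnorm (F t) * opnorm (G t).
    by rewrite ger0_norm ?opnorm_ge0 // opnormM.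
  have i1 : rint (fun t => opnorm (F t *m G t)).
    by apply: (rint_le _ iFG) => //; apply: meas_opnorm; exact: L1m_meas.
  rewrite /L1M /L1nrm (rintE (rint_norm i1)) lee_fin.
  apply: (@le_trans _ _ (n2 (fun t => opnorm (F t)) * n2 (fun t => opnorm (G t)))).
    by apply: le_trans (n2_CS SF SG); apply: le_rint => //; exact: rint_norm.
  rewrite -/(sop F) -/(sop G); apply: le_trans F1.
  by rewrite ler_piMr ?n2_ge0.
- by apply: aeT => t _; exact: mulmx_max_rank.
Qed.

Lemma pairing_mul (F : R -> 'M[C]_(n, k)) (G : R -> 'M[C]_(k, m)) :
  pairing Phi (fun t => F t *m G t) = cint (fun t => \tr (hankelk Phi F t *m G t)).
Proof. by rewrite /pairing; congr cint; apply/funext => t; rewrite mulmxA. Qed.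

Lemma pq_le_sigma (F : R -> 'M[C]_(n, k)) : H2m F -> sop F <= 1 ->
  ((pq (hankelk Phi F))%:E <= sigma_k k Phi)%E.
Proof.
move=> HF F1; have LX := L2m_hankel (H2m_L2m HF).
have [G [HG G1 <-]] := pq_attain LX.
apply: (@le_trans _ _ (cabs (pairing Phi (fun t => F t *m G t)))%:E).
  by rewrite lee_fin -pairing_mul; apply: le_trans (le_Re_cabs _); exact: ler_norm.
by apply: ereal_sup_ubound; exists (fun t => F t *m G t) => //; exact: Acal_mul.
Qed.

Lemma Acal_factor (Psi : R -> 'M[C]_(n, m)) : Acal k Psi ->
  exists (F : R -> 'M[C]_(n, k)) (G : R -> 'M[C]_(k, m)),
    [/\ H2m F, H20m G, sop F <= 1, sop G <= 1 &
        pairing Phi Psi = cint (fun t => \tr (hankelk Phi F t *m G t))].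
Proof.
move=> [HP [P1 Prank]]; have [F [G [HF HG H]]] := rank_factorization HP Prank.
have LF := H2m_L2m HF; have LG := H20m_L2m HG.
have mP : Mm Psi by move=> i j; case: (HP i j) => -[[]].
have mPhi : Mm Phi by move=> i j; case: (PhiL i j).
have mo : measurable_fun D (fun t => opnorm (Psi t)) by exact: meas_opnorm.
have iP : rint (fun t => opnorm (Psi t)).
  by apply: rint_measT => //; apply: le_lt_trans P1 _; rewrite ltry.
have I1 : \int[mu]_(t in D) opnorm (Psi t) <= 1.
  move: P1; rewrite /L1M /L1nrm (rintE (rint_norm iP)) lee_fin; apply: le_trans.
  by apply: le_rint => [//||t _]; [exact: rint_norm|exact: ler_norm].
have bnd p q (A : R -> 'M[C]_(p, q)) : L2m A ->
    {ae mu, forall t, D t -> opnorm (A t) ^+ 2 <= opnorm (Psi t)} -> sop A <= 1.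
  move=> LA HA; rewrite /sop /n2 -[leRHS]sqrtr1 ler_wsqrtr //; apply: le_trans I1.
  by apply: le_rint_ae => //; case: (sq_int_opnorm LA).
exists F, G; split => //.
- by apply: bnd => //; apply: (aeS _ H) => t + Dt => /(_ Dt)[].
- by apply: bnd => //; apply: (aeS _ H) => t + Dt => /(_ Dt)[].
- rewrite -pairing_mul; apply: cint_ae.
  + by apply: cmeas_sum => i; exact: (MmM mPhi mP).
  + by apply: cmeas_sum => i; exact: (MmM mPhi (MmM (L2m_meas LF) (L2m_meas LG))).
  + by apply: (aeS _ H) => t + Dt => /(_ Dt)[-> _ _].
Qed.

Lemma pairing_factor_le (F : R -> 'M[C]_(n, k)) (G : R -> 'M[C]_(k, m)) :
  H2m F -> H20m G -> sop G <= 1 ->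
  cabs (cint (fun t => \tr (hankelk Phi F t *m G t))) <= pq (hankelk Phi F).
Proof.
move=> HF HG G1; apply: le_trans (pairing_le (L2m_hankel (H2m_L2m HF)) HG) _.
by rewrite ler_piMr // pq_ge0.
Qed.

Lemma hankel_normE : hankel_norm k Phi = sigma_k k Phi.
Proof.
apply/eqP; rewrite eq_le; apply/andP; split; apply: ge_ereal_sup.
- move=> _ [F [HF F1] <-]; have LF := H2m_L2m HF.
  rewrite qnormE; last exact: L2m_hankel.
  by apply: pq_le_sigma => //; rewrite -lee_fin -L2ME.
- move=> _ [Psi AP <-]; have [F [G [HF HG F1 G1 ->]]] := Acal_factor AP.
  apply: (@le_trans _ _ (qnorm (hankelk Phi F))).
    rewrite qnormE; last by apply: L2m_hankel; exact: H2m_L2m.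
    by rewrite lee_fin pairing_factor_le.
  apply: ereal_sup_ubound; exists F => //; split => //.
  by rewrite L2ME ?lee_fin //; exact: H2m_L2m.
Qed.

(** Scaling by a positive majorant [a] of the norm, rather than by the norm itself, covers functions
    of norm zero. *)
Lemma pq_hankel_le (s a : R) (F : R -> 'M[C]_(n, k)) : sigma_k k Phi = s%:E -> H2m F ->
  0 < a -> sop F <= a -> pq (hankelk Phi F) <= a * s.
Proof.
move=> Es HF a0 Fa; have LF := H2m_L2m HF; have an0 := lt0r_neq0 a0.
have HaF := H2mZ (a^-1)%:C%C HF; have LaF := H2m_L2m HaF.
have -> : hankelk Phi F = a%:C%C *: hankelk Phi ((a^-1)%:C%C *: F).
  by rewrite -hankelkZ scalerA -rmorphM mulfV // scale1r.
apply: le_trans (pqZ_le (ltW a0) (L2m_hankel LaF)) _; rewrite ler_pM2l //.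
rewrite -lee_fin -Es; apply: pq_le_sigma => //.
by rewrite sopZ // gtr0_norm ?invr_gt0 // ler_pdivrMl // mulr1.
Qed.

Lemma maximizing_of_extremal (Psi : R -> 'M[C]_(n, m)) : (0 < n)%N -> (0 < k)%N ->
  k_extremal k Phi Psi -> exists F : R -> 'M[C]_(n, k), maximizing_vector Phi F.
Proof.
have mid (x : R) : 0 <= x -> x < 1 -> exists a : R, [/\ 0 < a, x <= a & a < 1].
  by move=> x0 x1; exists ((x + 1) / 2); split; lra.
move=> n0 k0 [AP [ReP _]]; move EPs : (complex.Re _) ReP => s ReP.
have [F1 HF1 E1] := exists_unit_cst n0 k0.
have s0 : 0 <= s.
  rewrite -lee_fin ReP; apply: le_trans (pq_le_sigma HF1 _); last by rewrite E1.
  by rewrite lee_fin pq_ge0.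
suff [F [HF F1' Fs]] : exists F : R -> 'M[C]_(n, k),
    [/\ H2m F, sop F = 1 & s <= pq (hankelk Phi F)].
  have LF := H2m_L2m HF; have LX := L2m_hankel LF.
  have Eq : pq (hankelk Phi F) = s.
    apply/eqP; rewrite eq_le Fs andbT.
    by have := pq_hankel_le (esym ReP) HF ltr01; rewrite F1' mul1r; apply.
  exists F; split; first exact: HF.
  rewrite (L2ME LF) F1' hankel_normE -ReP mule1 (qnormE LX) Eq; split; last by [].
  by apply/eqP; rewrite eqe oner_eq0.
(* For [s = 0] every vector of norm 1 is maximizing, whereas the factor of [Psi] may be zero. *)
have [s00|sn0] := eqVneq s 0.
  by exists F1; split; [exact: HF1|exact: E1|rewrite s00 pq_ge0].
have sp : 0 < s by rewrite lt_neqAle eq_sym sn0.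
have [F [G [HF HG F1' G1 EP]]] := Acal_factor AP.
have Fs : s <= pq (hankelk Phi F).
  apply: le_trans (pairing_factor_le HF HG G1); rewrite -EP -EPs.
  by apply: le_trans (le_Re_cabs _); exact: ler_norm.
exists F; split; [exact: HF| |exact: Fs].
(* A factor of norm less than 1 would give [s <= a * s] for some [a < 1], impossible for [s > 0]. So
   the factor automatically has norm 1. *)
apply/eqP; rewrite eq_le F1' leNgt; apply/negP => Flt.
have [a [a0 Fa a1]] : exists a : R, [/\ 0 < a, sop F <= a & a < 1].
  exact: (mid (sop F) (n2_ge0 _) Flt).
have := le_trans Fs (pq_hankel_le (esym ReP) HF a0 Fa).
by rewrite leNgt gtr_pMl // a1.
Qed.

Lemma extremal_of_maximizing (F : R -> 'M[C]_(n, k)) :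
  maximizing_vector Phi F -> exists Psi : R -> 'M[C]_(n, m), k_extremal k Phi Psi.
Proof.
move=> [HF [F0 EF]]; have LF := H2m_L2m HF; have LX := L2m_hankel LF.
move: F0 EF; rewrite (L2ME LF) (qnormE LX) hankel_normE; set c := sop F => F0 EF.
have c0 : 0 < c.
  by rewrite lt_neqAle n2_ge0 andbT eq_sym; apply/eqP => c0; apply: F0; rewrite c0.
have cn0 := lt0r_neq0 c0.
(* Finiteness is read off the maximizing identity: an infinite value times [c > 0] could not equal
   the real number [pq (hankelk Phi F)]. *)
have [s Es] : exists s : R, sigma_k k Phi = s%:E.
  move: EF; case: (sigma_k k Phi) => [s _|/eqP|/eqP]; first by exists s.
  - by rewrite gt0_mulye ?lte_fin.
  - by rewrite gt0_mulNye ?lte_fin.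
have {EF} Ep : pq (hankelk Phi F) = s * c by move: EF; rewrite Es -EFinM => -[].
have [G [HG G1 EG]] := pq_attain LX.
pose F' := (c^-1)%:C%C *: F; have HF' : H2m F' := H2mZ _ HF.
have F1 : sop F' <= 1.
  by rewrite sopZ // gtr0_norm ?invr_gt0 // -/c mulVf.
exists (fun t => F' t *m G t).
have AP : Acal k (fun t => F' t *m G t) by exact: Acal_mul.
have ReP : complex.Re (pairing Phi (fun t => F' t *m G t)) = s.
  rewrite pairing_mul hankelkZ.
  have -> : (fun t => \tr (((c^-1)%:C%C *: hankelk Phi F) t *m G t)) =
      (fun t => (c^-1)%:C%C * \tr (hankelk Phi F t *m G t)).
    apply/funext => t; rewrite -mxtraceZ scalemxAl; congr (\tr (_ *m _)).
  rewrite cintZ; last by apply: L1_tr; apply: L1mM => //; exact: H20m_L2m.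
  by rewrite ReZ EG Ep mulrCA mulVf // mulr1.
have leP : cabs (pairing Phi (fun t => F' t *m G t)) <= s.
  by rewrite -lee_fin -Es; apply: ereal_sup_ubound; exists (fun t => F' t *m G t).
split => //; rewrite ReP Es; split => //.
have s0 : 0 <= s by apply: le_trans leP; exact: cabs_ge0.
(* The real part already equals the bound [s] on the modulus, which leaves no room for an imaginary
   part. *)
have : cabs (pairing Phi (fun t => F' t *m G t)) ^+ 2 <= s ^+ 2.
  by rewrite ler_sqr ?nnegrE ?cabs_ge0.
rewrite sqr_cabs /cabs2 ReP gerDl => h; apply/eqP; rewrite -sqrf_eq0 eq_le h /=.
exact: sqr_ge0.
Qed.

End Fixed.
End Extremal.

Theorem theorem3p5 (R : realType) (m n k : nat) (Phi : R -> 'M[R[i]]_(m, n)) :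
  (1 < m)%N -> (1 < n)%N -> (1 <= k)%N -> (k <= minn m n)%N ->
  entrywise (@Linf R) Phi ->
  (exists Psi : R -> 'M[R[i]]_(n, m), k_extremal k Phi Psi) <->
  (exists F : R -> 'M[R[i]]_(n, k), maximizing_vector Phi F).
Proof.
move=> _ n1 k1 _ PhiL; split => [[Psi H]|[F H]].
- exact: (maximizing_of_extremal PhiL (ltnW n1) k1 H).
- exact: (extremal_of_maximizing PhiL H).
Qed.
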